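(* Let $v$ be a flow on a connected compact surface $S$. The orbit space $S/v$ is $T_2$ (Hausdorff) if and only if every point of $S$ is closed and the singular point set either is the whole surface $S$ or consists of at most two centers.
   Context: A surface is a two-dimensional paracompact manifold, possibly with boundary. A flow is a continuous $\mathbb{R}$-action $v\colon\mathbb{R}\times S\to S$, $v_t=v(t,\cdot)$. The orbit space $S/v$ is the quotient of $S$ by the relation $x\sim y$ iff $x,y$ lie on the same orbit. A point $x$ is singular if $v_t(x)=x$ for all $t$, periodic if it is not singular and $v_T(x)=x$ for some $T>0$, and closed if it is singular or periodic. A singular point $x$ is a center if it has an open neighbourhood $U$ such that $v|_U$ is topologically equivalent (via a homeomorphism mapping orbits to orbits preserving time orientation) to the flow generated by the vector field $(-y,x)$ on the open unit disk in $\mathbb{R}^2$. *)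

(* Defs.v *)
From HB Require Import structures.
From mathcomp Require Import all_boot all_order all_algebra.
From mathcomp Require Import all_classical all_reals all_analysis.
From mathcomp Require Import Rstruct Rstruct_topology.
Set Implicit Arguments. Unset Strict Implicit. Unset Printing Implicit Defensive.
Import Order.TTheory GRing.Theory Num.Theory.
Local Open Scope classical_set_scope.
Local Open Scope ring_scope.

Notation R := Rdefinitions.R.

Definition homeo_on (X Y : topologicalType) (A : set X) (B : set Y)
  (f : X -> Y) : Prop :=
  exists g : Y -> X,
    [/\ {within A, continuous f}, {within B, continuous g},
        (forall x, A x -> B (f x)) /\ (forall y, B y -> A (g y)),
        (forall x, A x -> g (f x) = x) & (forall y, B y -> f (g y) = y)].

Definition half_plane : set (R * R) := [set p | 0 <= p.2].

Definition unit_disk : set (R * R) := [set p | p.1 ^+ 2 + p.2 ^+ 2 < 1].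

Definition paracompact (S : topologicalType) : Prop :=
  forall (I : Type) (U : I -> set S),
    (forall i, open (U i)) -> \bigcup_i U i = setT ->
    exists (J : Type) (V : J -> set S),
      [/\ (forall j, open (V j)), \bigcup_j V j = setT,
          (forall j, exists i, V j `<=` U i) &
          (forall x : S, exists N : set S, nbhs x N /\ finite_set [set j | V j `&` N !=set0])].

Definition is_surface (S : topologicalType) : Prop :=
  [/\ hausdorff_space S, paracompact S &
      forall x : S, exists U : set S, [/\ open U, U x &
        exists (f : S -> R * R) (W : set (R * R)),
          open W /\ homeo_on U (W `&` half_plane) f]].

Definition is_flow (S : topologicalType) (v : R -> S -> S) : Prop :=
  [/\ continuous (fun p : R * S => v p.1 p.2),
      (forall x, v 0 x = x) &
      (forall s t x, v (s + t) x = v s (v t x))].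

Definition orbit (S : Type) (v : R -> S -> S) (x : S) : set S :=
  [set y | exists t, v t x = y].

(* The orbit space S/v: its points are the orbits, with the quotient topology
   (a set A of orbits is open iff its preimage under x |-> orbit x is open). *)
Definition orbit_space_open (S : topologicalType) (v : R -> S -> S)
  (A : set (set S)) : Prop := open (orbit v @^-1` A).

Definition orbit_space_T2 (S : topologicalType) (v : R -> S -> S) : Prop :=
  forall p q : set S, range (orbit v) p -> range (orbit v) q -> p <> q ->
    exists A B : set (set S),
      [/\ orbit_space_open v A, orbit_space_open v B, A p, B q & A `&` B = set0].

Definition singular_pt (S : Type) (v : R -> S -> S) (x : S) : Prop :=
  forall t, v t x = x.

Definition periodic_pt (S : Type) (v : R -> S -> S) (x : S) : Prop :=
  ~ singular_pt v x /\ exists T : R, 0 < T /\ v T x = x.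

Definition closed_point (S : Type) (v : R -> S -> S) (x : S) : Prop :=
  singular_pt v x \/ periodic_pt v x.

(* flow generated by the vector field (-y, x) *)
Definition rot (t : R) (p : R * R) : R * R :=
  (p.1 * cos t - p.2 * sin t, p.1 * sin t + p.2 * cos t).

(* x is a center: singular, with an open (invariant) neighbourhood U on which
   v is topologically equivalent to the rotation flow on the open unit disk:
   a homeomorphism h : U -> disk sending each orbit onto an orbit, with time
   orientation preserved (via an increasing homeomorphism tau of R). *)
Definition center_pt (S : topologicalType) (v : R -> S -> S) (x : S) : Prop :=
  singular_pt v x /\
  exists U : set S, [/\ open U, U x, (forall t y, U y -> U (v t y)) &
    exists h : S -> R * R, homeo_on U unit_disk h /\
      forall y, U y -> exists tau : R -> R,
        [/\ continuous tau, {homo tau : a b / a < b},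
            (forall s, exists t, tau t = s) &
            (forall t, h (v t y) = rot (tau t) (h y))]].

(* Main.v *)
Require Import Defs.
From HB Require Import structures.
From mathcomp Require Import all_boot all_order all_algebra.
From mathcomp Require Import all_classical all_reals all_analysis.
From mathcomp Require Import Rstruct Rstruct_topology.
From mathcomp Require Import ring lra.
Set Implicit Arguments. Unset Strict Implicit. Unset Printing Implicit Defensive.
Import Order.TTheory GRing.Theory Num.Theory.
Import numFieldNormedType.Exports.
Import mathcomp.analysis.trigo.
Local Open Scope classical_set_scope.
Local Open Scope ring_scope.

(* Suppose that the orbits are separated. They are then closed, hence (by recurrence
   and a Baire argument) points or circles, and every orbit is stable. On such a flow
   the Hausdorff distance D between orbits is a continuous pseudo-metric vanishing
   exactly on pairs of points of one orbit. Loop-erasing, relatively to D, a path that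
   runs through nonsingular points to a singular point x yields an arc of distinct
   orbits ending at x. Flow boxes and first return maps show that the orbits near a
   periodic orbit form an open interval or, next to the boundary or to the core of a
   Moebius band, a half-open one, whose end point cannot lie inside an arc; so all
   inner orbits of the arc have continuous periods, and sweeping a section over the
   arc by the flow gives a continuous injection of the disk sending 0 to x. By
   invariance of domain it is open: x is a center. If there are two singular points,
   some arc joins two of them; the union of its orbits is open and closed, hence is S.
   Conversely centers and periodic orbits are stable, and D separates the orbits. *)

(** Both directions meet in two facts: every point is closed, and every orbit has small invariant
    neighbourhoods. From these the distance D is built, once from separation and once from the
    centers. The obstacle is that the flow is only continuous, so no transversal is given. Averaging
    a function along the flow makes it increasing, and a level set of the average is a section, but
    a priori a bare set. Plane topology in a chart shows that near a point it is an arc, with that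
    point inside it or at its end; the second case is where the boundary enters. A closed orbit
    meets a section finitely often. This rigidity forces an increasing first return map to be the
    identity and a decreasing one to be an involution. Loop erasure relative to D controls orbits
    and not points: the arc it yields may jump along orbits, so a genuinely continuous
    representative has to be rebuilt from local sections, glued after a shift in time. Invariance of
    domain is proved by winding numbers. It serves three times: to open up flow boxes, to show that
    a section is more than a point, and to show that the swept disk is open. *)

(** * Tools: continuity at a point, compactness, connectedness *)

Section ContinuityAtPoint.
Context {K : realType} {T : topologicalType}.
Implicit Types x : T.

(** Continuity at a point under a name of its own, so that the tactic [cts] can choose a rule by the
    syntactic shape of the function. *)
Definition cts_at (U : topologicalType) (f : T -> U) x := f @ x --> f x.

Lemma cts_at_continuous (U : topologicalType) (f : T -> U) x :
  cts_at f x -> {for x, continuous f}.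
Proof. by []. Qed.

Lemma cts_addr (V : normedModType K) (f g : T -> V) x :
  cts_at f x -> cts_at g x -> cts_at (fun y => f y + g y) x.
Proof. by move=> cf cg; apply: cvgD. Qed.

Lemma cts_oppr (V : normedModType K) (f : T -> V) x : cts_at f x -> cts_at (fun y => - f y) x.
Proof. by move=> cf; apply: cvgN. Qed.

Lemma cts_mulr (f g : T -> K) x :
  cts_at f x -> cts_at g x -> cts_at (fun y => f y * g y) x.
Proof. by move=> cf cg; apply: cvgM. Qed.

Lemma cts_scale (V : normedModType K) (f : T -> K) (g : T -> V) x :
  cts_at f x -> cts_at g x -> cts_at (fun y => f y *: g y) x.
Proof. by move=> cf cg; apply: cvgZ. Qed.

Lemma cts_invr (f : T -> K) x :
  f x != 0 -> cts_at f x -> cts_at (fun y => (f y)^-1) x.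
Proof. by move=> f0 cf; apply: cvgV. Qed.

Lemma cts_cst (U : topologicalType) (a : U) x : cts_at (fun=> a) x.
Proof. exact: cvg_cst. Qed.

Lemma cts_id x : cts_at (fun y => y) x.
Proof. exact: cvg_id. Qed.

Lemma cts_comp (U W : topologicalType) (f : T -> U) (g : U -> W) x :
  cts_at f x -> g @ f x --> g (f x) -> cts_at (fun y => g (f y)) x.
Proof. exact: cvg_comp. Qed.

Lemma cts_pair (U W : topologicalType) (f : T -> U) (g : T -> W) x :
  cts_at f x -> cts_at g x -> cts_at (fun y => (f y, g y)) x.
Proof. by move=> cf cg; apply: cvg_pair. Qed.

Lemma cts_fst (U W : topologicalType) (f : T -> U * W) x :
  cts_at f x -> cts_at (fun y => (f y).1) x.
Proof. by move=> cf; apply: (cts_comp (g := fst)) => //; apply: cvg_fst. Qed.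

Lemma cts_snd (U W : topologicalType) (f : T -> U * W) x :
  cts_at f x -> cts_at (fun y => (f y).2) x.
Proof. by move=> cf; apply: (cts_comp (g := snd)) => //; apply: cvg_snd. Qed.

Lemma cts_max (f g : T -> K) x :
  cts_at f x -> cts_at g x -> cts_at (fun y => Num.max (f y) (g y)) x.
Proof. exact: continuous_max. Qed.

Lemma cts_min (f g : T -> K) x :
  cts_at f x -> cts_at g x -> cts_at (fun y => Num.min (f y) (g y)) x.
Proof. exact: continuous_min. Qed.

Lemma cts_abs (V : normedModType K) (f : T -> V) x :
  cts_at f x -> cts_at (fun y => `|f y|) x.
Proof. by move=> cf; apply: cvg_norm. Qed.

Lemma cts_cos (f : T -> K) x : cts_at f x -> cts_at (fun y => cos (f y)) x.
Proof. by move=> cf; apply: (cts_comp (g := @cos K)) => //; exact: continuous_cos. Qed.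

Lemma cts_sin (f : T -> K) x : cts_at f x -> cts_at (fun y => sin (f y)) x.
Proof. by move=> cf; apply: (cts_comp (g := @sin K)) => //; exact: continuous_sin. Qed.

Lemma cts_atan (f : T -> K) x : cts_at f x -> cts_at (fun y => atan (f y)) x.
Proof. by move=> cf; apply: (cts_comp (g := @atan K)) => //; exact: continuous_atan. Qed.

Lemma cts_near_gt0 (f : T -> K) x :
  cts_at f x -> 0 < f x -> \forall y \near x, 0 < f y.
Proof. by move=> cf; exact: (cvgr_gt (f x) cf). Qed.

Lemma cts_near_lt (f : T -> K) (a : K) x :
  cts_at f x -> f x < a -> \forall y \near x, f y < a.
Proof. by move=> cf; exact: (cvgr_lt (f x) cf). Qed.

End ContinuityAtPoint.

(** Retraction of the line onto [a, b]; composing with it turns a map that is only controlled on an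
    interval into a total continuous one. *)
Definition clamp {K : realType} (a b x : K) : K := Num.max a (Num.min b x).

Lemma clamp_in {K : realType} (a b x : K) : a <= b -> a <= clamp a b x <= b.
Proof. by move=> ab; rewrite /clamp le_max lexx /= ge_max ab ge_min lexx. Qed.

Lemma clampE {K : realType} (a b x : K) : a <= x <= b -> clamp a b x = x.
Proof. by move=> /andP[ax xb]; rewrite /clamp min_r // max_r. Qed.

Lemma cts_clamp {K : realType} (T : topologicalType) (f : T -> K) a b x :
  cts_at f x -> cts_at (fun y => clamp a b (f y)) x.
Proof. by move=> cf; apply: cts_max; [exact: cts_cst | apply: cts_min => //; exact: cts_cst]. Qed.

Ltac cts1 := first [ assumption
  | match goal with H : continuous ?f |- cts_at ?f _ => exact: H end
  | match goal with H : forall x, cts_at ?f x |- cts_at ?f _ => exact: H end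
  | match goal with
    | |- cts_at (fun y => y) _ => exact: cts_id
    | |- cts_at (fun y => ?a) _ => exact: cts_cst
    | |- cts_at (fun y => _ + _) _ => apply: cts_addr
    | |- cts_at (fun y => - _) _ => apply: cts_oppr
    | |- cts_at (fun y => _ * _) _ => apply: cts_mulr
    | |- cts_at (fun y => _ *: _) _ => apply: cts_scale
    | |- cts_at (fun y => (_, _)) _ => apply: cts_pair
    | |- cts_at (fun y => @Order.max _ _ _ _) _ => apply: cts_max
    | |- cts_at (fun y => @Order.min _ _ _ _) _ => apply: cts_min
    | |- cts_at (fun y => `|_|) _ => apply: cts_abs
    | |- cts_at (fun y => cos _) _ => apply: cts_cos
    | |- cts_at (fun y => sin _) _ => apply: cts_sin
    | |- cts_at (fun y => atan _) _ => apply: cts_atan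
    | |- cts_at (@GRing.mul _ ?a) ?x => apply: (@cts_mulr _ _ (fun=> a) (fun y => y) x)
    | |- cts_at (@GRing.add _ ?a) ?x => apply: (@cts_addr _ _ _ (fun=> a) (fun y => y) x)
    | |- cts_at (clamp ?a ?b) ?x => apply: (@cts_clamp _ _ (fun y => y) a b x)
    | |- cts_at fst _ => exact: cvg_fst
    | |- cts_at snd _ => exact: cvg_snd
    | |- cts_at (fun y => clamp _ _ _) _ => apply: cts_clamp
    | |- cts_at (fun y => fst _) _ => apply: cts_fst
    | |- cts_at (fun y => snd _) _ => apply: cts_snd
    end
  | match goal with H : continuous ?h |- cts_at (fun y => ?h (@?k y)) _ =>
      apply: (cts_comp (f := k) (g := h)); [ | exact: H] end
  | match goal with H : forall x, cts_at ?h x |- cts_at (fun y => ?h (@?k y)) _ =>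
      apply: (cts_comp (f := k) (g := h)); [ | exact: H] end ].
Ltac cts :=
  try (lazymatch goal with
       | |- cts_at _ _ => fail
       | |- continuous_at _ _ => apply: cts_at_continuous
       end);
  repeat cts1.

(** The tube lemma in filter form. Most uniform choices below are instances of it, with K a segment,
    a square or the whole surface. *)
Lemma compact_near_forall (X Y : topologicalType) (K : set X) (y0 : Y)
    (Q : X -> Y -> Prop) :
  compact K ->
  (forall x, K x -> \forall p \near (x, y0), Q p.1 p.2) ->
  \forall y \near y0, forall x, K x -> Q x y.
Proof.
move=> /compact_near_coveringP cK H.
apply: (cK Y (nbhs y0) (fun y x => Q x y)) => x Kx.
by have := H x Kx; apply: filterS => -[].
Qed.

(** The points of C satisfying P form a relatively open and closed subset. Continuation arguments
    below are put in this form. *)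
Lemma connected_locally_constant (X : topologicalType) (C : set X)
    (P : X -> Prop) : connected C ->
  (forall x, C x -> \forall y \near x, C y -> (P y <-> P x)) ->
  forall x y, C x -> C y -> P x -> P y.
Proof.
move=> cC H x y Cx Cy Px.
have E : C `&` [set z | P z] = C.
  apply: cC.
  - by exists x.
  - exists (interior [set z | C z -> P z]); first exact: open_interior.
    apply/seteqP; split => z [Cz Pz]; split => //.
      by near=> w => Cw; apply/(near (H z Cz) w).
    exact: (nbhs_singleton Pz).
  - exists (~` interior [set z | C z -> ~ P z]).
      by apply: open_closedC; exact: open_interior.
    apply/seteqP; split => z [Cz Pz]; split => //.
      by move=> /nbhs_singleton /(_ Cz).
    apply: contrapT => nP; apply: Pz.
    by near=> w => Cw Pw; apply: nP; apply/(near (H z Cz) w).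
by have : C y by []; rewrite -E => -[].
Unshelve. all: by end_near. Qed.

Section Angles.
Variable K : realType.
Implicit Types (a b t s l h : K) (u : K * K) (g : K -> K * K).

Lemma segment_locally_constant (a b : K) (P : K -> Prop) :
  (forall x, a <= x <= b -> \forall y \near x, a <= y <= b -> (P y <-> P x)) ->
  forall x y, a <= x <= b -> a <= y <= b -> P x -> P y.
Proof.
move=> H x y xab yab.
have cC := @segment_connected _ a b.
by apply: (connected_locally_constant cC); rewrite /= ?in_itv.
Qed.

(** * Angles and winding *)

Definition dot (u w : K * K) : K := u.1 * w.1 + u.2 * w.2.
Definition det2 (u w : K * K) : K := u.1 * w.2 - u.2 * w.1.

(** The arguments of a nonzero vector, as a relation: they are determined modulo 2 pi only. *)
Definition angle_of (a : K) (u : K * K) : Prop :=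
  exists2 r : K, 0 < r & u = (r * cos a, r * sin a).

Lemma dot_gt0 u : u <> 0 -> 0 < dot u u.
Proof.
case: u => a b H; rewrite /dot /= -!expr2 lt_neqAle addr_ge0 ?sqr_ge0 // andbT eq_sym.
apply/negP; rewrite paddr_eq0 ?sqr_ge0 // !sqrf_eq0 => /andP[/eqP a0 /eqP b0].
by apply: H; rewrite a0 b0.
Qed.

Lemma dotC u w : dot u w = dot w u.
Proof. by rewrite /dot; ring. Qed.

Lemma angle_of_neq0 a u : angle_of a u -> u <> 0.
Proof.
move=> [r r0 ->] [/eqP + /eqP]; rewrite !mulf_eq0 (gt_eqF r0) /= => /eqP c /eqP s.
by have := cos2Dsin2 a; rewrite c s !expr0n /= addr0 => /esym/eqP; rewrite oner_eq0.
Qed.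

(** The quotient of determinant by scalar product is the tangent of the angle from u to w, and
    [atan] recovers that angle when it is acute. Arguments can thus be followed by a formula that is
    visibly continuous. *)
Lemma angle_of_turn a u w : angle_of a u -> 0 < dot u w ->
  angle_of (a + atan (det2 u w / dot u w)) w.
Proof.
move=> [r r0 ->] D0; set u' := (_, _) in D0 *.
set D := dot u' w in D0 *; set E := det2 u' w; set x := E / D.
have qE := cos_atan x; set q := cos (atan x) in qE.
have q0 : 0 < q by rewrite qE invr_gt0 sqrtr_gt0 ltr_pwDl // sqr_ge0.
have sE : sin (atan x) = x * q.
  by have := atanK x; rewrite /tan -/q => /(congr1 (fun z => z * q)); rewrite divfK ?gt_eqF.
exists (D / (r * q)); first by rewrite divr_gt0 // mulr_gt0.
have cs := cos2Dsin2 a; have r0' := lt0r_neq0 r0; have q0' := lt0r_neq0 q0.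
have D0' := lt0r_neq0 D0.
rewrite cosD sinD sE -/q [LHS]surjective_pairing; congr pair.
  have -> : D / (r * q) * (cos a * q - sin a * (x * q)) = (D * cos a - E * sin a) / r.
    by rewrite /x; field; rewrite r0' q0' D0'.
  rewrite /D /E /dot /det2 /=.
  have -> : (r * cos a * w.1 + r * sin a * w.2) * cos a -
    (r * cos a * w.2 - r * sin a * w.1) * sin a = r * w.1 * (cos a ^+ 2 + sin a ^+ 2) by ring.
  by rewrite cs mulr1 mulrAC divff // mul1r.
have -> : D / (r * q) * (sin a * q + cos a * (x * q)) = (D * sin a + E * cos a) / r.
  by rewrite /x; field; rewrite r0' q0' D0'.
rewrite /D /E /dot /det2 /=.
have -> : (r * cos a * w.1 + r * sin a * w.2) * sin a +
  (r * cos a * w.2 - r * sin a * w.1) * cos a = r * w.2 * (cos a ^+ 2 + sin a ^+ 2) by ring.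
by rewrite cs mulr1 mulrAC divff // mul1r.
Qed.

(** One of the four axis directions makes an acute angle with u; turn from there. *)
Lemma angle_of_exists u : u <> 0 -> exists a, angle_of a u.
Proof.
have H a : 0 < dot (cos a, sin a) u -> exists b, angle_of b u.
  move=> d; eexists; apply: (@angle_of_turn a (cos a, sin a)) => //.
  by exists 1 => //; rewrite !mul1r.
case: u H => u1 u2 H u0.
case: (ltrgtP u1 0) => h1.
- by apply: (H pi); rewrite /dot cospi sinpi /=; lra.
- by apply: (H 0); rewrite /dot cos0 sin0 /=; lra.
- case: (ltrgtP u2 0) => h2.
  + by apply: (H (- (pi / 2))); rewrite /dot cosN sinN cos_pihalf sin_pihalf /=; lra.
  + by apply: (H (pi / 2)); rewrite /dot cos_pihalf sin_pihalf /=; lra.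
  + by case: u0; rewrite h1 h2.
Qed.

(** Throughout, [cos (a - b) = 1] stands for equality modulo 2 pi. *)
Lemma angle_of_cos a b u : angle_of a u -> angle_of b u -> cos (a - b) = 1.
Proof.
move=> [r r0 ->] [s s0 [E1 E2]].
have ca := cos2Dsin2 a; have cb := cos2Dsin2 b.
have rs : r = s.
  apply/eqP; rewrite -(@eqrXn2 _ 2) ?ltW //; apply/eqP.
  have -> : r ^+ 2 = (r * cos a) ^+ 2 + (r * sin a) ^+ 2 by rewrite !exprMn -mulrDr ca mulr1.
  by rewrite E1 E2 !exprMn -mulrDr cb mulr1.
have r0' := lt0r_neq0 r0.
have {}E1 : cos a = cos b by apply: (mulfI r0'); rewrite E1 rs.
have {}E2 : sin a = sin b by apply: (mulfI r0'); rewrite E2 rs.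
by rewrite cosB E1 E2 -!expr2 cb.
Qed.

Lemma cos_eq1_small (d : K) : cos d = 1 -> `|d| < 1 -> d = 0.
Proof.
move=> c1 d1; have pi2 := @pi_ge2 K.
have : `|d| = 0.
  apply: cos_inj; rewrite ?in_itv /= ?normr_ge0 ?lexx ?pi_ge0 //=.
    by apply: (le_trans (ltW d1)); apply: le_trans pi2; rewrite ler1n.
  by rewrite cos0 -c1; case: ger0P; rewrite ?cosN.
by move/eqP; rewrite normr_eq0 => /eqP.
Qed.

(** The values of f lie in one coset of the discrete group of multiples of 2 pi. *)
Lemma angle_diff_constant a b (f : K -> K) :
  continuous f ->
  (forall x y, a <= x <= b -> a <= y <= b -> cos (f x - f y) = 1) ->
  forall x y, a <= x <= b -> a <= y <= b -> f x = f y.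
Proof.
move=> cf H x y Cx Cy.
apply: (@segment_locally_constant a b (fun z => f x = f z)) Cx Cy _ => // z Cz.
have /cvgrPdist_lt /(_ 1 ltr01) := cf z; apply: filterS => w d Cw.
suff -> : f w = f z by [].
by rewrite -[f w]addr0 -[0](cos_eq1_small (H z w Cz Cw) d) addrC subrK.
Qed.

Definition unit_square : set (K * K) := `[0, 1]%classic `*` `[0, 1]%classic.

Lemma unit_squareE p : unit_square p = ((0 <= p.1 <= 1) /\ (0 <= p.2 <= 1)).
Proof. by rewrite /unit_square /setX /= !in_itv. Qed.

Lemma unit_square_compact : compact unit_square.
Proof. by apply: compact_setX; exact: segment_compact. Qed.

(** The square is shrunk to a corner by the scalings [sc l]. A constant argument works for l = 0,
    and by the tube lemma an argument for one l can be turned into one for all nearby l, uniformly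
    on the square. *)
Lemma continuous_angle (F : K * K -> K * K) : continuous F ->
  (forall p, unit_square p -> F p <> 0) ->
  exists2 theta : K * K -> K, continuous theta &
    forall p, unit_square p -> angle_of (theta p) (F p).
Proof.
move=> cF F0.
pose sc (l : K) (p : K * K) : K * K := (l * p.1, l * p.2).
pose P l := exists2 th : K * K -> K, continuous th &
  forall p, unit_square p -> angle_of (th p) (F (sc l p)).
pose cl (p : K * K) : K * K := (clamp 0 1 p.1, clamp 0 1 p.2).
have cl_in p : unit_square (cl p) by rewrite unit_squareE /=; split; apply: clamp_in.
have clE p : unit_square p -> cl p = p.
  by rewrite unit_squareE /cl; case: p => a b /= [? ?]; rewrite !clampE.
have ccl p : cts_at cl p by apply: cts_pair; apply: cts_clamp; cts.
have sc_in l p : 0 <= l <= 1 -> unit_square p -> unit_square (sc l p).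
  rewrite !unit_squareE /= => /andP[l0 l1] [/andP[a0 a1] /andP[b0 b1]].
  by rewrite !mulr_ge0 ?mulr_ile1.
have step l0 l : (forall p, unit_square p -> 0 < dot (F (sc l0 p)) (F (sc l p))) -> P l0 -> P l.
  move=> d [th cth H].
  exists (fun p => th p + atan (det2 (F (sc l0 (cl p))) (F (sc l (cl p))) /
    dot (F (sc l0 (cl p))) (F (sc l (cl p))))).
    move=> p.
    apply: cts_addr; first by cts.
    apply: cts_atan; apply: cts_mulr; first by rewrite /det2 /sc; cts.
    by apply: cts_invr; [rewrite gt_eqF // d | rewrite /dot /sc; cts].
  by move=> p Ip; rewrite clE //; apply: angle_of_turn; [exact: H | exact: d].
have P0 : P 0.
  have /angle_of_exists[a Ha] : F (0, 0) <> 0.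
    by apply: F0; rewrite unit_squareE /= lexx ler01.
  exists (fun=> a); first by move=> p; exact: cts_cst.
  by move=> p _; rewrite /sc !mul0r.
have P1 : P 1.
  apply: (@segment_locally_constant 0 1 P _ 0); rewrite ?lexx ?ler01 // => l0 l01.
  have : \forall l \near l0, forall p, unit_square p ->
      0 < dot (F (sc l0 p)) (F (sc l p)).
    apply: (@compact_near_forall _ _ unit_square l0
      (fun p l => 0 < dot (F (sc l0 p)) (F (sc l p)))); first exact: unit_square_compact.
    move=> p Ip; apply: (cts_near_gt0 (f := fun q : (K * K) * K =>
       dot (F (sc l0 q.1)) (F (sc q.2 q.1)))); last first.
      by apply: dot_gt0; apply: F0; exact: sc_in.
    have c1 : cts_at (fun q : (K * K) * K => F (sc l0 q.1)) (p, l0).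
      by rewrite /sc; cts.
    have c2 : cts_at (fun q : (K * K) * K => F (sc q.2 q.1)) (p, l0).
      by rewrite /sc; cts.
    by rewrite /dot; cts.
  apply: filterS => l H _; split; apply: step => // p Ip.
  by rewrite dotC; exact: H.
case: P1 => th cth H; exists th => // p Ip.
by have := H p Ip; rewrite /sc !mul1r; case: (p).
Qed.

Lemma cos_unit_sub (a b : K) : cos a = cos b -> cos b ^+ 2 = 1 -> cos (a - b) = 1.
Proof.
move=> ab b1; have sb : sin b = 0.
  by apply/eqP; rewrite -sqrf_eq0 sin2cos2 b1 subrr.
by rewrite cosB ab sb mulr0 addr0 -expr2.
Qed.

(** Total variation of the argument along [0, 1], not divided by 2 pi; the path need not close
    up. *)
Definition winding (g : K -> K * K) (w : K) : Prop :=
  exists2 th : K -> K, continuous th &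
    (forall t, 0 <= t <= 1 -> angle_of (th t) (g t)) /\ th 1 - th 0 = w.

Lemma winding_ext g g' w : (forall t, 0 <= t <= 1 -> g t = g' t) ->
  winding g w -> winding g' w.
Proof. by move=> E [th cth [H tw]]; exists th => //; split=> // t t01; rewrite -E //; exact: H. Qed.

Lemma winding_unique g w w' : winding g w -> winding g w' -> w = w'.
Proof.
move=> [th cth [H <-]] [th' cth' [H' <-]].
suff : th 1 - th' 1 = th 0 - th' 0 by lra.
apply: (@angle_diff_constant 0 1 (fun t => th t - th' t) _ _ 1 0); last 2 first.
- by rewrite lexx ler01.
- by rewrite lexx ler01.
- by move=> x; cts.
- move=> x y Hx Hy; apply: cos_unit_sub.
    by rewrite (angle_of_cos (H x Hx) (H' x Hx)) (angle_of_cos (H y Hy) (H' y Hy)).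
  by rewrite (angle_of_cos (H y Hy) (H' y Hy)) expr1n.
Qed.

(** As the loops close up, [th (s, 1) - th (s, 0)] is a multiple of 2 pi; being continuous in s, it
    is constant. *)
Lemma winding_homotopy (H : K * K -> K * K) w : continuous H ->
  (forall p, unit_square p -> H p <> 0) ->
  (forall s, 0 <= s <= 1 -> H (s, 0) = H (s, 1)) ->
  winding (fun t => H (0, t)) w -> winding (fun t => H (1, t)) w.
Proof.
move=> cH H0 H01 w0; have [th cth A] := continuous_angle cH H0.
have cS s : continuous (fun t => th (s, t)).
  by move=> t; cts.
have W s : 0 <= s <= 1 -> winding (fun t => H (s, t)) (th (s, 1) - th (s, 0)).
  move=> s01; exists (fun t => th (s, t)) => //; split=> // t t01.
  by apply: A; rewrite unit_squareE.
have i0 : 0 <= (0 : K) <= 1 by rewrite lexx ler01.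
have i1 : 0 <= (1 : K) <= 1 by rewrite lexx ler01.
rewrite (winding_unique w0 (W _ i0)).
suff <- : th (1, 1) - th (1, 0) = th (0, 1) - th (0, 0) by exact: W.
apply: (@angle_diff_constant 0 1 (fun t => th (t, 1) - th (t, 0)) _ _ 1 0) => //.
- by move=> x; cts.
- have c1 s : 0 <= s <= 1 -> cos (th (s, 1) - th (s, 0)) = 1.
    move=> s01; apply: (angle_of_cos (u := H (s, 1))).
      by apply: A; rewrite unit_squareE.
    by rewrite -H01 //; apply: A; rewrite unit_squareE.
  by move=> x y Hx Hy; apply: cos_unit_sub; rewrite !c1 ?expr1n.
Qed.

Lemma angle_of_opp a u : angle_of a u -> angle_of (a + pi) (- u).
Proof.
move=> [r r0 ->]; exists r => //.
by rewrite cosDpi sinDpi !mulrN.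
Qed.

(** Passing from t to t + h reverses the vector, so it adds an odd multiple of pi to the argument,
    the same one for all t by continuity. *)
Lemma winding_odd (g : K -> K * K) w h : 0 <= h <= 1 ->
  (forall t, 0 <= t <= 1 - h -> g (t + h) = - g t) -> winding g w ->
  exists c, cos c = -1 /\ exists2 th : K -> K, th 1 - th 0 = w &
    forall t, 0 <= t <= 1 - h -> th (t + h) = th t + c.
Proof.
move=> /andP[h0 h1] odd_g [th cth [H thw]].
have E t : 0 <= t <= 1 - h -> cos (th (t + h) - th t) = -1.
  move=> t01; have /angle_of_opp Ht : angle_of (th t) (g t) by apply: H; lra.
  have Hth : angle_of (th (t + h)) (- g t) by rewrite -odd_g //; apply: H; lra.
  have := angle_of_cos Hth Ht.
  have -> : th (t + h) - (th t + pi) = - (pi - (th (t + h) - th t)) by ring.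
  by rewrite cosN addrC cosDpi cosN => <-; rewrite opprK.
exists (th h - th 0); split; first by have := E 0; rewrite add0r => -> //; lra.
exists th => // t t01.
suff : th (t + h) - th t = th (0 + h) - th 0 by rewrite add0r; lra.
apply: (@angle_diff_constant 0 (1 - h) (fun t => th (t + h) - th t) _ _ t 0) => //.
- by move=> x; cts.
- by move=> x y Hx Hy; apply: cos_unit_sub; rewrite !E // sqrrN expr1n.
- by rewrite lexx subr_ge0.
Qed.

Lemma winding_odd_half (g : K -> K * K) w :
  (forall t, 0 <= t <= 2^-1 -> g (t + 2^-1) = - g t) -> winding g w ->
  exists2 c, cos c = -1 & w = c *+ 2.
Proof.
move=> odd_g /(@winding_odd _ _ 2^-1)[|t t01|c [c1 [th <- H]]].
- by lra.
- by apply: odd_g; lra.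
exists c => //.
have E0 : th 2^-1 = th 0 + c by rewrite -H ?add0r //; lra.
have E1 : th 1 = th 2^-1 + c by rewrite -H; [congr th; lra | lra].
by rewrite E1 E0; ring.
Qed.

(** All vectors make an acute angle with u, so one formula gives the argument along the whole loop,
    and it takes equal values at both ends. *)
Lemma winding_half_plane (g : K -> K * K) u : continuous g -> g 0 = g 1 ->
  (forall t, 0 <= t <= 1 -> 0 < dot u (g t)) -> winding g 0.
Proof.
move=> cg g01 d.
have c0 t : 0 <= clamp 0 1 t <= 1 by apply: clamp_in.
have i0 : 0 <= (0 : K) <= 1 by rewrite lexx ler01.
have i1 : 0 <= (1 : K) <= 1 by rewrite lexx ler01.
have u0 : u <> 0.
  by move=> u0; have := d 0 i0; rewrite u0 /dot /= !mul0r addr0 ltxx.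
have [a Ha] := angle_of_exists u0.
exists (fun t => a + atan (det2 u (g (clamp 0 1 t)) / dot u (g (clamp 0 1 t)))).
  move=> t; have cgc : cts_at (fun t => g (clamp 0 1 t)) t.
    by cts; apply: cts_clamp; cts.
  apply: cts_addr; first by cts.
  apply: cts_atan; apply: cts_mulr; first by rewrite /det2; cts.
  by apply: cts_invr; [rewrite gt_eqF // d | rewrite /dot; cts].
split; last by rewrite !clampE // g01 subrr.
by move=> t t01; rewrite clampE //; apply: angle_of_turn => //; exact: d.
Qed.

Lemma winding_odd_neq0 (g : K -> K * K) :
  (forall t, 0 <= t <= 2^-1 -> g (t + 2^-1) = - g t) -> ~ winding g 0.
Proof.
move=> odd_g /(winding_odd_half odd_g)[c c1 /esym/eqP].
rewrite mulrn_eq0 /= => /eqP c0.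
by move: c1; rewrite c0 cos0 => /eqP; rewrite eq_sym -subr_eq0 => /eqP; lra.
Qed.

(** * Invariance of domain in the plane *)

Definition circle (t : K) : K * K := (cos (pi *+ 2 * t), sin (pi *+ 2 * t)).

Lemma circle_half t : circle (t + 2^-1) = - circle t.
Proof.
rewrite /circle (_ : pi *+ 2 * (t + 2^-1) = pi *+ 2 * t + pi); last by field.
by rewrite cosDpi sinDpi.
Qed.

Lemma circle01 : circle 0 = circle 1.
Proof. by rewrite /circle mulr0 mulr1 cos0 sin0 cos2pi sin2pi. Qed.

Lemma cts_circle (T : topologicalType) (f : T -> K) x :
  cts_at f x -> cts_at (fun y => circle (f y)) x.
Proof. by move=> cf; rewrite /circle; cts. Qed.

(* The homotopy f(x) - f(-l x) joins f(x) - f(0) to the odd loop f(x) - f(-x),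
   whose winding number is odd; a point q missed by f would make it zero. *)
Lemma disk_image_contains (f : K * K -> K * K) (q : K * K) : continuous f ->
  (forall t l, 0 <= t <= 1 -> 0 <= l <= 1 ->
     f (circle t) <> f (- (l *: circle t))) ->
  (forall t l, 0 <= t <= 1 -> 0 <= l <= 1 ->
     f (circle t) <> f 0 + l *: (q - f 0)) ->
  exists t r, [/\ 0 <= t <= 1, 0 <= r <= 1 & f (r *: circle t) = q].
Proof.
move=> cf Hodd Hq; apply: contrapT => nq.
have cc (T : topologicalType) (k : T -> K) x :
    cts_at k x -> cts_at (fun y => circle (k y)) x by exact: cts_circle.
have i0 : 0 <= (0 : K) <= 1 by rewrite lexx ler01.
have i1 : 0 <= (1 : K) <= 1 by rewrite lexx ler01.
have w1 : winding (fun t => f (circle t) - q) 0.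
  apply: (@winding_ext (fun t => f (1 *: circle t) - q)).
    by move=> t _; rewrite scale1r.
  apply: (@winding_homotopy (fun p => f (p.1 *: circle p.2) - q)).
  - by move=> p; cts; apply: cc; cts.
  - move=> p; rewrite unit_squareE => -[p1 p2] /eqP; rewrite subr_eq0 => /eqP E.
    by apply: nq; exists p.2, p.1.
  - by move=> s _; rewrite circle01.
  - apply: (@winding_half_plane _ (f 0 - q)).
    + by move=> t /=; cts; apply: cc; cts.
    + by rewrite !scale0r.
    + move=> t _; rewrite /= scale0r; apply: dot_gt0 => /eqP; rewrite subr_eq0 => /eqP E.
      by apply: nq; exists 0, 0; rewrite scale0r.
have w2 : winding (fun t => f (circle t) - f 0) 0.
  apply: (@winding_ext (fun t => f (circle t) - (q + 1 *: (f 0 - q)))).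
    by move=> t _; rewrite scale1r [q + _]addrCA subrr addr0.
  apply: (@winding_homotopy (fun p => f (circle p.2) - (q + p.1 *: (f 0 - q)))).
  - by move=> p; cts; apply: cc; cts.
  - move=> p; rewrite unit_squareE => -[p1 p2] /eqP; rewrite subr_eq0 => /eqP E.
    apply: (Hq p.2 (1 - p.1)) => //; first by lra.
    by rewrite E scalerBl scale1r addrA [f 0 + (q - _)]addrCA subrr addr0 -scalerN opprB.
  - by move=> s _; rewrite circle01.
  - by apply: winding_ext w1 => t _; rewrite scale0r addr0.
have w3 : winding (fun t => f (circle t) - f (- circle t)) 0.
  apply: (@winding_ext (fun t => f (circle t) - f (- (1 *: circle t)))).
    by move=> t _; rewrite scale1r.
  apply: (@winding_homotopy (fun p => f (circle p.2) - f (- (p.1 *: circle p.2)))).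
  - by move=> p; cts; apply: cc; cts.
  - move=> p; rewrite unit_squareE => -[p1 p2] /eqP; rewrite subr_eq0 => /eqP E.
    exact: (Hodd p.2 p.1).
  - by move=> s _; rewrite circle01.
  - by apply: winding_ext w2 => t _; rewrite scale0r oppr0.
apply: winding_odd_neq0 w3 => t _.
by rewrite circle_half opprK opprB.
Qed.

(** The affine map k sends the unit disk into the rectangle. Injectivity keeps apart the points
    required by [disk_image_contains], which then applies to f composed with k. *)
Lemma invariance_of_domain (f : K * K -> K * K) (z : K * K) (a b : K) :
  0 < a -> 0 < b -> continuous f ->
  (forall p q, `|p.1 - z.1| <= a -> `|p.2 - z.2| <= b ->
     `|q.1 - z.1| <= a -> `|q.2 - z.2| <= b -> f p = f q -> p = q) ->
  \forall q \near f z, exists p, [/\ `|p.1 - z.1| <= a, `|p.2 - z.2| <= b & f p = q].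
Proof.
move=> a0 b0 cf inj.
pose k (p : K * K) : K * K := (z.1 + a * p.1, z.2 + b * p.2).
have n1 : `|1 : K| <= 1 by rewrite normr1.
have k0 : k 0 = z by rewrite /k !mulr0 !addr0; case: (z).
have kin (r : K) t : `|r| <= 1 -> `|(k (r *: circle t)).1 - z.1| <= a /\
    `|(k (r *: circle t)).2 - z.2| <= b.
  have E (x y : K) : x + y - x = y by ring.
  move=> r1; rewrite /k /= !E !normrM !(gtr0_norm a0) !(gtr0_norm b0).
  by split; apply: ler_piMr; rewrite ?(ltW a0) ?(ltW b0) //; apply: mulr_ile1 => //;
    rewrite ler_norml ?cos_geN1 ?cos_le1 ?sin_geN1 ?sin_le1.
have kinj p q : k p = k q -> p = q.
  case: p q => p1 p2 [q1 q2] [/addrI/(mulfI (lt0r_neq0 a0))-> /addrI/(mulfI (lt0r_neq0 b0))->].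
  by [].
have ck : continuous k by move=> p; rewrite /k; cts.
have cfk : continuous (fun p => f (k p)).
  by move=> p; cts.
have circ0 t : circle t <> 0.
  by apply: (@angle_of_neq0 (pi *+ 2 * t)); exists 1; rewrite ?mul1r.
have fc t : 0 <= t <= 1 -> f (k (circle t)) <> f z.
  move=> t01; rewrite -k0 => E; apply: (circ0 t); apply: kinj.
  have [E1 E2] := kin 1 t n1; rewrite scale1r in E1 E2.
  by apply: inj E => //; rewrite k0 subrr normr0 ltW.
(* For q close to f z, the whole segment from f z to q misses the image of the boundary circle. *)
have : \forall q \near f z, forall p, unit_square p ->
    f (k (circle p.1)) <> f z + p.2 *: (q - f z).
  apply: (@compact_near_forall _ _ unit_square (f z) (fun p q =>
    f (k (circle p.1)) <> f z + p.2 *: (q - f z))); first exact: unit_square_compact.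
  move=> p; rewrite unit_squareE => -[p1 p2].
  pose G (w : (K * K) * (K * K)) := f (k (circle w.1.1)) - (f z + w.1.2 *: (w.2 - f z)).
  have cG : cts_at G (p, f z).
    by rewrite /G; cts; apply: cts_circle; cts.
  have : 0 < dot (G (p, f z)) (G (p, f z)).
    apply: dot_gt0; rewrite /G /= subrr scaler0 addr0 => /eqP; rewrite subr_eq0 => /eqP.
    exact: fc.
  move=> /(cts_near_gt0 (f := fun w => dot (G w) (G w))) H.
  have : \forall w \near (p, f z), 0 < dot (G w) (G w) by apply: H; rewrite /dot; cts.
  apply: filterS => w + E; rewrite /G E subrr /dot /= !mul0r addr0.
  by rewrite ltxx.
apply: filterS => q Hq.
have [t l t01 l01 E|t l t01 l01 E|t [r [t01 r01 E]]] := @disk_image_contains _ q cfk.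
- have := kin (- l) t; rewrite scaleNr normrN ger0_norm; last by case/andP: l01.
  move=> [|E1 E2]; first by case/andP: l01.
  have [E3 E4] := kin 1 t n1; rewrite scale1r in E3 E4.
  have /kinj := inj _ _ E3 E4 E1 E2 E.
  move=> /eqP; rewrite -subr_eq0 opprK -{1}[circle t]scale1r -scalerDl scaler_eq0.
  move=> /orP[|/eqP]; last exact: circ0.
  by rewrite gt_eqF //; lra.
- apply: (Hq (t, l)); first by rewrite unit_squareE.
  by rewrite E k0.
have r1 : `|r| <= 1 by rewrite ger0_norm; case/andP: r01.
have [E1 E2] := kin r t r1.
by exists (k (r *: circle t)); split; [exact: E1 | exact: E2 | ].
Qed.

End Angles.

Lemma near_normP (K : realType) (V : normedModType K) (x : V) (P : set V) :
  (\forall y \near x, P y) <-> exists2 e : K, 0 < e & forall y, `|y - x| < e -> P y.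
Proof.
split=> [/nbhs_ballP[e /= e0 H]|[e e0 H]].
  by exists e => // y ye; apply: H; rewrite -ball_normE /ball_ /= distrC.
apply/nbhs_ballP; exists e => //= y; rewrite -ball_normE /ball_ /= distrC.
exact: H.
Qed.

Lemma cts_near_neq (T Y : topologicalType) (f g : T -> Y) (x : T) :
  hausdorff_space Y -> cts_at f x -> cts_at g x -> f x <> g x ->
  \forall y \near x, f y <> g y.
Proof.
rewrite open_hausdorff => hY cf cg /eqP /hY[[A B] /= [fA gB] [oA oB /eqP AB]].
have H1 : \forall y \near x, A (f y) by apply: cf; exact: open_nbhs_nbhs (conj oA (set_mem fA)).
have H2 : \forall y \near x, B (g y) by apply: cg; exact: open_nbhs_nbhs (conj oB (set_mem gB)).
near=> y => E; suff : (A `&` B) (f y) by rewrite AB.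
by split; [exact: (near H1 y) | rewrite E; exact: (near H2 y)].
Unshelve. all: by end_near. Qed.

Lemma segment_near_forall (K : realType) (Y : topologicalType) (a b : K) (y0 : Y)
    (Q : K -> Y -> Prop) :
  (forall x, a <= x <= b -> \forall p \near (x, y0), Q p.1 p.2) ->
  \forall y \near y0, forall x, a <= x <= b -> Q x y.
Proof.
move=> H; have : \forall y \near y0, forall x, `[a, b]%classic x -> Q x y.
  apply: compact_near_forall; first exact: segment_compact.
  by move=> x; rewrite /= in_itv; exact: H.
by apply: filterS => y Hy x xab; apply: Hy; rewrite /= in_itv.
Qed.

(** * Averages and arcs *)

Section Average.
Variable K : realType.
Implicit Types (f g : K -> K) (a b x t : K).

Lemma is_derive_lt f g a b : a < b ->
  (forall x, a <= x <= b -> is_derive x 1 f (g x)) ->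
  (forall x, a < x < b -> 0 < g x) -> f a < f b.
Proof.
move=> ab df g0.
have [x||c] := @MVT _ f g a b ab.
- by rewrite in_itv /= => /andP[ax xb]; apply: df; rewrite !ltW.
- apply: derivable_within_continuous => x; rewrite in_itv /= => /df d.
  exact: (@ex_derive _ _ _ _ _ _ _ d).
- rewrite in_itv /= => /g0 gc E.
  by rewrite -subr_gt0 E mulr_gt0 // subr_gt0.
Qed.

Lemma is_derive_le f g a b : a <= b ->
  (forall x, a <= x <= b -> is_derive x 1 f (g x)) ->
  (forall x, a <= x <= b -> 0 <= g x) -> f a <= f b.
Proof.
rewrite le_eqVlt => /predU1P[->//|ab] df g0.
have [x||c] := @MVT _ f g a b ab.
- by rewrite in_itv /= => /andP[ax xb]; apply: df; rewrite !ltW.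
- apply: derivable_within_continuous => x; rewrite in_itv /= => /df d.
  exact: (@ex_derive _ _ _ _ _ _ _ d).
- rewrite in_itv /= => /andP[ac cb] E.
  rewrite -subr_ge0 E; apply: mulr_ge0; last by rewrite subr_ge0 ltW.
  by apply: g0; rewrite !ltW.
Qed.

Lemma is_derive_const f c a b : a < b ->
  (forall x, a <= x <= b -> is_derive x 1 f c) -> f b - f a = c * (b - a).
Proof.
move=> ab df.
have [x||//] := @MVT _ f (fun=> c) a b ab.
- by rewrite in_itv /= => /andP[ax xb]; apply: df; rewrite !ltW.
- apply: derivable_within_continuous => x; rewrite in_itv /= => /df d.
  exact: (@ex_derive _ _ _ _ _ _ _ d).
Qed.

(** The window ]-2, 2[ leaves room for integrals over [t, t + 1] with -1 < t < 1, which
    [average_shift_lt] compares. *)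
Lemma exists_primitive f : continuous f ->
  exists G : K -> K, forall x, -2 < x < 2 -> is_derive x 1 G (f x).
Proof.
move=> cf; exists (fun x => (\int[lebesgue_measure]_(t in `[(-2 : K), x]) f t)%R).
move=> x /andP[x1 x2].
have [|D1 D2] := @continuous_FTC1_closed K f (-2) x 2 x2 _ x1 (cf x).
  apply: continuous_compact_integrable; first exact: segment_compact.
  exact: continuous_subspaceT.
exact: (DeriveDef D1 (etrans (esym (derive1E _ _)) D2)).
Qed.

Definition primitive f : K -> K :=
  xget (fun=> 0) [set G | forall x, -2 < x < 2 -> is_derive x 1 G (f x)].

Lemma primitive_is_derive f x : continuous f -> -2 < x < 2 ->
  is_derive x 1 (primitive f) (f x).
Proof. by move=> /exists_primitive; rewrite /primitive => /(xgetPex (fun=> 0)); exact. Qed.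

Opaque primitive.

(** The integral over [0, 1], taken through a primitive so that every property needed follows from
    the mean value theorem. *)
Definition average f : K := primitive f 1 - primitive f 0.

Lemma average_lt f g a b : continuous f -> continuous g ->
  0 <= a -> a < b -> b <= 1 -> (forall x, 0 <= x <= 1 -> f x <= g x) ->
  (forall x, a < x < b -> f x < g x) -> average f < average g.
Proof.
move=> cf cg a0 ab b1 fg fg'.
pose h := primitive g - primitive f.
have dh x : 0 <= x <= 1 -> is_derive x 1 h (g x - f x).
  by move=> x01; apply: is_deriveB; apply: primitive_is_derive => //; lra.
have h1 : h 0 <= h a.
  apply: (@is_derive_le h (fun x => g x - f x)) => // x xi; first by apply: dh; lra.
  by rewrite subr_ge0; apply: fg; lra.
have h2 : h b <= h 1.
  apply: (@is_derive_le h (fun x => g x - f x)) => // x xi; first by apply: dh; lra.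
  by rewrite subr_ge0; apply: fg; lra.
have h3 : h a < h b.
  apply: (@is_derive_lt h (fun x => g x - f x)) => // x xi; first by apply: dh; lra.
  by rewrite subr_gt0; exact: fg'.
have E x : h x = primitive g x - primitive f x by [].
by move: h1 h2 h3; rewrite /average !E; lra.
Qed.

Lemma average_le f g : continuous f -> continuous g ->
  (forall x, 0 <= x <= 1 -> f x <= g x) -> average f <= average g.
Proof.
move=> cf cg fg.
pose h := primitive g - primitive f.
have : h 0 <= h 1.
  apply: (@is_derive_le h (fun x => g x - f x)) => // x xi.
    by apply: is_deriveB; apply: primitive_is_derive => //; lra.
  by rewrite subr_ge0; apply: fg; lra.
have E x : h x = primitive g x - primitive f x by [].
by rewrite /average !E; lra.
Qed.

Lemma average_cst a : average (fun=> a) = a.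
Proof.
have := @is_derive_const (primitive (fun=> a)) a 0 1 ltr01; rewrite subr0 mulr1; apply.
by move=> x xi; apply: (@primitive_is_derive (fun=> a)); [move=> y; cts | lra].
Qed.

Lemma average_add f g : continuous f -> continuous g ->
  average (fun x => f x + g x) = average f + average g.
Proof.
move=> cf cg.
pose h := primitive (fun x => f x + g x) - (primitive f + primitive g).
have cfg : continuous (fun x => f x + g x) by move=> x; cts.
have dh x : 0 <= x <= 1 -> is_derive x 1 h 0.
  move=> x01; apply: (is_derive_eq _ (subrr (f x + g x))).
  by apply: is_deriveB; [|apply: is_deriveD];
    (apply: primitive_is_derive; [assumption | lra]).
have h1 : h 1 - h 0 = 0 * (1 - 0) by apply: is_derive_const dh; exact: ltr01.
have E x : h x = primitive (fun x => f x + g x) x - (primitive f x + primitive g x) by [].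
by move: h1; rewrite /average !E mul0r; lra.
Qed.

Lemma average_dist f g e : continuous f -> continuous g ->
  (forall x, 0 <= x <= 1 -> `|f x - g x| <= e) -> `|average f - average g| <= e.
Proof.
move=> cf cg fg; have cc : continuous (fun _ : K => e) by move=> x; cts.
have H1 : average f <= average (fun x => g x + e).
  apply: average_le => //; first by move=> x; cts.
  by move=> x /fg; rewrite ler_norml; lra.
have H2 : average g <= average (fun x => f x + e).
  apply: average_le => //; first by move=> x; cts.
  by move=> x /fg; rewrite ler_norml; lra.
move: H1 H2; rewrite !average_add // average_cst ler_norml.
lra.
Qed.

(** The integral of f over [t, t + 1] has derivative f (t + 1) - f t in t, which is positive
    here. *)
Lemma average_shift_lt f t t' : continuous f -> -1 < t -> t < t' -> t' < 1 ->
  (forall x, t <= x <= t' -> f x < f (x + 1)) ->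
  average (fun s => f (s + t)) < average (fun s => f (s + t')).
Proof.
move=> cf t1 tt' t'1 ff.
have dsh (c x : K) : -2 < x + c < 2 -> is_derive x 1 (fun y => primitive f (y + c)) (f (x + c)).
  move=> xc; rewrite -[f _]mulr1.
  apply: (@is_derive1_comp _ (primitive f) (fun y => y + c)).
    exact: primitive_is_derive.
  have := is_deriveD (is_derive_id x (1 : K)) (is_derive_cst c x 1).
  by rewrite addr0.
have sh c : -1 < c < 1 -> average (fun s => f (s + c)) = primitive f (1 + c) - primitive f c.
  move=> c1.
  have csh : continuous (fun s => f (s + c)) by move=> x; cts.
  pose h := primitive (fun s => f (s + c)) - (fun y => primitive f (y + c)).
  have dh x : 0 <= x <= 1 -> is_derive x 1 h 0.
    move=> x01; apply: (is_derive_eq _ (subrr (f (x + c)))).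
    apply: is_deriveB; last by apply: dsh; lra.
    by apply: (@primitive_is_derive (fun s => f (s + c))) => //; lra.
  have h1 : h 1 - h 0 = 0 * (1 - 0) by apply: is_derive_const dh; exact: ltr01.
  have E x : h x = primitive (fun s => f (s + c)) x - primitive f (x + c) by [].
  by move: h1; rewrite /average !E add0r mul0r; lra.
rewrite !sh; [|lra|lra].
have H : (fun y => primitive f (y + 1)) t - primitive f t < (fun y => primitive f (y + 1)) t' - primitive f t'.
  apply: (@is_derive_lt ((fun y => primitive f (y + 1)) - primitive f) (fun x => f (x + 1) - f x)) => // x xi.
    by apply: is_deriveB; [apply: dsh; lra | apply: primitive_is_derive => //; lra].
  by rewrite subr_gt0; apply: ff; lra.
by rewrite ![1 + _]addrC.
Qed.

End Average.

(** * Injective arcs by loop erasure *)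

Section Arcs.
Variable K : realType.
Implicit Types (s t u a b x y q e r h w : K).

Lemma last_outside (X : set K) s a : open X -> s <= a -> ~ X s ->
  exists b, [/\ s <= b <= a, ~ X b & forall u, b < u -> u <= a -> X u].
Proof.
move=> oX sa nXs; pose E : set K := [set u | s <= u <= a /\ ~ X u].
have Es : E s by split=> //; rewrite lexx sa.
have ubE : has_ubound E by exists a => u [/andP[]].
have hE : has_sup E by split; [exists s|].
exists (sup E); split.
- rewrite (ub_le_sup ubE Es) /=; apply: ge_sup; first by exists s.
  by move=> u [/andP[]].
- move=> XE; have /near_normP[e e0 H] : \forall u \near sup E, X u by exact: open_nbhs_nbhs.
  have [u [uE nXu] ue] := sup_adherent e0 hE.
  apply: (nXu); apply: H; have := ub_le_sup ubE (conj uE nXu).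
  by move=> uu; rewrite ltr_norml; lra.
- move=> u Eu ua; apply: contrapT => nXu.
  have : u <= sup E.
    apply: (ub_le_sup ubE); split=> //; rewrite ua andbT.
    by apply: le_trans (ub_le_sup ubE Es) (ltW Eu).
  by rewrite leNgt Eu.
Qed.

Lemma first_outside (X : set K) a t : open X -> a <= t -> ~ X t ->
  exists b, [/\ a <= b <= t, ~ X b & forall u, a <= u -> u < b -> X u].
Proof.
move=> oX at_ nXt.
have [|||b [b1 b2 b3]] := @last_outside (-%R @^-1` X) (- t) (- a).
- by apply: open_comp => // x _; exact: opp_continuous.
- by rewrite lerN2.
- by rewrite /= opprK.
exists (- b); split=> //; first by lra.
by move=> u au ub; rewrite -[u]opprK; apply: (b3 (- u)); lra.
Qed.

Section PseudoDist.
Variables (T : Type) (D : T -> T -> K).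
Implicit Types (c d : K -> T) (p : T).

Definition pseudo_dist : Prop :=
  [/\ forall p, D p p = 0, forall p p', D p p' = D p' p &
      forall p p' p'', D p p'' <= D p p' + D p' p''].

Definition dist_cts c : Prop :=
  forall u e, 0 < e -> \forall w \near u, D (c u) (c w) < e.

Hypothesis hD : pseudo_dist.
Let DC p p' : D p p' = D p' p. Proof. by have [] := hD. Qed.
Let Dxx p : D p p = 0. Proof. by have [] := hD. Qed.
Let Dtri p p' p'' : D p p'' <= D p p' + D p' p''. Proof. by have [] := hD. Qed.

Lemma dist_ge0 p p' : 0 <= D p p'.
Proof. by have := Dtri p p' p; rewrite Dxx (DC p' p); lra. Qed.

Lemma dist_eql p p' p'' : D p p' = 0 -> D p p'' = D p' p''.
Proof. by move=> E; have := Dtri p p' p''; have := Dtri p' p p''; rewrite (DC p' p) E; lra. Qed.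

Lemma dist_eqr p p' p'' : D p p' = 0 -> D p'' p = D p'' p'.
Proof. by rewrite !(DC p''); exact: dist_eql. Qed.

Lemma dist_near_neq c s t : dist_cts c -> D (c s) (c t) <> 0 ->
  exists e : K, 0 < e /\ forall x y, `|x - s| < e -> `|y - t| < e -> D (c x) (c y) <> 0.
Proof.
move=> cc n; have Dp : 0 < D (c s) (c t) by rewrite lt_neqAle dist_ge0 andbT eq_sym; exact/eqP.
have D2 : 0 < D (c s) (c t) / 2 by lra.
have /near_normP[e1 e10 H1] := cc s _ D2; have /near_normP[e2 e20 H2] := cc t _ D2.
exists (Num.min e1 e2); split; first by rewrite lt_min e10.
move=> x y; rewrite !lt_min => /andP[/H1 xe _] /andP[_ /H2 ye] E.
have := Dtri (c s) (c x) (c t); have := Dtri (c x) (c y) (c t).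
by rewrite (DC (c y)) E; lra.
Qed.

Lemma dist_cts_fun c p : dist_cts c -> continuous (fun t => D (c t) p).
Proof.
move=> cc t; apply/cvgrPdist_lt => e e0; have := cc t e e0; apply: filterS => w h.
have := Dtri (c t) (c w) p; have := Dtri (c w) (c t) p.
by rewrite (DC (c w) (c t)) ltr_norml; lra.
Qed.

(* Open subsets of ]0, 1[ such that c takes equal values at the two ends of
   each complementary gap; skipping a maximal one erases all loops of c. *)
Definition loop_cover c (G : set K) : Prop :=
  [/\ open G, ~ G 0, ~ G 1 & forall s t, 0 <= s -> s < t -> t <= 1 ->
    ~ G s -> ~ G t -> (forall u, s < u < t -> G u) -> D (c s) (c t) = 0].

(** The inner part [s + d, t - d] of a gap of the union already lies in one member X of the chain.
    The gap of X around it has ends within d of s and t, where c takes equal values; if c s and c t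
    were distinct, d small would forbid this. *)
Lemma loop_cover_bigcup c (F : set (set K)) : dist_cts c ->
  F `<=` loop_cover c -> total_on F subset -> loop_cover c (\bigcup_(X in F) X).
Proof.
move=> cc FP tot; split.
- by apply: bigcup_open => X /FP[].
- by move=> [X /FP[]].
- by move=> [X /FP[]].
move=> s t s0 st t1 nGs nGt G; apply: contrapT => ncs.
have [e' [e'0 He']] := dist_near_neq cc ncs.
pose d := Num.min (e' / 2) ((t - s) / 3).
have d0 : 0 < d by rewrite lt_min !divr_gt0 // subr_gt0.
have d1 : d <= e' / 2 by rewrite ge_min lexx.
have d2 : d <= (t - s) / 3 by rewrite ge_min lexx orbT.
pose Q u := exists2 X, F X & forall z, s + d <= z <= u -> X z.
(* By connectedness, one member of the chain contains all of [s + d, t - d]: totality allows the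
   larger of two overlapping members to be kept. *)
have : Q (t - d).
  apply: (@segment_locally_constant _ (s + d) (t - d) Q _ (s + d)); last 3 first.
  - by lra.
  - by lra.
  - have [X FX Xs] : (\bigcup_(X in F) X) (s + d) by apply: G; lra.
    by exists X => // z zz; have -> : z = s + d by lra.
  move=> u u_in; have [X0 FX0 X0u] : (\bigcup_(X in F) X) u by apply: G; lra.
  have [oX0 _ _ _] := FP _ FX0.
  have /near_normP[r r0 Hr] : \forall z \near u, X0 z by exact: open_nbhs_nbhs.
  apply/near_normP; exists r => // w wr w_in.
  have key (p q : K) : `|p - u| < r -> `|q - u| < r -> Q p -> Q q.
    move=> pr qr [X FX HX].
    have [XX|XX] := tot _ _ FX FX0; [exists X0 => // z zq | exists X => // z zq];
      case: (leP z p) => zp.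
    + by apply: XX; apply: HX; lra.
    + by apply: Hr; move: pr qr; rewrite !ltr_norml; lra.
    + by apply: HX; lra.
    + by apply: XX; apply: Hr; move: pr qr; rewrite !ltr_norml; lra.
  by split; apply: key => //; rewrite subrr normr0.
move=> [X FX HX]; have [oX _ _ PX] := FP _ FX.
have nXs : ~ X s by move=> Xs; apply: nGs; exists X.
have nXt : ~ X t by move=> Xt; apply: nGt; exists X.
have [|b [b1 b2 b3]] := @last_outside X s (s + d) oX _ nXs; first by lra.
have [|b' [b1' b2' b3']] := @first_outside X (t - d) t oX _ nXt; first by lra.
apply: (He' b b'); rewrite ?ltr_norml; [by lra | by lra |].
apply: PX => //; [by lra | | by lra | ].
  suff : b != s + d by move=> /eqP; lra.
  by apply/eqP => bE; apply: b2; rewrite bE; apply: HX; lra.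
move=> u ub; case: (leP u (s + d)) => u1; first by apply: b3; lra.
case: (leP u (t - d)) => u2; first by apply: HX; lra.
by apply: b3'; lra.
Qed.

(** With G a maximal loop cover, given by Zorn's lemma, d u is the value of c at the last point up
    to u outside G. By maximality, two points outside G with equal values bound a gap, so the fibres
    of d are intervals: this is the last clause. *)
Lemma exists_monotone_path c : dist_cts c ->
  exists d, [/\ dist_cts d, d 0 = c 0, d 1 = c 1,
    (forall u, exists2 t, 0 <= t <= 1 & d u = c t) &
    (forall u w u', 0 <= u -> u <= w -> w <= u' -> u' <= 1 ->
      D (d u) (d u') = 0 -> D (d w) (d u) = 0)].
Proof.
move=> cc.
have [G [[oG G0 G1 PG] maxG]] :=
  Zorn_bigcup (fun F => @loop_cover_bigcup c F cc).
(* Otherwise ]s, t[ could be added to G. *)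
have M s t : 0 <= s -> s < t -> t <= 1 -> ~ G s -> ~ G t -> D (c s) (c t) = 0 ->
    forall u, s < u < t -> G u.
  move=> s0 st t1 nGs nGt cst.
  pose B := G `|` `]s, t[%classic.
  have PB : loop_cover c B.
    split.
    - by apply: openU => //; exact: interval_open.
    - by move=> [//|]; rewrite /= in_itv /=; lra.
    - by move=> [//|]; rewrite /= in_itv /=; lra.
    move=> s1 t1' s10 st1 t11 nBs nBt HB.
    have nGs1 : ~ G s1 by move=> ?; apply: nBs; left.
    have nGt1 : ~ G t1' by move=> ?; apply: nBt; left.
    have [H|] := pselect (forall u, s1 < u < t1' -> G u); first exact: PG.
    move=> /existsNP[u /not_implyP[ui nGu]].
    have [//|] := HB u ui; rewrite /= in_itv /= => us.
    have nIs1 : ~ s < s1 < t by move=> h; apply: nBs; right; rewrite /= in_itv.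
    have nIt1 : ~ s < t1' < t by move=> h; apply: nBt; right; rewrite /= in_itv.
    have s1s : s1 <= s by case: (leP s1 s) => // h; case: nIs1; lra.
    have t1t : t <= t1' by case: (leP t t1') => // h; case: nIt1; lra.
    have -> : s1 = s.
      apply/eqP; case: (ltrgtP s1 s) => // h; last by lra.
      have /HB[//|] : s1 < s < t1' by lra.
      by rewrite /= in_itv /= ltxx.
    have -> // : t1' = t.
      apply/eqP; case: (ltrgtP t1' t) => // h; first by lra.
      have /HB[//|] : s1 < t < t1' by lra.
      by rewrite /= in_itv /= ltxx andbF.
  move=> u ui; apply: contrapT => nGu; apply: (maxG B) => //; split; first by left.
  by move=> /(_ u) H; apply: nGu; apply: H; right; rewrite /= in_itv.
have /choice[l Hl] : forall u, exists b, 0 <= u -> [/\ 0 <= b <= u, ~ G b & forall w, b < w -> w <= u -> G w].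
  move=> u; case: (leP 0 u) => u0; last by exists 0; lra.
  by have [b Hb] := last_outside oG u0 G0; exists b.
have lE u b : 0 <= b <= u -> ~ G b -> (forall w, b < w -> w <= u -> G w) -> l u = b.
  move=> bu nGb H; have [|l1 l2 l3] := Hl u; first by lra.
  by case: (ltrgtP (l u) b) => // h; [case: nGb; apply: l3; lra | case: l2; apply: H; lra].
pose cl u : K := clamp 0 1 u.
have cl_in u : 0 <= cl u <= 1 by apply: clamp_in.
have lin u : 0 <= u <= 1 -> 0 <= l u <= 1.
  by move=> u01; have [|l1 _ _] := Hl u; [lra | lra].
pose d u := c (l (cl u)).
have dE u : 0 <= u <= 1 -> d u = c (l u) by move=> u01; rewrite /d /cl clampE.
have key u : 0 <= u <= 1 -> forall e : K, 0 < e ->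
    \forall w \near u, 0 <= w <= 1 -> D (c (l u)) (c (l w)) < e.
  move=> u01 e e0; have [|l1 l2 l3] := Hl u; first by lra.
  have [Gu|nGu] := pselect (G u).
    have /near_normP[r r0 Hr] : \forall z \near u, G z by exact: open_nbhs_nbhs.
    apply/near_normP; exists r => // w wr w01.
    suff -> : l w = l u by rewrite Dxx.
    have lu : l u != u by apply/eqP => E; rewrite E in l2.
    have luw : l u <= w.
      rewrite leNgt; apply/negP => wl; apply: l2; apply: Hr.
      by move: wr; rewrite !ltr_norml; lra.
    apply: lE => //; first by lra.
    move=> x xl xw; case: (leP x u) => xu; first exact: l3.
    by apply: Hr; move: wr; rewrite !ltr_norml; lra.
  have lu : l u = u by apply: lE => //; [lra | move=> w; lra].
  rewrite lu; have /near_normP[r r0 Hr] := cc u e e0.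
  apply/near_normP; exists r => // w wr w01.
  have [|k1 k2 k3] := Hl w; first by lra.
  case: (leP u w) => uw.
    apply: Hr; have : u <= l w.
      by rewrite leNgt; apply/negP => h; apply: nGu; apply: k3.
    by move: wr; rewrite !ltr_norml; lra.
  (* To the left of u, [l w] may be far from u, but the gap that starts there ends at some b between
     w and u, and c has equal values at its two ends. *)
  have [b [b1 b2 b3]] := first_outside oG (ltW uw) nGu.
  suff E : D (c (l w)) (c b) = 0 by rewrite (dist_eqr _ E); apply: Hr; move: wr; rewrite !ltr_norml; lra.
  have [->|/eqP lb] := pselect (l w = b); first exact: Dxx.
  apply: PG => //; [by lra | by move: lb; rewrite neq_lt; lra | by lra |].
  by move=> x xi; case: (leP x w) => xw; [apply: k3; lra | apply: b3; lra].
exists d; split.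
- move=> u e e0; have /near_normP[r r0 Hr] := key _ (cl_in u) e e0.
  have : \forall w \near u, `|cl w - cl u| < r.
    have : cts_at cl u by rewrite /cl; cts.
    by move=> /cvgrPdist_lt/(_ r r0); apply: filterS => w; rewrite distrC.
  by apply: filterS => w /Hr; apply.
- rewrite dE; last by rewrite lexx ler01.
  by rewrite (@lE 0 0) ?lexx // => w; lra.
- rewrite dE; last by rewrite lexx ler01.
  by rewrite (@lE 1 1) ?lexx ?ler01 // => w; lra.
- by move=> u; exists (l (cl u)) => //; exact: lin.
move=> u w u' u0 uw wu' u'1; rewrite !dE; [|lra|lra|lra].
have [//|l1 l2 l3] := Hl u.
have [|m1 m2 m3] := Hl u'; first by lra.
case: (ltrgtP (l u) (l u')) => h E.
- have Gh := M _ _ (proj1 (andP l1)) h (ltac:(lra)) l2 m2 E.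
  case: (ltP w (l u')) => wl.
    rewrite (@lE w (l u)) //; first by lra.
    by move=> x x1 x2; apply: Gh; lra.
  rewrite (@lE w (l u')) //; [by rewrite DC | by lra |].
  by move=> x x1 x2; apply: m3; lra.
- case: l2; apply: m3; lra.
- rewrite (@lE w (l u)) //; first by lra.
  by move=> x x1 x2; apply: m3; lra.
Qed.

Lemma uniform_continuity01 d (e : K) : dist_cts d -> 0 < e ->
  exists2 r : K, 0 < r & forall x y, 0 <= x <= 1 -> `|y - x| < r -> D (d y) (d x) < e.
Proof.
move=> cd e0.
have /near_normP[r r0 Hr] : \forall h \near (0 : K), forall x, 0 <= x <= 1 ->
    D (d (x + h)) (d x) < e.
  apply: (@segment_near_forall _ _ 0 1 (0 : K) (fun x h => D (d (x + h)) (d x) < e)) => x _.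
  have e2 : 0 < e / 2 by lra.
  have /near_normP[r r0 H] := cd x _ e2.
  have : \forall p \near (x, 0 : K), `|p.1 + p.2 - x| < r.
    apply: (cts_near_lt (f := fun p : K * K => `|p.1 + p.2 - x|)); first by cts.
    by rewrite /= addr0 subrr normr0.
  have : \forall p \near (x, 0 : K), `|p.1 - x| < r.
    apply: (cts_near_lt (f := fun p : K * K => `|p.1 - x|)); first by cts.
    by rewrite /= subrr normr0.
  apply: filterS2 => p h1 h2; have := H _ h1; have := H _ h2.
  by have := Dtri (d (p.1 + p.2)) (d x) (d p.1); rewrite (DC (d (p.1 + p.2)) (d x)); lra.
exists r => // x y x01 yx; have := Hr (y - x); rewrite subr0 => /(_ yx x).
by rewrite [x + _]addrC subrK; exact.
Qed.

(** U picks points in the fibres of psi and may be discontinuous. By compactness of [0, 1], the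
    points whose image under d is at distance at least e from d (U x) are not mapped by psi to
    values near val x. *)
Lemma cts_quotient d (psi val U : K -> K) :
  dist_cts d -> continuous psi -> continuous val ->
  (forall x, 0 <= U x <= 1 /\ psi (U x) = val x) ->
  (forall u u', 0 <= u <= 1 -> 0 <= u' <= 1 -> psi u = psi u' -> D (d u) (d u') = 0) ->
  dist_cts (fun x => d (U x)).
Proof.
move=> cd cpsi cval HU dpsi x e e0.
have far : \forall x' \near x, forall u, 0 <= u <= 1 -> e <= D (d (U x)) (d u) -> psi u <> val x'.
  apply: (@segment_near_forall _ _ 0 1 x
    (fun u x' => e <= D (d (U x)) (d u) -> psi u <> val x')) => u u01.
  have [U01 UE] := HU x.
  have [h|h] := pselect (psi u = val x).
    have dE : D (d (U x)) (d u) = 0 by apply: dpsi => //; rewrite h.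
    have /near_normP[r r0 H] := cd u _ e0.
    have : \forall p \near (u, x), `|p.1 - u| < r.
      apply: (cts_near_lt (f := fun p : K * K => `|p.1 - u|)); first by cts.
      by rewrite /= subrr normr0.
    by apply: filterS => p /H hp hp'; move: hp; rewrite -(dist_eql _ dE) ltNge hp'.
  have : \forall p \near (u, x), psi p.1 <> val p.2.
    apply: (@cts_near_neq _ _ (fun p : K * K => psi p.1) (fun p : K * K => val p.2) (u, x)); last exact: h.
    - exact: norm_hausdorff.
    - by cts.
    - by cts.
  by apply: filterS => p hp _.
apply: filterS far => x' H; rewrite ltNge; apply/negP => h.
have [U01 UE] := HU x'.
exact: (H (U x') U01 h UE).
Qed.

(** The monotone path d may still be constant on intervals. It is reparametrized by a nondecreasing
    function psi with the same fibres: the average over q of M q u, the largest distance from d q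
    that is reached between the times q and u. *)
Lemma exists_arc c : dist_cts c -> D (c 0) (c 1) <> 0 ->
  exists al, [/\ dist_cts al, D (al 0) (c 0) = 0, D (al 1) (c 1) = 0,
    (forall x y, 0 <= x <= 1 -> 0 <= y <= 1 -> D (al x) (al y) = 0 -> x = y) &
    (forall x, exists2 t, 0 <= t <= 1 & al x = c t)].
Proof.
move=> cc c01.
have [d [cd d0 d1 dc mono]] := exists_monotone_path cc.
have [B HB] : exists B : K, forall u q, D (d u) (d q) <= B.
  have [||t _ Ht] := @EVT_max _ (fun t => D (c t) (c 0)) 0 1; first exact: ler01.
    by apply: continuous_subspaceT; exact: dist_cts_fun.
  have H u : D (d u) (c 0) <= D (c t) (c 0).
    by have [w w01 ->] := dc u; apply: Ht; rewrite in_itv.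
  exists (D (c t) (c 0) + D (c t) (c 0)) => u q.
  by have := Dtri (d u) (c 0) (d q); rewrite (DC (c 0)); have := H u; have := H q; lra.
(* The value 0 is included so that the supremum is 0 when u < q. *)
pose E q u : set K := [set r | r = 0 \/ exists s, [/\ q <= s, s <= u & r = D (d s) (d q)]].
pose M q u : K := sup (E q u).
have E0 q u : E q u !=set0 by exists 0; left.
have bE q u : has_ubound (E q u).
  exists B => r [->|[s [_ _ ->]]]; last exact: HB.
  exact: le_trans (dist_ge0 (d 0) (d 0)) (HB 0 0).
have M_ge q s u : q <= s -> s <= u -> D (d s) (d q) <= M q u.
  by move=> qs su; apply: (ub_le_sup (bE q u)); right; exists s.
have M_ge0 q u : 0 <= M q u by apply: (ub_le_sup (bE q u)); left.
have M_le q u r : 0 <= r -> (forall s, q <= s -> s <= u -> D (d s) (d q) <= r) -> M q u <= r.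
  by move=> r0 H; apply: ge_sup => // x [->//|[s [s1 s2 ->]]]; exact: H.
have M_lt q u : u < q -> M q u = 0.
  by move=> uq; apply/eqP; rewrite eq_le M_ge0 andbT; apply: M_le => // s; lra.
have unif e : 0 < e -> exists2 r : K, 0 < r & forall x y, 0 <= x <= 1 -> `|y - x| < r -> D (d y) (d x) < e.
  exact: uniform_continuity01.
have Mq e : 0 < e -> exists2 r : K, 0 < r & forall q q' u, 0 <= q <= 1 -> 0 <= q' <= 1 -> `|q - q'| < r ->
    M q' u <= M q u + e.
  move=> e0; have [r r0 H] := unif e e0; exists r => // q q' u q01 q'01 qq.
  apply: M_le; first by rewrite addr_ge0 // ltW.
  move=> s qs su; case: (leP q s) => h.
    rewrite (le_trans (Dtri _ (d q) _)) // lerD ?M_ge //.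
    by apply: ltW; apply: H.
  rewrite -[X in X <= _]add0r lerD //; apply: ltW; apply: H => //.
  by move: qq; rewrite !ltr_norml; lra.
have Mu e : 0 < e -> exists2 r : K, 0 < r & forall q u u', 0 <= q <= 1 -> 0 <= u <= 1 -> `|u' - u| < r ->
    M q u' <= M q u + e.
  move=> e0; have [r r0 H] := unif e e0; exists r => // q u u' q01 u01 uu.
  apply: M_le; first by rewrite addr_ge0 // ltW.
  move=> s qs su; case: (leP s u) => h.
    by rewrite (le_trans (M_ge _ _ u qs h)) // lerDl ltW.
  case: (leP q u) => qu.
    rewrite (le_trans (Dtri _ (d u) _)) // addrC lerD ?M_ge //.
    by apply: ltW; apply: H => //; move: uu; rewrite !ltr_norml; lra.
  rewrite -[X in X <= _]add0r lerD //; apply: ltW; apply: H => //.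
  by move: uu; rewrite !ltr_norml; lra.
pose cl u : K := clamp 0 1 u.
have cl_in u : 0 <= cl u <= 1 by apply: clamp_in.
have clE u : 0 <= u <= 1 -> cl u = u by exact: clampE.
have ccl u : cts_at cl u by rewrite /cl; cts.
have cM u : continuous (fun q => M (cl q) u).
  move=> q; apply/cvgrPdist_le => e e0; have [r r0 H] := Mq e e0.
  have /cvgrPdist_lt/(_ r r0) := ccl q; apply: filterS => q' qq.
  have h1 := H _ _ u (cl_in q) (cl_in q') qq.
  have h2 : M (cl q) u <= M (cl q') u + e by apply: H => //; rewrite distrC.
  by rewrite ler_norml; lra.
pose psi u := average (fun q => M (cl q) (cl u)).
have cpsi : continuous psi.
  move=> u; apply/cvgrPdist_le => e e0; have [r r0 H] := Mu e e0.
  have /cvgrPdist_lt/(_ r r0) := ccl u; apply: filterS => u' uu.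
  apply: average_dist => // q _.
  have h1 : M (cl q) (cl u') <= M (cl q) (cl u) + e by apply: H => //; rewrite distrC.
  have h2 : M (cl q) (cl u) <= M (cl q) (cl u') + e by apply: H.
  by rewrite ler_norml; lra.
have psi_eq u u' : 0 <= u -> u <= u' -> u' <= 1 -> D (d u) (d u') = 0 -> psi u = psi u'.
  move=> u0 uu u1 duu; rewrite /psi; congr average; apply/funext => q.
  rewrite (clE u); last by lra.
  rewrite (clE u'); last by lra.
  apply/eqP; rewrite eq_le; apply/andP; split; apply: M_le => // s qs su.
    by apply: M_ge => //; lra.
  case: (leP s u) => h; first exact: M_ge.
  have Es : D (d s) (d u) = 0 by apply: (mono u s u') => //; lra.
  rewrite (dist_eql _ Es); case: (leP (cl q) u) => h'; first exact: M_ge.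
  have Eq : D (d (cl q)) (d u) = 0 by apply: (mono u (cl q) u') => //; lra.
  by rewrite (dist_eqr _ Eq) Dxx.
have psi_lt u u' : 0 <= u -> u < u' -> u' <= 1 -> D (d u) (d u') <> 0 -> psi u < psi u'.
  move=> u0 uu u1 duu.
  have [r [r0 Hr]] := dist_near_neq cd duu.
  rewrite /psi (clE u); last by lra.
  rewrite (clE u'); last by lra.
  pose b := Num.min (u + r / 2) u'.
  have b1 : u < b by rewrite lt_min uu ltrDl divr_gt0.
  have b2 : b <= u' by rewrite ge_min lexx orbT.
  have b3 : b <= u + r / 2 by rewrite ge_min lexx.
  (* For q in ]u, b[, M q u = 0, whereas M q u' is at least the distance from d u' to d q, which is
     positive as q is close to u. *)
  apply: (@average_lt _ _ _ u b) => //; first by lra.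
    move=> q q01; apply: M_le => // s qs su; apply: M_ge => //; lra.
  move=> q qi; rewrite clE; last by lra.
  rewrite M_lt; last by lra.
  apply: (lt_le_trans _ (@M_ge q u' u' _ _)) => //; last by lra.
  rewrite lt_neqAle dist_ge0 andbT eq_sym DC; apply/eqP; apply: Hr; last by rewrite subrr normr0.
  by rewrite ltr_norml; lra.
clearbody psi; clear cM Mu Mq M_lt M_le M_ge0 M_ge bE E0 M E.
have p01 : psi 0 < psi 1 by apply: psi_lt => //; rewrite d0 d1.
pose val x := psi 0 + cl x * (psi 1 - psi 0).
have cval : continuous val by move=> x; rewrite /val; cts; exact: ccl.
have /choice[U HU] : forall x, exists u, 0 <= u <= 1 /\ psi u = val x.
  move=> x; have [|||u] := @IVT _ psi 0 1 (val x); first exact: ler01.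
  - exact: continuous_subspaceT.
  - by rewrite (min_l (ltW p01)) (max_r (ltW p01)) /val; have := cl_in x; move: p01; nra.
  - by rewrite in_itv /= => u01 E1; exists u.
have dpsi u u' : 0 <= u <= 1 -> 0 <= u' <= 1 -> psi u = psi u' <-> D (d u) (d u') = 0.
  move=> u01 u'01; wlog uu : u u' u01 u'01 / u <= u'.
    move=> W; case: (leP u u') => h; first exact: W.
    by rewrite DC; have [W1 W2] := W u' u u'01 u01 (ltW h); split=> [/esym/W1|/W2/esym].
  split=> E1; last by apply: psi_eq => //; lra.
  apply: contrapT => duu.
  have u_lt : u < u' by rewrite lt_neqAle uu andbT; apply/eqP => h; apply: duu; rewrite h Dxx.
  have [/andP[u0 _] /andP[_ u'1]] := (u01, u'01).
  by have := psi_lt _ _ u0 u_lt u'1 duu; rewrite E1 ltxx.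
exists (fun x => d (U x)); split.
- by apply: (cts_quotient cd cpsi cval HU) => u u' u01 u'01 /dpsi; exact.
- have [U01 UE] := HU 0; rewrite -d0; apply/dpsi => //; first by rewrite lexx ler01.
  by rewrite UE /val clE ?lexx ?ler01 // mul0r addr0.
- have [U01 UE] := HU 1; rewrite -d1; apply/dpsi => //; first by rewrite lexx ler01.
  by rewrite UE /val clE ?lexx ?ler01 // mul1r addrC subrK.
- move=> x y x01 y01; have [Ux01 UxE] := HU x; have [Uy01 UyE] := HU y.
  move=> /(dpsi _ _ Ux01 Uy01); rewrite UxE UyE /val !clE // => H.
  have /addrI/mulIf : psi 0 + x * (psi 1 - psi 0) = psi 0 + y * (psi 1 - psi 0) by exact: H.
  by apply; rewrite subr_eq0 gt_eqF.
- by move=> x; exact: dc.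
Qed.

End PseudoDist.

Lemma exists_plane_arc (c : K -> K * K) : continuous c -> c 0 <> c 1 ->
  exists al : K -> K * K, [/\ continuous al, al 0 = c 0, al 1 = c 1,
    (forall x y, 0 <= x <= 1 -> 0 <= y <= 1 -> al x = al y -> x = y) &
    (forall x, exists2 t, 0 <= t <= 1 & al x = c t)].
Proof.
pose D (p q : K * K) : K := `|p - q|.
have D0 (p q : K * K) : D p q = 0 -> p = q by move=> /normr0P; rewrite subr_eq0 => /eqP.
have hD : pseudo_dist D.
  split=> [p|p q|p q r]; rewrite /D; [by rewrite subrr normr0 | exact: distrC |].
  exact: ler_distD.
move=> cc c01; have [||al [h1 /D0 h2 /D0 h3 h4 h5]] := @exists_arc _ D hD c.
- by move=> u e e0; have /cvgrPdist_lt/(_ e e0) := cc u.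
- by move=> /D0.
exists al; split => //.
- by move=> u; apply/cvgrPdist_lt => e e0; exact: h1.
- by move=> x y x01 y01 E; apply: h4 => //; rewrite E /D subrr normr0.
Qed.

End Arcs.

Lemma cts_glue (K : realType) (X : topologicalType) (f g : K -> X) (a : K) :
  continuous f -> continuous g -> f a = g a ->
  continuous (fun s => if s <= a then f s else g s).
Proof.
move=> cf cg fg s; apply: cts_at_continuous => A H.
suff : \forall u \near s, A (if u <= a then f u else g u) by [].
have [sa|sa|sa] := ltrgtP s a; move: H; rewrite /= ?sa ?(ltW sa) ?leNgt ?sa ?ltxx /= => H.
- have H1 : \forall u \near s, A (f u) by exact: cf.
  have H2 : \forall u \near s, u < a by exact: lt_nbhsl.
  by apply: filterS2 H1 H2 => u Au /ltW ->.
- have H1 : \forall u \near s, A (g u) by exact: cg.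
  have H2 : \forall u \near s, a < u by exact: lt_nbhsr.
  by apply: filterS2 H1 H2 => u Au; rewrite leNgt => ->.
- have H1 : \forall u \near a, A (f u) by exact: cf.
  have H2 : \forall u \near a, A (g u) by apply: cg; rewrite -fg.
  by apply: filterS2 H1 H2 => u A1 A2; case: ifP.
Qed.

Lemma cts_nbhs (T U : topologicalType) (f : T -> U) (x : T) (A : set U) :
  cts_at f x -> nbhs (f x) A -> \forall y \near x, A (f y).
Proof. by move=> cf; exact: cf. Qed.

Lemma convex_comb_lt (K : realType) (r l a b : K) : 0 <= l <= 1 ->
  - r < a < r -> - r < b < r -> - r < (1 - l) * a + l * b < r.
Proof.
move=> l01 ha hb; have [->|l0] := eqVneq l 0; first by rewrite subr0 mul1r mul0r addr0.
have l_gt0 : 0 < l by rewrite lt_neqAle eq_sym l0; lra.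
have h1 : (1 - l) * a <= (1 - l) * r by apply: ler_wpM2l; lra.
have h2 : (1 - l) * (- r) <= (1 - l) * a by apply: ler_wpM2l; lra.
have h3 : l * b < l * r by rewrite ltr_pM2l //; lra.
have h4 : l * (- r) < l * b by rewrite ltr_pM2l //; lra.
by lra.
Qed.

(** * Charts of a surface with boundary *)

(** A retraction that collapses the lower half-plane onto the axis, not a reflection. *)
Definition fold_plane {K : realType} (q : K * K) : K * K := (q.1, Num.max 0 q.2).

(* A chart centred at z0: f maps U to the closed half-plane, and g, precomposed
   with the fold of the plane onto the half-plane, is a continuous left inverse
   of f defined on a whole square of radius r around z0. *)
Definition chart {K : realType} {S : topologicalType} (U : set S) (f : S -> K * K)
    (g : K * K -> S) (z0 : K * K) (r : K) : Prop :=
  [/\ open U, (forall x, U x -> cts_at f x),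
      (forall x, U x -> 0 <= (f x).2 /\ g (f x) = x), 0 < r &
      forall q, `|q - z0| < r -> [/\ cts_at g q, U (g q) & f (g q) = fold_plane q]].

Lemma pair_norm_lt (K : realType) (p : K * K) (r : K) :
  (`|p| < r) = (`|p.1| < r) && (`|p.2| < r).
Proof. by case: p => a b; rewrite prod_normE /= gt_max. Qed.

Lemma pair_norm_le (K : realType) (p : K * K) (r : K) :
  (`|p| <= r) = (`|p.1| <= r) && (`|p.2| <= r).
Proof. by case: p => a b; rewrite prod_normE /= ge_max. Qed.

Lemma fold_plane_dist (K : realType) (q z : K * K) (r : K) : 0 <= z.2 ->
  `|q - z| < r -> `|fold_plane q - z| < r.
Proof.
rewrite !pair_norm_lt /= => z0 /andP[-> h] /=.
move: h; rewrite !ltr_norml => /andP[h1 h2]; case: (leP 0 q.2) => h3; lra.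
Qed.

Lemma cts_fold_plane (K : realType) (q : K * K) : cts_at fold_plane q.
Proof. by rewrite /fold_plane; cts. Qed.

Lemma exists_le2 (K : realType) (a b : K) : 0 < a -> 0 < b ->
  exists c, [/\ 0 < c, c <= a & c <= b].
Proof.
by move=> a0 b0; exists (Num.min a b); rewrite lt_min a0 b0 !ge_min !lexx orbT.
Qed.

Lemma exists_le3 (K : realType) (a b c : K) : 0 < a -> 0 < b -> 0 < c ->
  exists m, [/\ 0 < m, m <= a, m <= b & m <= c].
Proof.
move=> a0 b0 c0; have [m [m0 ma mb]] := exists_le2 a0 b0.
have [n [n0 nm nc]] := exists_le2 m0 c0; exists n; split => //; exact: le_trans nm _.
Qed.

(** * Flow boxes *)

Section Flow.
Variables (K : realType) (S : topologicalType) (v : K -> S -> S).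
Implicit Types (x y z : S) (s t a e : K).

Definition singular x := forall t, v t x = x.

Hypothesis hS : hausdorff_space S.
Hypothesis cS : compact [set: S].
Hypothesis has_chart : forall x : S, exists (U : set S) (f : S -> K * K)
  (g : K * K -> S) (r : K), chart U f g (f x) r /\ U x.
Hypothesis v_cont : continuous (fun p : K * S => v p.1 p.2).
Hypothesis v0 : forall x, v 0 x = x.
Hypothesis vD : forall s t x, v (s + t) x = v s (v t x).
Hypothesis all_closed : forall x, singular x \/ exists2 T : K, 0 < T & v T x = x.
Hypothesis stable : forall x (U : set S), open U -> (forall t, U (v t x)) ->
  \forall z \near x, forall t, U (v t z).

(* lra fails once section variables have been cleared, hence the exceptions. *)
Ltac section_hyp H := first [constr_eq H v0 | constr_eq H vD | constr_eq H v_cont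
  | constr_eq H has_chart | constr_eq H hS | constr_eq H cS | constr_eq H v
  | constr_eq H all_closed | constr_eq H stable].
Ltac flra :=
  repeat match goal with
  | H : forall _, _ |- _ => tryif section_hyp H then fail else clear H
  | H : continuous _ |- _ => tryif section_hyp H then fail else clear H
  | H : cts_at _ _ |- _ => clear H
  | H : _ \/ _ |- _ => clear H
  | H : exists _, _ |- _ => clear H
  | H := _ |- _ => clearbody H
  end; lra.

Lemma vK t x : v (- t) (v t x) = x.
Proof. by rewrite -vD addNr v0. Qed.

Lemma vNK t x : v t (v (- t) x) = x.
Proof. by rewrite -vD subrr v0. Qed.

Lemma v_inj t x y : v t x = v t y -> x = y.
Proof. by move=> /(congr1 (v (- t))); rewrite !vK. Qed.

Lemma vC s t x : v s (v t x) = v t (v s x).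
Proof. by rewrite -!vD addrC. Qed.

Lemma cts_flow (T : topologicalType) (k : T -> K) (f : T -> S) (x : T) :
  cts_at k x -> cts_at f x -> cts_at (fun w => v (k w) (f w)) x.
Proof.
move=> ck cf; apply: (cts_comp (f := fun w => (k w, f w)) (g := fun p : K * S => v p.1 p.2)).
  exact: cts_pair.
exact: v_cont.
Qed.

Ltac ctsv := cts; repeat (first [apply: cts_flow | cts1]).

Lemma near_flow (P : set S) t x : nbhs (v t x) P -> \forall y \near x, P (v t y).
Proof.
have c : cts_at (fun y => v t y) x by ctsv.
exact: c.
Qed.

Lemma nbhs_flow (P : set S) t x : nbhs x P -> nbhs (v t x) (v t @` P).
Proof.
move=> Px; have := @near_flow P (- t) (v t x); rewrite vK => /(_ Px).
by apply: filterS => y Py; exists (v (- t) y) => //; rewrite vNK.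
Qed.

(** A Urysohn function g separates y from [v tau y]. Its average over the orbit segment of duration
    tau starting at z moves, along the flow, with speed proportional to the difference of g between
    the two ends of the segment, which is positive near y. *)
Lemma exists_increasing_function y : ~ singular y ->
  exists (phi : S -> K) (a : K) (N : set S), [/\ continuous phi, 0 < a, open N, N y &
    forall z t t', N z -> - a <= t -> t < t' -> t' <= a -> phi (v t z) < phi (v t' z)].
Proof.
move=> /existsNP[t0 vt0].
have [tau tau0 vtau] : exists2 tau : K, 0 < tau & v tau y <> y.
  case: (ltrgtP t0 0) => h; last by rewrite h v0 in vt0.
    exists (- t0); first by rewrite oppr_gt0.
    by move=> E; apply: vt0; rewrite -{1}E vNK.
  by exists t0.
have cl1 x : closed [set x] by apply: compact_closed => //; exact: compact_set1.
have [g [cg _ g0 g1]] : exists g : S -> K, [/\ continuous g, range g `<=` `[0, 1],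
    g @` [set y] `<=` [set 0] & g @` [set v tau y] `<=` [set 1]].
  apply/uniform_separatorP; apply: normal_uniform_separator => //.
    exact: compact_normal.
  by apply/seteqP; split => // x /= [->] /esym.
have gy : g y = 0 by apply: g0; exists y.
have gvy : g (v tau y) = 1 by apply: g1; exists (v tau y).
pose F z s := g (v (tau * s) z).
have cF z : continuous (F z).
  move=> s; apply: cts_at_continuous.
  by change (cts_at (fun s : K => g (v (tau * s) z)) s); ctsv.
pose phi z := average (F z).
have : \forall p \near ((0 : K), y), F p.2 p.1 < F p.2 (p.1 + 1).
  have c : cts_at (fun p : K * S => F p.2 (p.1 + 1) - F p.2 p.1) (0, y).
    by rewrite /F; cts; ctsv.
  have := cts_near_gt0 c; rewrite /F /= mulr0 v0 add0r mulr1 gy gvy subr0 => /(_ ltr01).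
  by apply: filterS => p; rewrite subr_gt0.
move=> [[A B] /= [/near_normP[r r0 Hr] By] HAB].
pose a0 := Num.min (r / 2) (2^-1).
have a00 : 0 < a0 by rewrite lt_min; apply/andP; split; flra.
have a0r : a0 < r by rewrite gt_min; apply/orP; left; flra.
have a01 : a0 < 1 by rewrite gt_min; apply/orP; right; flra.
exists phi, (tau * a0), (interior B); split.
- move=> z; apply/cvgrPdist_le => e e0.
  have : \forall z' \near z, forall s, 0 <= s <= 1 -> `|F z s - F z' s| < e.
    apply: (@segment_near_forall _ _ 0 1 z (fun s z' => `|F z s - F z' s| < e)) => s _.
    apply: (cts_near_lt (f := fun p : K * S => `|F z p.1 - F p.2 p.1|)).
      by rewrite /F; cts; ctsv.
    by rewrite /= subrr normr0.
  by apply: filterS => z' H; apply: average_dist => // s /H /ltW.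
- by rewrite mulr_gt0.
- exact: open_interior.
- by [].
move=> z t t' /nbhs_singleton Bz t1 tt t2.
pose u := t / tau; pose u' := t' / tau.
have tu : t = tau * u by rewrite /u mulrC divfK ?gt_eqF.
have tu' : t' = tau * u' by rewrite /u' mulrC divfK ?gt_eqF.
have shift w : phi (v (tau * w) z) = average (fun s => F z (s + w)).
  by congr average; apply/funext => s; rewrite /F -vD mulrDr.
have uu : u < u' by rewrite ltr_pM2r ?invr_gt0.
have u1 : - a0 <= u by rewrite ler_pdivlMr // mulrC mulrN.
have u2 : u' <= a0 by rewrite ler_pdivrMr // mulrC.
rewrite tu tu' !shift; apply: average_shift_lt => //; [flra | flra |].
move=> x xi; apply: (HAB (x, z)); split => //=; apply: Hr.
by rewrite subr0 ltr_norml; flra.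
Qed.

(** The section is a level set of a function increasing along the flow. The time T needed to reach
    it exists by the intermediate value theorem; it is unique and continuous by monotonicity. *)
Lemma exists_local_section y : ~ singular y ->
  exists (a : K) (M : set S) (T : S -> K) (Sg : set S),
    [/\ 0 < a, open M, M y, T y = 0 /\ Sg y &
    (forall z, M z -> [/\ `|T z| <= a, Sg (v (T z) z) & cts_at T z]) /\
    (forall x x' t, Sg x -> Sg x' -> `|t| <= a *+ 4 -> v t x = x' -> t = 0)].
Proof.
move=> /exists_increasing_function[phi [a0 [N [cphi a00 oN Ny mono]]]].
have : \forall p \near ((0 : K), y), N (v p.1 p.2).
  have c : cts_at (fun p : K * S => v p.1 p.2) (0, y) by ctsv.
  by apply: c; rewrite /= v0; exact: open_nbhs_nbhs.
move=> [[A B] /= [/near_normP[r r0 Hr] By] HAB].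
(* a < r keeps the points slid onto the section inside N; 4 a <= a0 keeps times up to 4 a in the
   range of monotonicity. *)
pose a := Num.min (r / 2) (a0 / 4).
have a_gt0 : 0 < a by rewrite lt_min !divr_gt0.
have a1 : a <= a0 / 4 by rewrite ge_min lexx orbT.
have a2 : a < r by rewrite gt_min ltr_pdivrMr // ltr_pMr // ltr1n.
pose c0 := phi y.
have ct (t : K) z : cts_at (fun z' => phi (v t z')) z by cts; ctsv.
pose M := [set z | [/\ N z, interior B z, c0 < phi (v a z) & phi (v (- a) z) < c0]].
have oM : open M.
  rewrite openE => z [Nz Bz h1 h2].
  have H1 : \forall z' \near z, N z' by exact: open_nbhs_nbhs.
  have H2 : \forall z' \near z, interior B z'.
    by apply: open_nbhs_nbhs; split => //; exact: open_interior.
  have H3 : \forall z' \near z, c0 < phi (v a z') by exact: (cvgr_gt _ (ct a z)).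
  have H4 : \forall z' \near z, phi (v (- a) z') < c0 by exact: (cvgr_lt _ (ct (- a) z)).
  by near=> z'; split; near: z'.
have My : M y.
  split => //.
    by have := mono y 0 a Ny; rewrite v0; apply; flra.
  by have := mono y (- a) 0 Ny; rewrite v0; apply; flra.
have /choice[T HT] : forall z, exists t, M z -> `|t| <= a /\ phi (v t z) = c0.
  move=> z; have [Mz|nMz] := pselect (M z); last by exists 0.
  have [_ _ h1 h2] := Mz.
  have h21 := lt_trans h2 h1.
  have [|||t] := @IVT _ (fun t => phi (v t z)) (- a) a c0; first by flra.
  - by apply: continuous_subspaceT => t; cts; ctsv.
  - by rewrite (min_l (ltW h21)) (max_r (ltW h21)) !ltW.
  - by rewrite in_itv /= => ta E; exists t => _; rewrite ler_norml.
have uniq z t t' : N z -> - a0 <= t <= a0 -> - a0 <= t' <= a0 ->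
    phi (v t z) = phi (v t' z) -> t = t'.
  move=> Nz h1 h2 E; case: (ltrgtP t t') => // h.
    have : phi (v t z) < phi (v t' z) by apply: mono => //; flra.
    by rewrite E ltxx.
  have : phi (v t' z) < phi (v t z) by apply: mono => //; flra.
  by rewrite E ltxx.
exists a, M, T, [set x | N x /\ phi x = c0]; split => //.
  split => //; have [h1 h2] := HT y My; apply: (uniq y) => //; [|flra|].
    by move: h1; rewrite ler_norml; flra.
  by rewrite h2 v0.
split; last first.
  move=> x x' t [Nx Ex] [Nx' Ex'] ta vt; apply: (uniq x) => //; [|flra|by rewrite vt v0 Ex Ex'].
  by move: ta; rewrite ler_norml; flra.
move=> z Mz; have [h1 h2] := HT z Mz; have [Nz Bz h3 h4] := Mz; split => //.
  split => //; apply: (HAB (T z, z)); split => /=; last exact: nbhs_singleton.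
  by apply: Hr; rewrite subr0; apply: le_lt_trans a2.
apply/cvgrPdist_lt => e0 e00.
pose e := Num.min (e0 / 2) a.
have e_gt0 : 0 < e by rewrite lt_min divr_gt0.
have e1 : e < e0 by rewrite gt_min ltr_pdivrMr // ltr_pMr // ltr1n.
have e2 : e <= a by rewrite ge_min lexx orbT.
move: (h1); rewrite ler_norml => h1'.
have H1 : \forall z' \near z, c0 < phi (v (T z + e) z').
  by apply: (cvgr_gt _ (ct _ z)); rewrite -h2; apply: mono => //; flra.
have H2 : \forall z' \near z, phi (v (T z - e) z') < c0.
  by apply: (cvgr_lt _ (ct _ z)); rewrite -h2; apply: mono => //; flra.
have H3 : \forall z' \near z, M z' by exact: open_nbhs_nbhs.
near=> z'; have Mz' : M z' by near: z'.
have [k1 k2] := HT z' Mz'; have [Nz' _ _ _] := Mz'.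
have k3 : c0 < phi (v (T z + e) z') by near: z'.
have k4 : phi (v (T z - e) z') < c0 by near: z'.
move: k1; rewrite ler_norml => k1.
have l1 : T z' < T z + e.
  rewrite ltNge; apply/negP; rewrite le_eqVlt => /predU1P[E|h].
    by move: k3; rewrite E k2 ltxx.
  have : phi (v (T z + e) z') < phi (v (T z') z') by apply: mono => //; flra.
  by rewrite k2 => /(lt_trans k3); rewrite ltxx.
have l2 : T z - e < T z'.
  rewrite ltNge; apply/negP; rewrite le_eqVlt => /predU1P[E|h].
    by move: k4; rewrite -E k2 ltxx.
  have : phi (v (T z') z') < phi (v (T z - e) z') by apply: mono => //; flra.
  by rewrite k2 => /lt_trans/(_ k4); rewrite ltxx.
by rewrite ltr_norml; flra.
Unshelve. all: by end_near. Qed.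

(* Invariance of domain applied to (s, t) |-> v t (al s) in a chart. *)
Lemma box_open (al : K -> S) s0 eta : 0 < eta -> continuous al ->
  (forall s s' t t', `|s - s0| <= eta -> `|s' - s0| <= eta -> `|t| <= eta -> `|t'| <= eta ->
     v t (al s) = v t' (al s') -> s = s' /\ t = t') ->
  forall e, 0 < e ->
    nbhs (al s0) [set x | exists s t, [/\ `|s - s0| < e, `|t| < e & x = v t (al s)]].
Proof.
move=> eta0 cal inj e e0.
have [U [f [g [r [[oU cf fU r0 gr] Us0]]]]] := has_chart (al s0).
have [d d0 Hd] : exists2 d : K, 0 < d & forall s t, `|s - s0| <= d -> `|t| <= d -> U (v t (al s)).
  have : \forall p \near (s0, (0 : K)), U (v p.2 (al p.1)).
    have c : cts_at (fun p : K * K => v p.2 (al p.1)) (s0, 0) by ctsv.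
    by apply: c; rewrite /= v0; exact: open_nbhs_nbhs.
  move=> /near_normP[d d0 Hd]; exists (d / 2); first by rewrite divr_gt0.
  move=> s t h1 h2; apply: (Hd (s, t)).
  have h : d / 2 < d by rewrite ltr_pdivrMr // ltr_pMr // ltr1n.
  by rewrite pair_norm_lt /= subr0 !(le_lt_trans _ h).
pose b := Num.min (Num.min d eta) (e / 2).
have b0 : 0 < b by rewrite !lt_min d0 eta0 divr_gt0.
have b1 : b <= d by rewrite !ge_min lexx.
have b2 : b <= eta by rewrite !ge_min lexx !orbT.
have b3 : b < e.
  by rewrite gt_min (_ : e / 2 < e) ?orbT // ltr_pdivrMr // ltr_pMr // ltr1n.
pose F (p : K * K) := f (v (clamp (- b) b p.2) (al (clamp (s0 - b) (s0 + b) p.1))).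
have inU p : U (v (clamp (- b) b p.2) (al (clamp (s0 - b) (s0 + b) p.1))).
  have h1 := @clamp_in _ (- b) b p.2; have h2 := @clamp_in _ (s0 - b) (s0 + b) p.1.
  by apply: Hd; rewrite ler_norml; [have := h2 (ltac:(flra)) | have := h1 (ltac:(flra))]; flra.
have FE p : `|p.1 - s0| <= b -> `|p.2 - 0| <= b -> F p = f (v p.2 (al p.1)) /\ U (v p.2 (al p.1)).
  rewrite subr0 !ler_norml => h1 h2; have := inU p.
  by rewrite /F !clampE //; flra.
have cF : continuous F.
  move=> p; apply: cts_at_continuous.
  apply: (cts_comp (f := fun p : K * K => v (clamp (- b) b p.2) (al (clamp (s0 - b) (s0 + b) p.1))) (g := f)).
    by ctsv.
  exact: cf.
have /= := @invariance_of_domain _ F (s0, 0) b b b0 b0 cF.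
have -> : F (s0, 0) = f (al s0).
  by have [-> _] := FE (s0, 0) (ltac:(by rewrite /= subrr normr0 ltW)) (ltac:(by rewrite /= subrr normr0 ltW)); rewrite /= v0.
move=> H; have {}H := H _.
have : \forall q \near f (al s0), exists p, [/\ `|p.1 - s0| <= b, `|p.2 - 0| <= b & F p = q].
  apply: H => p q p1 p2 q1 q2; have [-> Up] := FE p p1 p2; have [-> Uq] := FE q q1 q2.
  move=> /(congr1 g); have [_ ->] := fU _ Up; have [_ ->] := fU _ Uq.
  move: p1 p2 q1 q2; rewrite !subr0 => p1 p2 q1 q2 E.
  have [||||E1 E2] := inj p.1 q.1 p.2 q.2 _ _ _ _ E; try by apply: (le_trans _ b2).
  by rewrite [p]surjective_pairing [q]surjective_pairing E1 E2.
move=> H'; have H1 : \forall x \near al s0, exists p, [/\ `|p.1 - s0| <= b, `|p.2 - 0| <= b & F p = f x].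
  exact: (cf _ Us0 _ H').
have H2 : \forall x \near al s0, U x by exact: open_nbhs_nbhs.
near=> x; have Ux : U x by near: x.
have [p [p1 p2]] : exists p, [/\ `|p.1 - s0| <= b, `|p.2 - 0| <= b & F p = f x] by near: x.
have [-> Up] := FE p p1 p2; move=> /(congr1 g); have [_ ->] := fU _ Up; have [_ ->] := fU _ Ux.
move=> E; exists p.1, p.2; split; [exact: le_lt_trans b3 | | by []].
by rewrite -[p.2]subr0; exact: le_lt_trans b3.
Unshelve. all: by end_near. Qed.

(** Equivalent to injectivity of (s, t) |-> v t (sg s) for times at most a / 2, with both times
    gathered on one side. *)
Definition box_injective (l : K) (sg : K -> S) a : Prop :=
  forall s s' t, l <= s <= 1 -> l <= s' <= 1 -> `|t| <= a ->
    v t (sg s) = sg s' -> s = s' /\ t = 0.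

(* The box is two-sided for l = -1; it is one-sided, y lying on its edge, for l = 0. *)
Definition flowbox (l : K) (sg : K -> S) a y : Prop :=
  [/\ 0 < a, continuous sg, sg 0 = y, box_injective l sg a &
    forall s0 e, s0 = 0 \/ l < s0 < 1 -> 0 < e -> nbhs (sg s0)
      [set x | exists s t, [/\ l <= s <= 1, `|s - s0| < e, `|t| < e & x = v t (sg s)]]].

Lemma box_nbhs l (sg : K -> S) a s1 e : 0 < a -> continuous sg -> box_injective l sg a ->
  l < s1 < 1 -> 0 < e -> nbhs (sg s1)
    [set x | exists s t, [/\ l <= s <= 1, `|s - s1| < e, `|t| < e & x = v t (sg s)]].
Proof.
move=> a0 csg inj /andP[ls s11] e0.
pose d := Num.min (a / 2) (Num.min (s1 - l) (1 - s1)).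
have d0 : 0 < d by rewrite !lt_min !subr_gt0 ls s11 divr_gt0.
have d1 : d <= a / 2 by rewrite ge_min lexx.
have d2 : d <= s1 - l by rewrite !ge_min lexx !orbT.
have d3 : d <= 1 - s1 by rewrite !ge_min lexx !orbT.
pose e' := Num.min e d.
have e'0 : 0 < e' by rewrite lt_min e0.
have e'1 : e' <= e by rewrite ge_min lexx.
have e'2 : e' <= d by rewrite ge_min lexx orbT.
have := @box_open sg s1 d d0 csg _ e' e'0; move=> H.
have {}H := H _; apply: filterS (H _).
  move=> x [s [t [h1 h2 ->]]]; exists s, t; split => //.
  - by move: h1; rewrite ltr_norml; flra.
  - exact: lt_le_trans e'1.
  - exact: lt_le_trans e'1.
move=> s s' t t'; rewrite !ler_norml => h1 h2 h3 h4 E.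
have [||||-> tt] := inj s s' (t - t'); [flra | flra | by rewrite ler_norml; flra | |].
  by rewrite addrC vD E vK.
by split => //; flra.
Qed.

Lemma flowbox_of_arc (al : K -> S) s0 a : continuous al -> 0 < s0 < 1 -> 0 < a ->
  box_injective 0 al a -> exists sg, flowbox (-1) sg a (al s0).
Proof.
move=> cal /andP[s00 s01] a0 inj.
pose m := Num.min s0 (1 - s0).
have m0 : 0 < m by rewrite lt_min s00 subr_gt0.
have m1 : m <= s0 by rewrite ge_min lexx.
have m2 : m <= 1 - s0 by rewrite ge_min lexx orbT.
pose sg s := al (s0 + m * clamp (-1) 1 s).
have csg : continuous sg by move=> s; rewrite /sg; cts.
have isg : box_injective (-1) sg a.
  move=> s s' t h1 h2 ta; rewrite /sg !clampE // => E.
  have [||E1 E2] := inj _ _ t _ _ ta E; [nra | nra |].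
  split => //; move: E1 => /addrI/mulfI; apply; exact: lt0r_neq0.
exists sg; split => //.
  by rewrite /sg clampE ?mulr0 ?addr0 //; flra.
move=> s1 e hs1 e0; apply: (box_nbhs a0) => //.
by case: hs1 => [->|//]; flra.
Qed.

(** Sliding along the flow projects a square of the chart onto the section, so points of the section
    near y are joined by injective arcs inside it. If such an arc has y in its interior, it gives a
    two-sided box. Otherwise an arc that starts at y must exhaust the section near y, since a second
    branch at y would extend it beyond y; this gives a one-sided box. *)
Lemma flowbox_exists y : ~ singular y ->
  exists l sg a, (l = -1 \/ l = 0) /\ flowbox l sg a y.
Proof.
move=> ny; have [a [M [T [Sg [a0 oM My [Ty Sgy] [HM HS]]]]]] := exists_local_section ny.
have [U [f [g [r [[oU cf fU r0 gr] Uy]]]]] := has_chart y.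
pose z0 := f y; have [z02 gz0] : 0 <= z0.2 /\ g z0 = y := fU y Uy.
pose pi z := v (T z) z.
have cpi z : M z -> cts_at pi z.
  by move=> /HM[_ _ cT]; rewrite /pi; apply: cts_flow; cts.
(* The bound 3 a, together with [|T z| <= a], makes up the 4 a granted by the local section. *)
have uniqT z t : M z -> Sg (v t z) -> `|t| <= a *+ 3 -> t = T z.
  move=> Mz h1 h2; have [h3 h4 _] := HM z Mz.
  have : t - T z = 0.
    apply: (HS _ _ _ h4 h1); last by rewrite -vD subrK.
    by move: h2 h3; rewrite !ler_norml; flra.
  by move/eqP; rewrite subr_eq0 => /eqP.
have piE x : M x -> Sg x -> pi x = x.
  move=> Mx Sx; rewrite /pi -(uniqT x 0) ?v0 // normr0 mulrn_wge0 // ltW //.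
have piy : pi y = y by exact: piE.
have cg0 : cts_at g z0 by have [] := gr z0 (ltac:(by rewrite subrr normr0)).
have cpg : cts_at (fun q => pi (g q)) z0.
  by apply: (cts_comp (f := g) (g := pi)) => //; rewrite gz0; exact: cpi.
have near_pg (O : set S) : nbhs y O -> \forall q \near z0, O (pi (g q)).
  by move=> Oy; apply: cpg; rewrite gz0 piy.
have [rho0 rho00 Hrho] : exists2 rho0 : K, 0 < rho0 & forall q, `|q - z0| < rho0 ->
    [/\ `|q - z0| < r, M (g q), U (pi (g q)), M (pi (g q)) & `|f (pi (g q)) - z0| < r].
  apply/near_normP.
  have H1 : \forall q \near z0, `|q - z0| < r by apply/near_normP; exists r.
  have H2 : \forall q \near z0, M (g q) by apply: cg0; rewrite gz0; exact: open_nbhs_nbhs.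
  have H3 : \forall q \near z0, U (pi (g q)) by apply: near_pg; exact: open_nbhs_nbhs.
  have H4 : \forall q \near z0, M (pi (g q)) by apply: near_pg; exact: open_nbhs_nbhs.
  have H5 : \forall q \near z0, `|f (pi (g q)) - z0| < r.
    apply: (near_pg [set x | `|f x - z0| < r]).
    apply: (cts_near_lt (f := fun x => `|f x - z0|)); last by rewrite subrr normr0.
    by have cfy := cf y Uy; cts.
  by near=> q; split; near: q.
(* The piece of the section onto which the square of radius rho is projected. *)
pose D rho x := exists2 q, `|q - z0| < rho & x = pi (g q).
have Dsmall (O : set S) : nbhs y O -> exists2 rho : K, 0 < rho <= rho0 & forall x, D rho x -> O x.
  move=> /near_pg/near_normP[d d0 Hd]; exists (Num.min d rho0).
    by rewrite lt_min d0 rho00 ge_min lexx orbT.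
  by move=> x [q qd ->]; apply: Hd; apply: lt_le_trans qd _; rewrite ge_min lexx.
have Dnear (rho : K) : 0 < rho -> \forall x \near y, M x /\ D rho (pi x).
  move=> rho1; have H1 : \forall x \near y, U x by exact: open_nbhs_nbhs.
  have H2 : \forall x \near y, M x by exact: open_nbhs_nbhs.
  have H3 : \forall x \near y, `|f x - z0| < rho.
    apply: (cts_near_lt (f := fun x => `|f x - z0|)); last by rewrite subrr normr0.
    by have cfy := cf y Uy; cts.
  near=> x; split; first by near: x.
  have Ux : U x by near: x.
  by exists (f x); [near: x | have [_ ->] := fU x Ux].
have DSg rho x : rho <= rho0 -> D rho x -> [/\ Sg x, M x & U x].
  move=> h [q qr ->]; have [h1 h2 h3 h4 h5] := Hrho q (lt_le_trans qr h).
  by have [_ ? _] := HM _ h2.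
have Dy rho : 0 < rho -> D rho y by move=> h; exists z0; rewrite ?subrr ?normr0 // gz0 piy.
have arcs rho x1 x2 : rho <= rho0 -> D rho x1 -> D rho x2 -> x1 <> x2 ->
    exists al : K -> S, [/\ continuous al, al 0 = x1, al 1 = x2,
      (forall s s', 0 <= s <= 1 -> 0 <= s' <= 1 -> al s = al s' -> s = s') & forall s, D rho (al s)].
  move=> hr [q1 q1r E1] [q2 q2r E2] x12.
  pose qs s := q1 + clamp 0 1 s *: (q2 - q1).
  have qsr s : `|qs s - z0| < rho.
    have := @clamp_in _ 0 1 s ler01; set l := clamp 0 1 s => hl.
    move: q1r q2r; rewrite !pair_norm_lt /= !ltr_norml => /andP[A1 A2] /andP[B1 B2].
    have conv (u1 u2 z : K) : - rho < u1 - z < rho -> - rho < u2 - z < rho ->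
        - rho < u1 + l * (u2 - u1) - z < rho.
      move=> h1 h2; have -> : u1 + l * (u2 - u1) - z = (1 - l) * (u1 - z) + l * (u2 - z) by ring.
      exact: convex_comb_lt.
    by apply/andP; split; [exact: (conv _ _ _ A1 B1) | exact: (conv _ _ _ A2 B2)].
  have qsin s := Hrho _ (lt_le_trans (qsr s) hr).
  have cqs s : cts_at qs s by rewrite /qs; cts.
  pose c s := f (pi (g (qs s))).
  have cc : continuous c.
    move=> s; apply: cts_at_continuous; have [h1 h2 h3 h4 h5] := qsin s.
    apply: (cts_comp (f := fun s => pi (g (qs s))) (g := f)); last exact: cf.
    apply: (cts_comp (f := fun s => g (qs s)) (g := pi)); last exact: cpi.
    apply: (cts_comp (f := qs) (g := g)); first exact: cqs.
    by have [] := gr _ h1.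
  have gc s : g (c s) = pi (g (qs s)).
    by have [h1 h2 h3 h4 h5] := qsin s; have [_ ->] := fU _ h3.
  have c0E : g (c 0) = x1.
    by rewrite gc /qs clampE ?scale0r ?addr0 ?lexx ?ler01.
  have c1E : g (c 1) = x2.
    by rewrite gc /qs clampE ?scale1r ?lexx ?ler01 // addrC subrK.
  have [|be [cbe b0 b1 binj bc]] := exists_plane_arc cc.
    by move=> E; apply: x12; rewrite -c0E -c1E E.
  exists (fun s => g (be s)); split.
  - move=> s; apply: cts_at_continuous; apply: (cts_comp (f := be) (g := g)); first exact: cbe.
    have [t _ ->] := bc s; have [_ _ _ _ h5] := qsin t.
    by have [] := gr _ h5.
  - by rewrite b0.
  - by rewrite b1.
  - move=> s s' s01 s'01 E; apply: binj => //.
    have [t _ Et] := bc s; have [t' _ Et'] := bc s'.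
    move: E; rewrite Et Et' !gc => E.
    by rewrite /c E.
  - by move=> s; have [t _ ->] := bc s; rewrite gc; exists (qs t).
have binj (al : K -> S) : (forall s, Sg (al s)) ->
    (forall s s', 0 <= s <= 1 -> 0 <= s' <= 1 -> al s = al s' -> s = s') -> box_injective 0 al a.
  move=> Sal inj s s' t h1 h2 ta E.
  have t0 : t = 0.
    by apply: (HS _ _ _ (Sal s) (Sal s')) => //; apply: le_trans ta _; rewrite mulrS lerDl mulrn_wge0 // ltW.
  by split => //; apply: inj => //; rewrite -E t0 v0.
have [[al [s0 [cal Sal inj s01 <-]]]|nI] := pselect (exists (al : K -> S) s0,
  [/\ continuous al, (forall s, Sg (al s)),
    (forall s s', 0 <= s <= 1 -> 0 <= s' <= 1 -> al s = al s' -> s = s'), 0 < s0 < 1 & al s0 = y]).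
  have [sg Hsg] := flowbox_of_arc cal s01 a0 (binj al Sal inj).
  by exists (-1), sg, a; split => //; left.
(* If the section reduced to y, the time T alone would embed an open subset of the plane into a
   line; F = (T, 0) would then contradict invariance of domain. *)
have [x1 Dx1 x1y] : exists2 x1, D rho0 x1 & x1 <> y.
  apply: contrapT => nx.
  have const q : `|q - z0| < rho0 -> pi (g q) = y.
    move=> qr; apply: contrapT => h; apply: nx; exists (pi (g q)) => //.
    by exists q.
  pose b := rho0 / 4; have b0 : 0 < b by rewrite /b; flra.
  (* The rectangle is moved upwards off the axis, where folding is the identity and g is
     injective. *)
  pose c1 := z0.1; pose c2 := z0.2 + rho0 / 2.
  pose cq (q : K * K) := (clamp (c1 - b) (c1 + b) q.1, clamp (c2 - b) (c2 + b) q.2).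
  have cqr q : `|cq q - z0| < rho0.
    have h1 := @clamp_in _ (c1 - b) (c1 + b) q.1 (ltac:(flra)).
    have h2 := @clamp_in _ (c2 - b) (c2 + b) q.2 (ltac:(flra)).
    by rewrite pair_norm_lt /= !ltr_norml; move: h1 h2; rewrite /c1 /c2 /b; flra.
  pose F (q : K * K) : K * K := (T (g (cq q)), 0).
  have cF : continuous F.
    move=> q; apply: cts_at_continuous; apply: cts_pair; last by cts.
    have [h1 h2 h3 h4 h5] := Hrho _ (cqr q).
    apply: (cts_comp (f := fun q => g (cq q)) (g := T)); last by have [] := HM _ h2.
    apply: (cts_comp (f := cq) (g := g)); first by rewrite /cq; cts.
    by have [] := gr _ h1.
  have cqE (q : K * K) : `|q.1 - c1| <= b -> `|q.2 - c2| <= b -> cq q = q.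
    rewrite !ler_norml => h1 h2; rewrite /cq !clampE; [by case: (q) | flra | flra].
  have /= := @invariance_of_domain _ F (c1, c2) b b b0 b0 cF.
  move=> H; have {}H := H _.
  have /near_normP[e e0 He] : \forall q \near F (c1, c2),
      exists p, [/\ `|p.1 - c1| <= b, `|p.2 - c2| <= b & F p = q].
    apply: H => p q p1 p2 q1 q2 [ET].
    have pE := cqE p p1 p2; have qE := cqE q q1 q2.
    have pr := cqr p; have qr := cqr q.
    rewrite pE in pr ET; rewrite qE in qr ET.
    have : g p = g q.
      by have := const p pr; rewrite -(const q qr) /pi ET; exact: v_inj.
    move=> /(congr1 f).
    have [h1 _ _ _ _] := Hrho _ pr; have [h2 _ _ _ _] := Hrho _ qr.
    have [_ _ ->] := gr _ h1; have [_ _ ->] := gr _ h2.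
    rewrite /fold_plane !max_r; [by case: (p) (q) => ? ? [] | |];
      [move: q2 | move: p2]; rewrite ler_norml /c2 /b; flra.
  have [|p [_ _ Fp]] := He (F (c1, c2) + (0, e / 2)).
    by rewrite addrC addrA addNr add0r pair_norm_lt /= normr0 e0 gtr0_norm; flra.
  by move: (congr1 snd Fp); rewrite /F /=; flra.
have [al [cal al0 al1 ainj aD]] := arcs rho0 y x1 (lexx _) (Dy _ rho00) Dx1 (nesym x1y).
have Sal s : Sg (al s) by have [] := DSg _ _ (lexx _) (aD s).
have abox := binj al Sal ainj.
(* Near y the section avoids the other end x1 of [al]. *)
have /Dsmall[rho /andP[rho1 rho2] Drho] : nbhs y [set x | x <> x1].
  by apply: (@cts_near_neq _ _ (fun x => x) (fun=> x1) y); [ | cts | cts | exact: nesym].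
have cover w : D rho w -> exists2 s, 0 <= s < 1 & w = al s.
  move=> Dw; apply: contrapT => nw.
  have wy : y <> w by move=> E; apply: nw; exists 0; rewrite ?lexx ?ltr01 // al0.
  have [be [cbe b0 b1 beinj bD]] := arcs rho y w rho2 (Dy _ rho1) Dw wy.
  have Sbe s : Sg (be s) by have [] := DSg _ _ rho2 (bD s).
  pose P s := exists2 u, 0 < u < 1 & be s = al u.
  (* Meeting the interior of [al] is an open and closed condition along [be] after its start: box
     neighbourhoods give openness, and the ends of [al] are excluded by injectivity of [be] and by
     the choice of rho. As w is not on [al], the two arcs share only y. *)
  have loc s : 0 < s <= 1 -> \forall s' \near s, 0 < s' <= 1 -> (P s' <-> P s).
    move=> s01; have [[u u01 E]|nP] := pselect (P s).
      have H := @box_nbhs 0 al a u (Num.min a (Num.min u (1 - u))) a0 cal abox u01.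
      have {H} : \forall s' \near s, P s'.
        have : nbhs (be s) [set x | exists s t, [/\ 0 <= s <= 1, `|s - u| < Num.min a (Num.min u (1 - u)),
            `|t| < Num.min a (Num.min u (1 - u)) & x = v t (al s)]].
          by rewrite E; apply: H; rewrite !lt_min a0 subr_gt0.
        move=> /(cts_nbhs (cbe s)); apply: filterS => s' [u' [t [h1 h2 h3 E']]].
        move: h2 h3; rewrite !lt_min => /and3P[_ h4 h5] /andP[h6 _].
        exists u'; first by move: h4 h5; rewrite !ltr_norml; flra.
        suff t0 : t = 0 by rewrite E' t0 v0.
        apply: (HS _ _ _ (Sal u') (Sbe s')) => //.
        by apply: (le_trans (ltW h6)); rewrite mulrS lerDl mulrn_wge0 // ltW.
      by apply: filterS => s' Ps' _; split => // _; exists u.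
    have : \forall s' \near s, forall u, 0 <= u <= 1 -> al u <> be s'.
      apply: (@segment_near_forall _ _ 0 1 s (fun u s' => al u <> be s')) => u u01.
      apply: (@cts_near_neq _ _ (fun p : K * K => al p.1) (fun p => be p.2)) => //; [by cts | by cts |].
      move=> /= E; case: (ltrgtP u 0) => h0; first by flra.
        case: (ltrgtP u 1) => h1.
        - by apply: nP; exists u; [flra | rewrite E].
        - by flra.
        - by apply: (Drho (be s) (bD s)); rewrite /= -E h1.
      have : s = 0 by apply: beinj => //; [flra | flra | rewrite b0 -E h0].
      by flra.
    apply: filterS => s' H s'01; split => // -[u u01 E].
    by case: (H u) => //; flra.
  have nP s : 0 < s <= 1 -> ~ P s.
    move=> s01 Ps; have P1 : P 1.
      apply: (@segment_locally_constant _ s 1 P _ s) => //; [|flra|flra] => x xs.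
      have : \forall s' \near x, 0 < s' <= 1 -> (P s' <-> P x) by apply: loc; flra.
      by apply: filterS => s' H hs'; apply: H; flra.
    by case: P1 => u u01; rewrite b1 => E; apply: nw; exists u => //; flra.
  (* [al] run backwards to y, followed by [be]: an injective arc with y inside, contrary to [nI]. *)
  pose ga s := if s <= 2^-1 then al (clamp 0 1 (1 - s * 2)) else be (clamp 0 1 (s * 2 - 1)).
  apply: nI; exists ga, 2^-1; split.
  - apply: cts_glue; [by move=> s; cts | by move=> s; cts |].
    rewrite (_ : 2^-1 * 2 = 1); last by flra.
    by rewrite !subrr clampE ?lexx ?ler01 // al0 b0.
  - by move=> s; rewrite /ga; case: ifP.
  - have disj s s' : 0 <= s <= 2^-1 -> 2^-1 < s' <= 1 -> ga s <> ga s'.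
      move=> h1 h2; have h3 : s <= 2^-1 by flra.
      have h4 : (s' <= 2^-1) = false by apply/negbTE; rewrite -ltNge; flra.
      rewrite /ga h3 h4 !clampE; [|flra|flra] => E.
      have s'0 : 0 < s' * 2 - 1 <= 1 by flra.
      case: (ltrgtP s 2^-1) => h5; [|flra|].
        case: (ltrgtP s 0) => h6; first by flra.
          by apply: (nP _ s'0); exists (1 - s * 2); [flra | rewrite E].
        apply: (Drho _ (bD (s' * 2 - 1))); rewrite /= -E h6 mul0r subr0; exact: al1.
      have : s' * 2 - 1 = 0.
        apply: beinj; [flra | flra |].
        by rewrite b0 -E h5 (_ : 1 - 2^-1 * 2 = 0) //; flra.
      by flra.
    move=> s s' s01 s'01; case: (leP s 2^-1) => h1; case: (leP s' 2^-1) => h2.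
    + rewrite /ga h1 h2 !clampE; [|flra|flra] => E.
      have : 1 - s * 2 = 1 - s' * 2 by apply: ainj E; flra.
      by flra.
    + by move=> E; case: (disj s s' _ _ E); flra.
    + by move=> /esym E; case: (disj s' s _ _ E); flra.
    + rewrite /ga !leNgt h1 h2 /= !clampE; [|flra|flra] => E.
      have : s * 2 - 1 = s' * 2 - 1 by apply: beinj E; flra.
      by flra.
  - by flra.
  - rewrite /ga lexx (_ : 1 - 2^-1 * 2 = 0); last by flra.
    by rewrite clampE ?lexx ?ler01.
exists 0, al, a; split; first by right.
split => //.
move=> s0 e [->|hs0] e0; last exact: (box_nbhs a0).
rewrite al0.
have H1 := Dnear rho rho1.
have H2 : \forall x \near y, `|T x| < e.
  have [_ _ cT] := HM y My.
  by apply: (cts_near_lt (f := fun x => `|T x|)); [cts | rewrite Ty normr0].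
(* Points of [al] with parameter at least e stay away from y, so the projection of a point near y
   has a small parameter. *)
have H3 : \forall x \near y, forall s, e <= s <= 1 -> al s <> pi x.
  apply: (@segment_near_forall _ _ e 1 y (fun s x => al s <> pi x)) => s hs.
  apply: (@cts_near_neq _ _ (fun p : K * S => al p.1) (fun p => pi p.2)) => //; first by cts.
    by apply: (cts_comp (f := snd) (g := pi)); [cts | exact: cpi].
  rewrite /= piy -al0 => /ainj E; have : s = 0 by apply: E; flra.
  by flra.
near=> x.
have [Mx /cover[s s01 E]] : M x /\ D rho (pi x) by near: x.
exists s, (- T x); split; [flra | | by rewrite normrN; near: x | by rewrite -E /pi vK].
rewrite subr0 ger0_norm; last by flra.
rewrite ltNge; apply/negP => h.
have H : forall s, e <= s <= 1 -> al s <> pi x by near: x.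
by apply: (H s) => //; flra.
Unshelve. all: by end_near. Qed.

(** * First return maps *)

Lemma period_nat (T : K) z n : v T z = z -> v (T *+ n) z = z.
Proof. by move=> E; elim: n => [|n IH]; rewrite ?mulr0n ?v0 // mulrS vD IH. Qed.

Lemma period_reduce (T : K) z t : 0 < T -> v T z = z ->
  exists2 u : K, 0 <= u <= T & v t z = v u z.
Proof.
move=> T0 E; have [t0|t0] := leP 0 t.
  have := truncn_itv (divr_ge0 t0 (ltW T0)); set n := Num.trunc _.
  rewrite ler_pdivlMr // ltr_pdivrMr // -natr1 mulrDl mul1r => h.
  exists (t - T *+ n); first by rewrite -mulr_natl; flra.
  by rewrite -[in RHS](period_nat n E) -vD subrK.
have t0' : 0 <= - t / T by rewrite divr_ge0 ?ltW // oppr_gt0.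
have := truncn_itv t0'; set n := Num.trunc _.
rewrite ler_pdivlMr // ltr_pdivrMr // -natr1 mulrDl mul1r => h.
exists (t + T *+ n.+1); first by rewrite -mulr_natl -natr1 mulrDl mul1r; flra.
by rewrite vD (period_nat n.+1 E).
Qed.

(** A flow box bounds the positive periods of y from below by a, so their infimum is positive; it is
    a period by continuity. *)
Lemma exists_min_period y : ~ singular y ->
  exists T : K, [/\ 0 < T, v T y = y & forall t, 0 < t < T -> v t y <> y].
Proof.
move=> ny; have [l [sg [a [hl [a0 _ sg0 inj _]]]]] := flowbox_exists ny.
have l0 : l <= (0 : K) <= 1 by case: hl => ->; flra.
pose E : set K := [set t | 0 < t /\ v t y = y].
have Ea t : E t -> a < t.
  move=> [t0 vt]; rewrite ltNge; apply/negP => ta.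
  have [||_ tE] := inj 0 0 t l0 l0; [by rewrite gtr0_norm | by rewrite sg0 |].
  by rewrite tE ltxx in t0.
have [T0 ET0] : E !=set0.
  by have [//|[T T0 vT]] := all_closed y; exists T.
have bE : has_lbound E by exists a => t /Ea /ltW.
have hE : has_inf E by split => //; exists T0.
exists (inf E); split.
- by apply: lt_le_trans a0 _; apply: lb_le_inf; [exists T0 | move=> t /Ea /ltW].
- apply: contrapT => nE.
  have /near_normP[e e0 He] : \forall t \near inf E, v t y <> y.
    by apply: (@cts_near_neq _ _ (fun t => v t y) (fun=> y)) => //; ctsv.
  have [t [t0 vt] te] := inf_adherent e0 hE.
  apply: (He t) => //; have := ge_inf bE (conj t0 vt).
  by rewrite ltr_norml; flra.
- move=> t /andP[t0 tE] vt; have := ge_inf bE (conj t0 vt).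
  by rewrite leNgt tE.
Qed.

(** Two crossings less than a apart in time coincide. Cutting [0, T] into N + 1 slots of length a,
    with N the integer part of T / a, the pigeonhole principle excludes N + 2 distinct crossings. *)
Lemma finite_plaques l sg a y z (u : nat -> K) (T : K) : flowbox l sg a y -> 0 < T -> v T z = z ->
  injective u -> (forall n, l <= u n <= 1) -> ~ (forall n, exists t, v t z = sg (u n)).
Proof.
move=> [a0 _ _ inj _] T0 vT uinj ul Hu.
have /choice[tau Htau] : forall n, exists t, 0 <= t <= T /\ v t z = sg (u n).
  move=> n; have [t vt] := Hu n; have [t' t'T E] := period_reduce t T0 vT.
  by exists t'; rewrite -E.
pose N := Num.trunc (T / a).
have kN n : (Num.trunc (tau n / a)%R < N.+1)%N.
  rewrite ltnS; apply: le_truncn; rewrite ler_pM2r ?invr_gt0 //.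
  by have [/andP[]] := Htau n.
pose f (i : 'I_N.+2) : 'I_N.+1 := Ordinal (kN i).
suff finj : injective f by have := leq_card f finj; rewrite !card_ord ltnn.
move=> i j /(congr1 val) /= Eij; apply/val_inj/uinj.
have [i0 vi] := Htau i; have [j0 vj] := Htau j.
have hi : 0 <= tau i / a by apply: divr_ge0; flra.
have hj : 0 <= tau j / a by apply: divr_ge0; flra.
have := truncn_itv hi; have := truncn_itv hj; rewrite Eij; set n := Num.trunc _.
rewrite !ler_pdivlMr // !ltr_pdivrMr // -natr1 mulrDl mul1r => h1 h2.
have [||//] := inj (u i) (u j) (tau j - tau i) (ul i) (ul j); first by rewrite ler_norml; flra.
by rewrite -vi -vD subrK.
Qed.

(** Iterates of rho if rho s < s, successive preimages otherwise: either way the sequence decreases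
    and never leaves [0, s]. *)
Lemma monotone_sequence (rho : K -> K) e s : continuous rho -> rho 0 = 0 ->
  (forall x y : K, 0 <= x -> x < y -> y <= e -> rho x < rho y) ->
  0 < s <= e -> rho s != s ->
  exists u : nat -> K, [/\ injective u, u 0%N = s, (forall n, 0 <= u n <= s) &
    forall n, rho (u n) = u n.+1 \/ rho (u n.+1) = u n].
Proof.
move=> crho rho0 mono s0e rs.
have decr_inj (u : nat -> K) : (forall n, u n.+1 < u n) -> injective u.
  move=> H; have lt m n : (m < n)%N -> u n < u m.
    elim: n => // n IH; rewrite ltnS leq_eqVlt => /predU1P[->|/IH h]; first exact: H.
    exact: lt_trans (H n) h.
  move=> m n E; case: (ltngtP m n) => // /lt; by rewrite E ltxx.
have [h|h] : rho s < s \/ s < rho s by move: rs; rewrite neq_lt => /orP.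
  pose u n := iter n rho s.
  have H n : [/\ 0 < u n, u n <= s & rho (u n) < u n].
    elim: n => [|n [h1 h2 h3]]; first by rewrite /u /=; split; flra.
    have h4 : 0 < rho (u n) by rewrite -rho0; apply: mono; flra.
    by split; rewrite /u /= -/(u n); [flra | flra | apply: mono; flra].
  exists u; split => //.
  - by apply: decr_inj => n; have [] := H n.
  - by move=> n; have [h1 h2 _] := H n; flra.
  - by move=> n; left.
have /choice[k Hk] : forall x : K, exists w : K, 0 < x -> x <= s -> x < rho x ->
    [/\ 0 < w, w < x, w < rho w & rho w = x].
  move=> x; have [hx|nx] := pselect (0 < x /\ x <= s /\ x < rho x); last first.
    by exists 0 => h1 h2 h3; case: nx.
  have [h1 [h2 h3]] := hx.
  have [|||w] := @IVT _ rho 0 x x; first exact: ltW.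
  - exact: continuous_subspaceT.
  - have rx : 0 <= rho x by flra.
    by rewrite rho0 (min_l rx) (max_r rx); flra.
  rewrite in_itv /= => w1 w2; exists w => _ _ _.
  have wx : w != x by apply/eqP => E; move: h3; rewrite -{2}E w2 ltxx.
  have w0 : w != 0 by apply/eqP => E; move: h1; rewrite -w2 E rho0 ltxx.
  by split => //; [rewrite lt_neqAle eq_sym w0 | rewrite lt_neqAle wx | rewrite w2 lt_neqAle wx]; flra.
pose u n := iter n k s.
have H n : [/\ 0 < u n, u n <= s & u n < rho (u n)].
  elim: n => [|n [h1 h2 h3]]; first by rewrite /u /=; split; flra.
  have [k1 k2 k3 k4] := Hk _ h1 h2 h3.
  by split; rewrite /u /= -/(u n) //; flra.
exists u; split => //.
- by apply: decr_inj => n; have [h1 h2 h3] := H n; have [] := Hk _ h1 h2 h3.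
- by move=> n; have [h1 h2 _] := H n; flra.
- by move=> n; right; have [h1 h2 h3] := H n; have [] := Hk _ h1 h2 h3.
Qed.

(* A section through y together with its first return map r and the return time
   T + d; either r = id, or r is an orientation reversing involution (T + d' is
   the return time from r s back to s). *)
Record tube y (l : K) (sg : K -> S) (a T e : K) (r d d' : K -> K) : Prop := Tube {
  tube_l : l = -1 \/ l = 0;
  tube_box : flowbox l sg a y;
  tube_T : 0 < T;
  tube_per : v T y = y;
  tube_min : forall t, 0 < t < T -> v t y <> y;
  tube_e : 0 < e < 1;
  tube_r : continuous r;
  tube_d : continuous d;
  tube_d' : continuous d';
  tube_r0 : [/\ r 0 = 0, d 0 = 0 & d' 0 = 0];
  tube_ret : forall s, l * e <= s <= e ->
    [/\ l <= r s <= 1, `|d s| <= a / 4, `|d' s| <= a / 4,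
        v (T + d s) (sg s) = sg (r s) & v (T + d' s) (sg (r s)) = sg s];
  tube_cases : (forall s, l * e <= s <= e -> r s = s) \/
    (l = -1 /\ forall s s', l * e <= s -> s < s' -> s' <= e -> r s' < r s) }.

(** After the period T of y, a point of the section near y is back in the box, and sliding it along
    the flow by a small time d puts it on the section. Injectivity of the box makes r and d
    single-valued, continuous, and r injective. *)
Lemma flowbox_return y l sg a (T : K) : l = -1 \/ l = 0 -> flowbox l sg a y -> v T y = y ->
  exists (e : K) (r d : K -> K), [/\ 0 < e < 1, continuous r, continuous d, r 0 = 0 /\ d 0 = 0 &
    (forall s, l * e <= s <= e ->
       [/\ l <= r s <= 1, `|d s| <= a / 4 & v (T + d s) (sg s) = sg (r s)]) /\
    (forall s s', l * e <= s <= e -> l * e <= s' <= e -> r s = r s' -> s = s')].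
Proof.
move=> hl [a0 csg sg0 inj nb] vT.
have l0 : l <= (0 : K) <= 1 by case: hl => ->; flra.
have le_l e : 0 < e < 1 -> l <= l * e /\ l * e <= 0 by case: hl => ->; flra.
(* The bound 1/2 keeps r s away from the ends of the section other than 0, so that the box is a
   neighbourhood there; a / 4 keeps the sums of a few time corrections below a. *)
pose e1 := Num.min (a / 4) 2^-1.
have e10 : 0 < e1 by rewrite lt_min; apply/andP; split; flra.
have e1a : e1 <= a / 4 by rewrite ge_min lexx.
have e1h : e1 <= 2^-1 by rewrite ge_min lexx orbT.
have [e [e01 He]] : exists e : K, 0 < e < 1 /\ forall s, `|s| <= e ->
    exists s' t', [/\ l <= s' <= 1, `|s'| < e1, `|t'| < e1 & v T (sg s) = v t' (sg s')].
  have H := nb 0 e1 (or_introl erefl) e10.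
  have : \forall s \near (0 : K), exists s' t',
      [/\ l <= s' <= 1, `|s'| < e1, `|t'| < e1 & v T (sg s) = v t' (sg s')].
    have c : cts_at (fun s => v T (sg s)) 0 by ctsv.
    have : nbhs (v T (sg 0)) [set x | exists s t, [/\ l <= s <= 1, `|s - 0| < e1, `|t| < e1 & x = v t (sg s)]].
      by rewrite sg0 vT -sg0.
    move=> /(cts_nbhs c); apply: filterS => s [s' [t [h1 h2 h3 h4]]].
    by exists s', t; split => //; rewrite subr0 in h2.
  move=> /near_normP[d d0 Hd]; exists (Num.min (d / 2) 2^-1); split.
    by rewrite lt_min gt_min; apply/andP; split; [apply/andP; split; flra | apply/orP; right; flra].
  move=> s hs; apply: Hd; rewrite subr0; apply: le_lt_trans hs _.
  by rewrite gt_min; apply/orP; left; flra.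
have /choice[R HR] : forall s, exists p : K * K, `|s| <= e ->
    [/\ l <= p.1 <= 1, `|p.1| < 2^-1, `|p.2| <= a / 4 & v (T + p.2) (sg s) = sg p.1].
  move=> s; have [se|se] := pselect (`|s| <= e); last by exists 0.
  have [s' [t' [h1 h2 h3 h4]]] := He s se.
  exists (s', - t') => _ /=; split => //; [flra | by rewrite normrN; flra |].
  by rewrite addrC vD h4 vK.
pose D s := l * e <= s <= e.
have DE s : D s -> `|s| <= e by rewrite /D ler_norml; case: hl => ->; flra.
have Dl s : D s -> l <= s <= 1 by rewrite /D; case: hl => ->; flra.
pose r s := (R s).1; pose d s := (R s).2.
have Rr s : D s -> [/\ l <= r s <= 1, `|r s| < 2^-1, `|d s| <= a / 4 & v (T + d s) (sg s) = sg (r s)].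
  by move=> /DE /HR.
have cont s : D s -> forall eta : K, 0 < eta ->
    \forall s' \near s, D s' -> `|r s' - r s| < eta /\ `|d s' - d s| < eta.
  move=> Ds eta eta0; have [h1 h2 h3 h4] := Rr s Ds.
  have rs0 : r s = 0 \/ l < r s < 1.
    move: h1 h2; rewrite ltr_norml; case: hl => -> h1 h2; first by right; flra.
    by have [->|n] := eqVneq (r s) 0; [left | right; rewrite lt_neqAle eq_sym n; flra].
  pose et := Num.min eta (a / 4).
  have et0 : 0 < et by rewrite lt_min eta0; flra.
  have et1 : et <= eta by rewrite ge_min lexx.
  have et2 : et <= a / 4 by rewrite ge_min lexx orbT.
  have H := nb (r s) et rs0 et0.
  have c : cts_at (fun s' => v (T + d s) (sg s')) s by ctsv.
  rewrite -h4 in H; have := cts_nbhs c H; apply: filterS => s' [s'' [t [k1 k2 k3 k4]]] Ds'.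
  have [m1 m2 m3 m4] := Rr s' Ds'.
  have [||E1 E2] := inj s'' (r s') (t - (d s - d s')) k1 m1.
  - by move: k3 h3 m3; rewrite ltr_norml !ler_norml; flra.
  - rewrite -m4.
    have -> : t - (d s - d s') = (T + d s') - (T + d s) + t by ring.
    by rewrite vD -k4 -vD; congr v; ring.
  rewrite -E1 (lt_le_trans k2 et1); split => //.
  have -> : d s' - d s = - t by move: E2; flra.
  by rewrite normrN (lt_le_trans k3).
have D0 : D 0 by rewrite /D; have [] := le_l e e01; flra.
have r0 : r 0 = 0 /\ d 0 = 0.
  have [h1 h2 h3 h4] := Rr 0 D0.
  have [||E1 E2] := inj 0 (r 0) (d 0) l0 h1.
  - by move: h3; rewrite !ler_norml; flra.
  - by rewrite -h4 sg0 addrC vD vT.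
  by rewrite -E1 E2.
have rinj s s' : D s -> D s' -> r s = r s' -> s = s'.
  move=> Ds Ds' E; have [h1 h2 h3 h4] := Rr s Ds; have [k1 k2 k3 k4] := Rr s' Ds'.
  have [||//] := inj s s' (d s - d s') (Dl _ Ds) (Dl _ Ds').
  - by move: h3 k3; rewrite !ler_norml; flra.
  - have -> : d s - d s' = - (T + d s') + (T + d s) by ring.
    by rewrite vD h4 E -k4 vK.
pose cl s := clamp (l * e) e s.
have clD s : D (cl s) by apply: clamp_in; have [] := le_l e e01; flra.
have clE s : D s -> cl s = s by exact: clampE.
pose r1 s := r (cl s); pose d1 s := d (cl s).
have cr1d1 s : cts_at r1 s /\ cts_at d1 s.
  have ccl : cts_at cl s by rewrite /cl; cts.
  split; apply/cvgrPdist_lt => eta eta0; have := cts_nbhs ccl (cont _ (clD s) eta eta0);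
    by apply: filterS => s' /(_ (clD s'))[h1 h2]; rewrite distrC.
have cr1 : continuous r1 by move=> s; have [] := cr1d1 s.
have cd1 : continuous d1 by move=> s; have [] := cr1d1 s.
have r1E s : D s -> r1 s = r s by move=> Ds; rewrite /r1 clE.
have d1E s : D s -> d1 s = d s by move=> Ds; rewrite /d1 clE.
exists e, r1, d1; split => //; first by rewrite r1E // d1E.
split=> [s Ds|s s' Ds Ds']; last by rewrite !r1E //; exact: rinj.
by have [h1 h2 h3 h4] := Rr s Ds; rewrite r1E // d1E.
Qed.

(** A point that is moved would have infinitely many distinct iterates or preimages on its own
    orbit, which [finite_plaques] forbids. The sign [sgn] allows the same argument on the negative
    half of a two-sided section. *)
Lemma return_fixed y l sg a (rho : K -> K) (e2 : K) (sgn : K) : l = -1 \/ l = 0 ->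
  flowbox l sg a y -> sgn = 1 \/ (sgn = -1 /\ l = -1) ->
  0 < e2 < 1 -> continuous rho -> rho 0 = 0 ->
  (forall x y : K, 0 <= x -> x < y -> y <= e2 -> rho x < rho y) ->
  (forall x : K, 0 <= x <= e2 -> exists t, v t (sg (sgn * x)) = sg (sgn * rho x)) ->
  forall s, 0 <= s <= e2 -> rho s = s.
Proof.
move=> hl box; have [a0 csg sg0 inj nb] := box.
have per s : l <= s <= 1 -> exists2 T' : K, 0 < T' & v T' (sg s) = sg s.
  move=> hs; have [sing|//] := all_closed (sg s).
  have [|_ aE] := inj s s a hs hs _ (sing a); first by rewrite gtr0_norm.
  by rewrite aE ltxx in a0.
move=> hsgn he2 crho rho0 mono orb s hs; apply: contrapT => /eqP rs.
have s0 : s != 0 by apply/eqP => E; move: rs; rewrite E rho0 eqxx.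
have s0e : 0 < s <= e2 by rewrite lt_neqAle eq_sym s0; flra.
have [u [uinj u0 us ur]] := monotone_sequence crho rho0 mono s0e rs.
have ul n : l <= sgn * u n <= 1.
  have := us n; case: hsgn => [->|[-> ->]]; first by case: hl => ->; flra.
  by flra.
have [T' T'0 vT'] := per _ (ul 0%N).
apply: (finite_plaques (u := fun n => sgn * u n) box T'0 vT').
- move=> m n /mulfI E; apply: uinj; apply: E.
  by case: hsgn => [->|[-> _]]; rewrite ?oppr_eq0 oner_eq0.
- exact: ul.
- elim=> [|n [t IH]]; first by exists 0; rewrite v0.
  have [E|E] := ur n.
    have [|t' Et'] := orb (u n); first by have := us n; flra.
    by exists (t' + t); rewrite vD IH Et' E.
  have [|t' Et'] := orb (u n.+1); first by have := us n.+1; flra.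
  by exists (- t' + t); rewrite vD IH -E -Et' vK.
Qed.

(** A continuous injective return map is monotone. If increasing, it is the identity by
    [return_fixed], applied on each side of 0; if decreasing, the section is two-sided and the
    square of the map, which increases, is the identity. *)
Lemma tube_exists y : ~ singular y -> exists l sg a T e r d d', tube y l sg a T e r d d'.
Proof.
move=> ny; have [l [sg [a [hl box]]]] := flowbox_exists ny.
have [T [T0 vT minT]] := exists_min_period ny.
have [e [r1 [d1 [e01 cr1 cd1 [r10 d10] [Rr rinj]]]]] := flowbox_return hl box vT.
pose D s := l * e <= s <= e.
have D0 : D 0 by rewrite /D; case: hl => ->; flra.
have same_orbit s : D s -> exists t, v t (sg s) = sg (r1 s).
  by move=> Ds; have [_ _ h] := Rr s Ds; exists (T + d1 s).
have fixed := return_fixed hl box.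
have Din (x : K) : 0 <= x <= e -> D x by rewrite /D; case: hl => ->; flra.
have DinN (x : K) : l = -1 -> 0 <= x <= e -> D (-1 * x) by rewrite /D => ->; flra.
have [||incr|decr] := @itv_continuous_inj_mono _ r1 `[l * e, e].
- exact: continuous_subspaceT.
- move=> s s'; rewrite !in_itv /= => Ds Ds'; exact: rinj.
- have rs_id s : D s -> r1 s = s.
    move=> Ds; have [s0|s0] := leP 0 s.
      apply: (fixed r1 e 1) => //; [by left | | | ].
      + by move=> x w x0 xy ye; apply: incr => //; rewrite in_itv /=; apply: Din; flra.
      + by move=> x xe; rewrite !mul1r; apply: same_orbit; exact: Din.
      + by move: Ds; rewrite /D; flra.
    have l1 : l = -1 by case: hl => // l1; move: Ds; rewrite /D l1 mul0r; flra.
    (* The negative side is reached by conjugating the return map with the reflection of the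
       section. *)
    have := @fixed (fun x : K => - r1 (- x)) e (-1) (or_intror (conj erefl l1)).
    move=> H; have H' := H _ _ _ _ _ (- s); rewrite opprK in H'; suff : - r1 s = - s by move/oppr_inj.
    apply: H'.
    + by flra.
    + by move=> x; cts.
    + by rewrite oppr0 r10 oppr0.
    + move=> x w x0 xy ye; rewrite ltrN2; apply: incr; rewrite ?ltrN2 //.
        by rewrite in_itv /= -[- w]mulN1r; apply: DinN => //; flra.
      by rewrite in_itv /= -[- x]mulN1r; apply: DinN => //; flra.
    + move=> x xe; rewrite !mulN1r opprK; apply: same_orbit.
      by rewrite -mulN1r; apply: DinN.
    + by move: Ds; rewrite /D l1; flra.
  exists l, sg, a, T, e, r1, d1, d1; split => //.
  + move=> s Ds; have [h1 h3 h4] := Rr s Ds; split => //.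
    by move: h4; rewrite rs_id.
  + by left.
have l1 : l = -1.
  case: hl => // l1.
  have : r1 e < r1 0 by apply: decr; rewrite ?in_itv /= ?l1 ?mul0r; flra.
  rewrite r10.
  have De : D e by rewrite /D l1 mul0r; flra.
  have [h1 _ _] := Rr e De; move: h1; rewrite l1; flra.
(* The section is shortened so that the return map can be applied twice. *)
have [e2 [he2 He2]] : exists e2 : K, 0 < e2 <= e /\ forall s, `|s| <= e2 -> `|r1 s| <= e.
  have : \forall s \near (0 : K), `|r1 s| < e.
    apply: (cts_near_lt (f := fun s => `|r1 s|)); first by cts.
    by rewrite r10 normr0; flra.
  move=> /near_normP[q q0 Hq].
  have [||m [m0 mq me]] := @exists_le2 _ (q / 2) e; [flra | flra |].
  exists m; split; first by flra.
  by move=> s hs; apply: ltW; apply: Hq; rewrite subr0; apply: le_lt_trans hs _; flra.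
have D2 s : `|s| <= e2 -> D s by rewrite ler_norml /D l1; flra.
have D2r s : `|s| <= e2 -> D (r1 s) by move=> /He2; rewrite ler_norml /D l1; flra.
have he2' : 0 < e2 < 1 by flra.
have rr_id s : `|s| <= e2 -> r1 (r1 s) = s.
  have orb2 (x : K) : `|x| <= e2 -> exists t, v t (sg x) = sg (r1 (r1 x)).
    move=> hx; have [t Et] := same_orbit x (D2 x hx).
    by have [t' Et'] := same_orbit _ (D2r x hx); exists (t' + t); rewrite vD Et Et'.
  have incr2 (x w : K) : `|x| <= e2 -> `|w| <= e2 -> x < w -> r1 (r1 x) < r1 (r1 w).
    move=> hx hy xy; apply: (decr); rewrite ?in_itv /=; [exact: (D2r x) | exact: (D2r w) |].
    by apply: decr; rewrite ?in_itv /= //; [exact: D2 | exact: D2].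
  have rr0 : r1 (r1 0) = 0 by rewrite !r10.
  move=> hs; have [s0|s0] := leP 0 s.
    apply: (fixed (fun x : K => r1 (r1 x)) e2 1) => //; [by left | by move=> x; cts | | |].
    + by move=> x w x0 xy ye; apply: incr2 => //; rewrite ler_norml; flra.
    + by move=> x xe; rewrite !mul1r; apply: orb2; rewrite ler_norml; flra.
    + by move: hs; rewrite ler_norml; flra.
  have := @fixed (fun x : K => - r1 (r1 (- x))) e2 (-1) (or_intror (conj erefl l1)).
  move=> H; have H' := H _ _ _ _ _ (- s); rewrite opprK in H'.
  suff : - r1 (r1 s) = - s by move/oppr_inj.
  apply: H' => //.
  + by move=> x; cts.
  + by rewrite oppr0 rr0 oppr0.
  + by move=> x w x0 xy ye; rewrite ltrN2; apply: incr2; [rewrite ler_norml; flra | rewrite ler_norml; flra | flra].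
  + by move=> x xe; rewrite !mulN1r opprK; apply: orb2; rewrite normrN ler_norml; flra.
  + by move: hs; rewrite ler_norml; flra.
(* The way back from r s to s is the first return of r s, hence the correction d' = d o r. *)
exists l, sg, a, T, e2, r1, d1, (fun s => d1 (r1 s)); split => //.
- by move=> s; cts.
- by rewrite r10.
- move=> s; rewrite l1 => hs; have h : `|s| <= e2 by rewrite ler_norml; flra.
  have [h1 h3 h4] := Rr s (D2 s h); have [k1 k3 k4] := Rr _ (D2r s h).
  by split => //; rewrite -?l1 // k4 rr_id.
- right; split; first exact: l1.
  move=> s s' h1 h2 h3; rewrite l1 in h1.
  apply: decr; [rewrite in_itv /= l1; flra | rewrite in_itv /= l1; flra | exact: h2].
Qed.

Definition same_orbit x y : Prop := exists t : K, v t x = y.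

Lemma same_orbit_refl x : same_orbit x x. Proof. by exists 0. Qed.

Lemma same_orbit_sym x y : same_orbit x y -> same_orbit y x.
Proof. by move=> [t <-]; exists (- t); rewrite vK. Qed.

Lemma same_orbit_trans y x z : same_orbit x y -> same_orbit y z -> same_orbit x z.
Proof. by move=> [t <-] [t' <-]; exists (t' + t); rewrite vD. Qed.

Definition min_period z (T : K) : Prop :=
  [/\ 0 < T, v T z = z & forall t, 0 < t < T -> v t z <> z].

Lemma min_period_unique z (T T' : K) : min_period z T -> min_period z T' -> T = T'.
Proof.
move=> [h1 h2 h3] [k1 k2 k3]; case: (ltrgtP T T') => // h.
  by case: (k3 T) => //; rewrite h1 h.
by case: (h3 T') => //; rewrite k1 h.
Qed.

Lemma min_period_flow z (T : K) t : min_period z T -> min_period (v t z) T.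
Proof.
move=> [h1 h2 h3]; split => //; first by rewrite vC h2.
by move=> u hu E; apply: (h3 u hu); apply: (v_inj (t := t)); rewrite vC.
Qed.

(** * Crossings of a tube and stability of periodic orbits *)

Section Tube.
Variables (y : S) (l : K) (sg : K -> S) (a T e : K) (r d d' : K -> K).
Hypothesis tub : tube y l sg a T e r d d'.

Lemma tube_l01 : l <= (0 : K) <= 1.
Proof. by case: (tube_l tub) => ->; flra. Qed.

Lemma tube_aT : a < T.
Proof.
have [a0 _ sg0 inj _] := tube_box tub; have T0 := tube_T tub.
rewrite ltNge; apply/negP => Ta.
have [||_ E] := inj 0 0 T tube_l01 tube_l01; first by rewrite gtr0_norm.
  by rewrite sg0 (tube_per tub).
by move: T0; rewrite E ltxx.
Qed.

(** The time of two turns: a period in both cases, whether the return map is the identity or an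
    involution, but in general not the minimal one. *)
Definition tperiod (s : K) : K := (T + d' s) + (T + d s).

Lemma tperiodP s : l * e <= s <= e ->
  [/\ 0 < tperiod s, tperiod s <= 2 * T + a & v (tperiod s) (sg s) = sg s].
Proof.
move=> hs; have [_ h1 h2 h3 h4] := tube_ret tub hs; have aT := tube_aT.
have [a0 _ _ _ _] := tube_box tub.
rewrite /tperiod vD h3 h4; move: h1 h2; rewrite !ler_norml => h1 h2.
by split => //; flra.
Qed.

Lemma tube_far (b c h : K) : 0 < h -> (forall u, b + h <= u <= c - h -> v u y <> y) ->
  exists2 e' : K, 0 < e' & forall s s', `|s| <= e' -> `|s'| <= e' ->
    forall u, b + h <= u <= c - h -> v u (sg s) <> sg s'.
Proof.
move=> h0 ny; have [a0 csg sg0 _ _] := tube_box tub.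
have : \forall p \near ((0 : K), (0 : K)), forall u, b + h <= u <= c - h -> v u (sg p.1) <> sg p.2.
  apply: (segment_near_forall (Q := fun u (p : K * K) => v u (sg p.1) <> sg p.2)) => u hu.
  apply: (@cts_near_neq _ _ (fun p : K * (K * K) => v p.1 (sg p.2.1)) (fun p : K * (K * K) => sg p.2.2)) => //.
  - by ctsv.
  - by ctsv.
  - by rewrite /= sg0; exact: ny.
move=> [[A B] /= [/near_normP[e1 e10 H1] /near_normP[e2 e20 H2]] H].
have [||m [m0 m1 m2]] := @exists_le2 _ (e1 / 2) (e2 / 2); [flra | flra |].
exists m => // s s' hs hs'; apply: (H (s, s')); split.
  by apply: H1; rewrite /= subr0; flra.
by apply: H2; rewrite /= subr0; flra.
Qed.

(** Times further than a / 4 from 0, T and 2 T are excluded because y itself does not return then,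
    uniformly for nearby points; around each of these three times, injectivity of the box leaves one
    crossing. *)
Lemma tube_return : exists2 e' : K, 0 < e' <= e & forall s s' u,
  l * e' <= s <= e' -> l * e' <= s' <= e' -> v u (sg s) = sg s' -> 0 <= u <= tperiod s ->
  [\/ s' = s /\ u = 0, s' = r s /\ u = T + d s | s' = s /\ u = tperiod s].
Proof.
have [a0 csg sg0 inj _] := tube_box tub; have aT := tube_aT; have he := tube_e tub.
have a4 : 0 < a / 4 by flra.
have [|e1 e10 far1] := @tube_far 0 T _ a4.
  by move=> u hu; apply: (tube_min tub); flra.
have [|e2 e20 far2] := @tube_far T (2 * T) _ a4.
  move=> u hu E; apply: (tube_min tub (t := u - T)); first by flra.
  by rewrite -{1}(tube_per tub) -vD subrK.
have [|m [m0 m1 m2 m3]] := @exists_le3 _ e1 e2 e e10 e20; first by flra.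
exists m; first by flra.
move=> s s' u hs hs' E hu.
have ls : l <= s <= 1 by case: (tube_l tub) hs => ->; flra.
have ls' : l <= s' <= 1 by case: (tube_l tub) hs' => ->; flra.
have ns : `|s| <= m by rewrite ler_norml; case: (tube_l tub) hs => ->; flra.
have ns' : `|s'| <= m by rewrite ler_norml; case: (tube_l tub) hs' => ->; flra.
have hse : l * e <= s <= e by case: (tube_l tub) hs => ->; flra.
have [lr h1 h2 h3 h4] := tube_ret tub hse; rewrite !ler_norml in h1 h2.
have [P0 P1 P2] := tperiodP hse.
have nu1 : ~ (0 + a / 4 <= u <= T - a / 4).
  by move=> h; apply: (far1 s s' _ _ u h E); flra.
have nu2 : ~ (T + a / 4 <= u <= 2 * T - a / 4).
  by move=> h; apply: (far2 s s' _ _ u h E); flra.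
have [ua|ua] := leP u (a / 4).
  have [||E1 E2] := inj s s' u ls ls'; [by rewrite ler_norml; flra | exact: E |].
  by apply: Or31.
have [uT|uT] := leP u (T + a / 4).
  have uT' : T - a / 4 <= u by rewrite leNgt; apply/negP => h; apply: nu1; flra.
  have [||E1 E2] := inj (r s) s' (u - (T + d s)) lr ls'; first by rewrite ler_norml; flra.
    by rewrite -h3 -vD subrK.
  by apply: Or32; rewrite E1; split => //; flra.
have uT' : 2 * T - a / 4 <= u by rewrite leNgt; apply/negP => h; apply: nu2; flra.
have [||E1 E2] := inj s s' (u - tperiod s) ls ls'.
- by rewrite ler_norml; move: hu; rewrite /tperiod; flra.
- by rewrite -{1}P2 -vD subrK.
by apply: Or33; split; [exact: esym | flra].
Qed.

Lemma tube_involution s : l * e <= s <= e -> l * e <= r s <= e -> r (r s) = s.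
Proof.
move=> hs hr; have [a0 csg sg0 inj _] := tube_box tub; have he := tube_e tub.
have ls : l <= s <= 1 by case: (tube_l tub) hs => ->; flra.
have [lr h1 h2 h3 h4] := tube_ret tub hs; have [lr' k1 k2 k3 k4] := tube_ret tub hr.
rewrite !ler_norml in h1 h2 k1 k2.
have [||E1 E2] := inj s (r (r s)) (d (r s) - d' s) ls lr'; last exact: esym.
- by rewrite ler_norml; flra.
- rewrite -k3 -h4 -vD; congr v; ring.
Qed.

Lemma tube_nbhs (s0 : K) (eta : K) t0 : l <= s0 -> `|s0| < e -> 0 < eta ->
  nbhs (v t0 (sg s0)) [set x | exists s t, [/\ l <= s, `|s - s0| < eta & x = v t (sg s)]].
Proof.
move=> ls s0e eta0; have [a0 csg sg0 inj nb] := tube_box tub; have he := tube_e tub.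
have H : s0 = 0 \/ l < s0 < 1.
  move: s0e; rewrite ltr_norml => s0e; case: (tube_l tub) (ls) => -> ls'; first by right; flra.
  by have [->|n] := eqVneq s0 0; [left | right; rewrite lt_neqAle eq_sym n ls'; flra].
have := nbhs_flow t0 (nb s0 eta H eta0); apply: filterS => _ [_ [s [t [h1 h2 h3 ->]]] <-].
by exists s, (t0 + t); split; [flra | exact: h2 | rewrite vD].
Qed.

End Tube.

(** The periods [tperiod s] are bounded by 2 T + a, so it is enough to control nearby orbits over
    one compact range of times. *)
Lemma periodic_stable y (U : set S) : ~ singular y -> open U -> (forall t, U (v t y)) ->
  \forall z \near y, forall t, U (v t z).
Proof.
move=> ny oU yU; have [l [sg [a [T [e [r [d [d' tub]]]]]]]] := tube_exists ny.
have [a0 csg sg0 inj nb] := tube_box tub; have he := tube_e tub.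
have : \forall s \near (0 : K), forall u, 0 <= u <= 2 * T + a -> U (v u (sg s)).
  apply: (segment_near_forall (Q := fun u s => U (v u (sg s)))) => u hu.
  have c : cts_at (fun p : K * K => v p.1 (sg p.2)) (u, 0) by ctsv.
  apply: (cts_nbhs c); apply: open_nbhs_nbhs; split => //=.
  by rewrite sg0; exact: yU.
move=> /near_normP[e1 e10 H].
have [||m [m0 m1 m2]] := @exists_le2 _ e1 e; [flra | flra |].
have n0 : `|0 : K| < e by rewrite normr0; flra.
have := tube_nbhs tub 0 (proj1 (andP (tube_l01 tub))) n0 m0; rewrite v0 sg0.
apply: filterS => _ [s [t [ls hs ->]]] t'; rewrite subr0 in hs.
have hse : l * e <= s <= e.
  by move: hs; rewrite ltr_norml; case: (tube_l tub) ls => -> ls hs; flra.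
have [P0 P1 P2] := tperiodP tub hse.
rewrite -vD; have [u hu ->] := period_reduce (t' + t) P0 P2.
by apply: H; rewrite ?subr0; flra.
Qed.

(** * Local coordinates on the space of orbits *)

Section OrbitChart.
Variables (y : S) (l : K) (sg : K -> S) (a T e e' : K) (r d d' : K -> K).
Hypothesis tub : tube y l sg a T e r d d'.
Hypothesis e'e : 0 < e' <= e.
Hypothesis ret : forall s s' u : K,
  l * e' <= s <= e' -> l * e' <= s' <= e' -> v u (sg s) = sg s' -> 0 <= u <= tperiod T d d' s ->
  [\/ s' = s /\ u = 0, s' = r s /\ u = T + d s | s' = s /\ u = tperiod T d d' s].

(** Both crossings s and r s are required to be in the window, where [ret] applies. *)
Definition chart_range (s : K) : Prop := [/\ l <= s, `|s| < e' & `|r s| < e'].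

Lemma chart_range_in s : chart_range s -> l * e' <= s <= e' /\ l * e <= s <= e.
Proof.
move=> [ls hs _]; move: hs; rewrite ltr_norml; have h := e'e.
by case: (tube_l tub) ls => -> ls hs; split; flra.
Qed.

Lemma chart_range_r s : chart_range s -> l * e <= r s <= e.
Proof.
move=> rs; have [_ h1] := chart_range_in rs; have [ls hs hr] := rs.
move: hr; rewrite ltr_norml; have h := e'e; have [lr _ _ _ _] := tube_ret tub h1.
by case: (tube_l tub) lr => -> lr hr; flra.
Qed.

Definition chart_dom : set S := [set x | exists s t, chart_range s /\ x = v t (sg s)].

(** An orbit crosses the window at s and r s only, so [Num.max s (r s)] depends on the orbit alone.
    It is s for a trivial return map; for a reversing one it identifies the two halves of the
    section. *)
Lemma chart_range_max s s' : chart_range s -> chart_range s' -> same_orbit (sg s) (sg s') ->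
  Num.max s' (r s') = Num.max s (r s).
Proof.
move=> rs rs' [u E]; have [hs hse] := chart_range_in rs; have [hs' hse'] := chart_range_in rs'.
have [P0 P1 P2] := tperiodP tub hse; have [u' hu' E'] := period_reduce u P0 P2.
rewrite E' in E; have [[-> //]|[-> _]|[-> //]] := ret hs hs' E hu'.
rewrite (tube_involution tub hse (chart_range_r rs)); exact: maxC.
Qed.

Lemma chart_function : exists k : S -> K, forall s t, chart_range s ->
  k (v t (sg s)) = Num.max s (r s).
Proof.
have /choice[k Hk] : forall x, exists k : K, forall s t, chart_range s -> x = v t (sg s) ->
    k = Num.max s (r s).
  move=> x; have [[s [t [rs E]]]|nx] := pselect (chart_dom x); last first.
    by exists 0 => s t rs E; case: nx; exists s, t.
  exists (Num.max s (r s)) => s' t' rs' E'; apply: chart_range_max => //.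
  by exists (- t + t'); rewrite vD -E' E vK.
by exists k => s t rs; exact: (Hk _ s t).
Qed.

Lemma chart_range_near s : chart_range s -> \forall s' \near s, l <= s' -> chart_range s'.
Proof.
move=> [ls hs hr]; have cr : continuous r := tube_r tub.
have H1 : \forall s' \near s, `|s'| < e' by apply: (cts_near_lt (f := fun s : K => `|s|)) => //; cts.
have H2 : \forall s' \near s, `|r s'| < e' by apply: (cts_near_lt (f := fun s : K => `|r s|)) => //; cts.
by apply: filterS2 H1 H2 => s' h1 h2 h3; split.
Qed.

Lemma chart_nbhs s t (Q : K -> Prop) : chart_range s -> (\forall s' \near s, Q s') ->
  nbhs (v t (sg s)) [set x | exists s' t', [/\ chart_range s', Q s' & x = v t' (sg s')]].
Proof.
move=> rs HQ; have [ls hs _] := rs; have h := e'e.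
have : \forall s' \near s, (l <= s' -> chart_range s') /\ Q s'.
  by apply: filterS2 (chart_range_near rs) HQ => s' h1 h2; split.
move=> /near_normP[m m0 Hm].
have hs' : `|s| < e by flra.
have := tube_nbhs tub t ls hs' m0; apply: filterS => x [s' [t' [h1 h2 ->]]].
by have [k1 k2] := Hm _ h2; exists s', t'; split => //; exact: k1.
Qed.

Lemma chart_range0 : chart_range 0.
Proof.
have h := e'e; have [r0 _ _] := tube_r0 tub; have /andP[l0 _] := tube_l01 tub.
by split; rewrite ?r0 ?normr0 //; flra.
Qed.

Lemma chart_min_period s : l = -1 -> (forall s, l * e <= s <= e -> r s = s) ->
  chart_range s -> min_period (sg s) (T + d s).
Proof.
move=> l1 rid rs; have [hs hse] := chart_range_in rs; have [_ h1 h2 h3 h4] := tube_ret tub hse.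
have aT := tube_aT tub; have [a0 _ _ _ _] := tube_box tub.
rewrite !ler_norml in h1 h2; rewrite (rid _ hse) in h3.
split => //; first by flra.
move=> t ht E; have [|||]:= ret hs hs E.
- by rewrite /tperiod; flra.
- by move=> [_ tE]; flra.
- by move=> [_ tE]; flra.
- by move=> [_ tE]; move: tE; rewrite /tperiod; flra.
Qed.

End OrbitChart.

(** The function k is a coordinate on the orbits near y. Either k >= 0, when y is at the edge of a
    one-sided section or its return map reverses the section, or the section is two-sided with
    trivial return map, and the minimal period T + d s is continuous at y. *)
Lemma orbit_chart y : ~ singular y -> exists (W : set S) (k : S -> K) (sg : K -> S),
  [/\ open W, W y /\ k y = 0, (forall t x, W x -> W (v t x)),
      continuous sg /\ (forall x, W x -> cts_at k x) &
      [/\ forall t x, W x -> k (v t x) = k x, forall x, W x -> same_orbit x (sg (k x)) &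
        (forall x, W x -> 0 <= k x) \/
        (forall e, 0 < e -> \forall z \near y, forall T T', min_period y T ->
          min_period z T' -> `|T' - T| < e)]].
Proof.
move=> ny; have [l [sg [a [T [e [r [d [d' tub]]]]]]]] := tube_exists ny.
have [e' e'e ret] := tube_return tub; have [k kE] := chart_function tub e'e ret.
have [a0 csg sg0 inj nb] := tube_box tub.
have r00 := chart_range0 tub e'e; have [r0 d0 _] := tube_r0 tub.
have cr : continuous r := tube_r tub.
exists (chart_dom l sg e' r), k, sg; split.
- rewrite openE => x [s [t [rs ->]]]; rewrite /interior.
  have H : \forall s' \near s, True by exact: filterT.
  have := chart_nbhs tub e'e t rs H; apply: filterS => x' [s' [t' [rs' _ ->]]].
  by exists s', t'.
- split; first by exists 0, 0; rewrite v0 sg0.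
  by rewrite -sg0 -[sg 0]v0 kE // r0 maxxx.
- by move=> t x [s [t' [rs ->]]]; exists s, (t + t'); rewrite vD.
- split => // x [s [t [rs ->]]]; apply/cvgrPdist_lt => eta eta0.
  have c : continuous (fun s => Num.max s (r s)) by move=> s'; cts.
  have /cvgrPdist_lt/(_ eta eta0) := c s.
  move=> /(chart_nbhs tub e'e t rs); apply: filterS => x' [s' [t' [rs' h ->]]].
  by rewrite !kE.
split.
- by move=> t x [s [t' [rs ->]]]; rewrite -vD !kE.
- move=> x [s [t [rs ->]]]; rewrite kE //.
  have [hs hse] := chart_range_in tub e'e rs; have [_ _ _ h _] := tube_ret tub hse.
  apply: (same_orbit_trans (y := sg s)); first by apply: same_orbit_sym; exists t.
  by rewrite /Num.max; case: ifP => _; [exists (T + d s) | exact: same_orbit_refl].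
- have [rid|[l1 decr]] := tube_cases tub; last first.
    left => x [s [t [rs ->]]]; rewrite kE // le_max.
    have [hs hse] := chart_range_in tub e'e rs; have h := e'e.
    have [s0|s0] := leP 0 s; first by [].
    have := decr s 0 (proj1 (andP hse)) s0; rewrite r0 => H.
    by apply/orP; right; apply: ltW; apply: H; flra.
  have [l1|l0] := tube_l tub; last first.
    by left => x [s [t [rs ->]]]; rewrite kE // le_max; case: rs => ls _ _; rewrite -l0 ls.
  right => eta eta0; have cd : continuous d := tube_d tub.
  have : \forall s \near (0 : K), `|d s| < eta.
    by apply: (cts_near_lt (f := fun s => `|d s|)); [cts | rewrite d0 normr0].
  move=> /(chart_nbhs tub e'e 0 r00); rewrite v0 sg0.
  apply: filterS => x [s [t [rs h ->]]] T1 T' hT hT'.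
  have mp := chart_min_period tub e'e ret l1 rid.
  have := mp _ r00; rewrite sg0 d0 addr0 => /(min_period_unique hT) ->.
  have -> : T' = T + d s by apply: (min_period_unique hT'); apply: min_period_flow; exact: mp.
  by rewrite addrC addrA addNr add0r.
Qed.

(** * The distance between orbits *)

Lemma cts_near_eq (T U : topologicalType) (f g : T -> U) (x : T) :
  (\forall y \near x, f y = g y) -> cts_at g x -> cts_at f x.
Proof.
move=> H cg A; rewrite (nbhs_singleton H) => /(cts_nbhs cg) HA.
have : \forall y \near x, A (f y) by apply: filterS2 H HA => y ->.
by [].
Qed.

(** Compactness as an induction principle. If P failed for the whole space, the complements of the
    sets satisfying P would form a proper filter, and a cluster point of it would contradict the
    local hypothesis. *)
Lemma compact_ind (X : topologicalType) (P : set X -> Prop) : compact [set: X] ->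
  P set0 -> (forall A B, P A -> P B -> P (A `|` B)) -> (forall A B, A `<=` B -> P B -> P A) ->
  (forall x : X, exists2 A, nbhs x A & P A) -> P setT.
Proof.
move=> cX P0 PU Psub loc; apply: contrapT => nPT.
pose F : set_system X := [set B | P (~` B)].
have FF : ProperFilter F.
  apply: Build_ProperFilter; first by rewrite /F /= setC0.
  split; rewrite /F /=; first by rewrite setCT.
    by move=> A B hA hB; rewrite /= setCI; exact: PU.
  by move=> A B AB; apply: Psub; exact: subsetC.
have [|p [_ clp]] := cX F FF; first by rewrite /F /= setCT.
have [A Ap PA] := loc p.
by have [|q []] := clp (~` A) A _ Ap; first by rewrite /F /= setCK.
Qed.

Lemma closed_square_compact (z : K * K) (r : K) : compact [set q : K * K | `|q - z| <= r].
Proof.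
have -> : [set q : K * K | `|q - z| <= r] =
    `[z.1 - r, z.1 + r]%classic `*` `[z.2 - r, z.2 + r]%classic.
  rewrite predeqE => -[a b]; rewrite /= pair_norm_le /= !in_itv /= !ler_norml.
  by split=> [/andP[h1 h2]|[h1 h2]]; [split | apply/andP; split]; lra.
by apply: compact_setX; exact: segment_compact.
Qed.

(** A tent function of the chart, extended by 0. It is continuous outside U because its support lies
    in the image under g of the closed square of radius r / 2, a compact set that does not meet the
    complement of U. *)
Lemma chart_bump (U : set S) f g (z0 : K * K) (r : K) : chart U f g z0 r ->
  exists b : S -> K, [/\ continuous b, continuous (fun z => b z *: f z),
    forall z, 0 <= b z, forall z, b z != 0 -> U z & forall z, U z -> f z = z0 -> 0 < b z].
Proof.
move=> [oU cf Ug r0 gr].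
pose b z : K := if pselect (U z) then Num.max 0 (r / 2 - `|f z - z0|) else 0.
have bU z : U z -> b z = Num.max 0 (r / 2 - `|f z - z0|) by rewrite /b; case: pselect.
have bN z : ~ U z -> b z = 0 by rewrite /b; case: pselect.
have nearU z : U z -> \forall w \near z, b w = Num.max 0 (r / 2 - `|f w - z0|).
  by move=> Uz; have : \forall w \near z, U w by [exact: open_nbhs_nbhs]; apply: filterS => w /bU.
have nearN z : ~ U z -> \forall w \near z, b w = 0.
  move=> nU; have : \forall w \near z, forall q, `|q - z0| <= r / 2 -> g q <> w.
    apply: (@compact_near_forall _ _ [set q | `|q - z0| <= r / 2] z (fun q w => g q <> w)).
      exact: closed_square_compact.
    move=> q /= hq; have [|cg Uq _] := gr q; first by lra.
    apply: (@cts_near_neq _ _ (fun p : (K * K) * S => g p.1) snd) => //=.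
    - by apply: (cts_comp (f := fst) (g := g)) => //; cts.
    - by cts.
    - by move=> E; apply: nU; rewrite -E.
  apply: filterS => w Hw; have [Uw|/bN //] := pselect (U w).
  rewrite bU //; apply/max_idPl; have [_ gE] := Ug w Uw.
  by case: (leP `|f w - z0| (r / 2)) => h; [case: (Hw (f w)) | lra].
have cb z : cts_at b z.
  have [Uz|nU] := pselect (U z); last by apply: cts_near_eq (nearN z nU) _; cts.
  by apply: cts_near_eq (nearU z Uz) _; have := cf z Uz => cfz; cts.
exists b; split.
- by move=> z; apply: cts_at_continuous.
- move=> z; apply: cts_at_continuous; have [Uz|nU] := pselect (U z).
    by have := cf z Uz => cfz; cts.
  apply: (@cts_near_eq _ _ _ (fun=> (0 : K * K))); last by cts.
  by apply: filterS (nearN z nU) => w ->; rewrite scale0r.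
- by move=> z; rewrite /b; case: pselect => //= _; rewrite le_max lexx.
- by move=> z; rewrite /b; case: pselect => //=; rewrite eqxx.
- by move=> z Uz fz; rewrite bU // fz subrr normr0 subr0 lt_max divr_gt0 ?orbT.
Qed.

(** For each chart, the maps b and b f give a pseudo-metric that separates the points where b > 0
    from all others; finitely many are added up by [compact_ind]. *)
Lemma exists_metric : exists dl : S -> S -> K,
  [/\ pseudo_dist dl, forall x y, dl x y = 0 -> x = y, forall x y, dl x y <= 1 &
      continuous (fun p : S * S => dl p.1 p.2)].
Proof.
pose P (A : set S) := exists dl : S -> S -> K, [/\ pseudo_dist dl,
  continuous (fun p : S * S => dl p.1 p.2) & forall x y, A x -> dl x y = 0 -> x = y].
have [dl [hd cd sep]] : P setT.
  apply: compact_ind => //.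
  - exists (fun _ _ : S => (0 : K)); split.
    + by split=> [p|p p'|p p' p'']; rewrite ?addr0.
    + exact: cst_continuous.
    + by [].
  - move=> A B [d1 [[h1 h2 h3] c1 s1]] [d2 [[k1 k2 k3] c2 s2]].
    have q1 x y : 0 <= d1 x y := dist_ge0 (And3 h1 h2 h3) x y.
    have q2 x y : 0 <= d2 x y := dist_ge0 (And3 k1 k2 k3) x y.
    exists (fun x y => d1 x y + d2 x y); split.
    + split=> [x|x y|x y z]; first by rewrite h1 k1 addr0.
        by rewrite h2 k2.
      by have := h3 x y z; have := k3 x y z; lra.
    + by move=> p; cts.
    + move=> x y [Ax|Bx] E; have := q1 x y; have := q2 x y.
        by move=> e1 e2; apply: s1 => //; lra.
      by move=> e1 e2; apply: s2 => //; lra.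
  - by move=> A B AB [d [h1 h2 h3]]; exists d; split => // x y /AB; exact: h3.
  - move=> x; have [U [f [g [r [ch Ux]]]]] := has_chart x.
    have [b [cb cbf b0 bU bx]] := chart_bump ch; have [oU cf Ug _ _] := ch.
    exists [set z | 0 < b z].
      by apply: (cts_near_gt0 (f := b)); [exact: cb | exact: bx].
    have [F FE cF] : exists2 F : S -> K * K, (forall z, F z = b z *: f z) & continuous F.
      by exists (fun z => b z *: f z).
    exists (fun z w => `|b z - b w| + `|F z - F w|); split.
    + split=> [z|z w|z w u]; first by rewrite !subrr !normr0 addr0.
        by rewrite (distrC (b z)) (distrC (F z)).
      by have := ler_distD (b w) (b z) (b u); have := ler_distD (F w) (F z) (F u); lra.
    + by move=> p; cts.
    + move=> z w /= bz E.
      have /eqP : `|b z - b w| = 0.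
        by have := normr_ge0 (b z - b w); have := normr_ge0 (F z - F w); lra.
      rewrite normr_eq0 subr_eq0 => /eqP bE.
      have /eqP : `|F z - F w| = 0.
        by have := normr_ge0 (b z - b w); have := normr_ge0 (F z - F w); lra.
      rewrite normr_eq0 subr_eq0 !FE -bE => /eqP /(scalerI (lt0r_neq0 bz)) fE.
      have Uz : U z by apply: bU; rewrite gt_eqF.
      have Uw : U w by apply: bU; rewrite -bE gt_eqF.
      by have [_ <-] := Ug z Uz; have [_ <-] := Ug w Uw; rewrite fE.
have [h1 h2 h3] := hd; have d0 x y := dist_ge0 hd x y.
(* Truncation at 1 bounds the supremum in [orbit_dist]. *)
exists (fun x y => Num.min 1 (dl x y)); split.
- split=> [x|x y|x y z]; first by rewrite h1; apply/min_idPr.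
    by rewrite h2.
  have := h3 x y z; have := d0 x y; have := d0 y z; rewrite ge_min => e1 e2 e3.
  by rewrite /Num.min; do 2 case: ifPn; rewrite -?leNgt => e4 e5; apply/orP; (left; lra) || (right; lra).
- move=> x y; rewrite /Num.min; case: ifPn => [_ E|_]; last exact: sep.
  by have := @ltr01 K; rewrite E ltxx.
- by move=> x y; rewrite ge_min lexx.
- by move=> p; cts; exact: cd.
Qed.

Section OrbitDist.
Variable dl : S -> S -> K.
Hypothesis hdl : pseudo_dist dl.
Hypothesis dl_eq0 : forall x y, dl x y = 0 -> x = y.
Hypothesis dl_le1 : forall x y, dl x y <= 1.
Hypothesis dl_cont : continuous (fun p : S * S => dl p.1 p.2).

Lemma dlxx x : dl x x = 0. Proof. by have [] := hdl. Qed.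
Lemma dlC x y : dl x y = dl y x. Proof. by have [] := hdl. Qed.
Lemma dl_tri x y z : dl x z <= dl x y + dl y z. Proof. by have [] := hdl. Qed.

Lemma cts_dl (T : topologicalType) (f g : T -> S) (x : T) :
  cts_at f x -> cts_at g x -> cts_at (fun w => dl (f w) (g w)) x.
Proof.
move=> cf cg; apply: (cts_comp (f := fun w => (f w, g w)) (g := fun p : S * S => dl p.1 p.2)).
  exact: cts_pair.
exact: dl_cont.
Qed.

Definition orbit_gap z x : K := inf [set dl z (v t x) | t in [set: K]].

Lemma orbit_gap_le z x t : orbit_gap z x <= dl z (v t x).
Proof.
apply: ge_inf; last by exists t.
by exists 0 => _ [u _ <-]; exact: dist_ge0.
Qed.

Lemma orbit_gap_ge z x (c : K) : (forall t, c <= dl z (v t x)) -> c <= orbit_gap z x.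
Proof.
move=> H; apply: lb_le_inf; first by exists (dl z (v 0 x)); exists 0.
by move=> _ [u _ <-].
Qed.

Lemma orbit_gap_flow z x t : orbit_gap z (v t x) = orbit_gap z x.
Proof.
apply/eqP; rewrite eq_le; apply/andP; split; apply: orbit_gap_ge => u.
  by rewrite -(subrK t u) vD; exact: orbit_gap_le.
by rewrite -vD; exact: orbit_gap_le.
Qed.

Lemma orbit_gap01 z x : 0 <= orbit_gap z x <= 1.
Proof.
apply/andP; split; first by apply: orbit_gap_ge => t; exact: dist_ge0.
exact: le_trans (orbit_gap_le z x 0) (dl_le1 _ _).
Qed.

(** The Hausdorff distance between the orbits, written as the uniform distance between their
    distance functions; in this form the triangle inequality is immediate. *)
Definition orbit_dist x y : K := sup [set `|orbit_gap z x - orbit_gap z y| | z in [set: S]].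

Lemma orbit_dist_ge z x y : `|orbit_gap z x - orbit_gap z y| <= orbit_dist x y.
Proof.
apply: ub_le_sup; last by exists z.
exists 1 => _ [w _ <-]; have := orbit_gap01 w x; have := orbit_gap01 w y.
by rewrite ler_norml; flra.
Qed.

Lemma orbit_dist_le x y (c : K) : (forall z, `|orbit_gap z x - orbit_gap z y| <= c) ->
  orbit_dist x y <= c.
Proof.
move=> H; apply: ge_sup; first by exists `|orbit_gap x x - orbit_gap x y|; exists x.
by move=> _ [z _ <-].
Qed.

Lemma orbit_dist_pseudo : pseudo_dist orbit_dist.
Proof.
have C x y : orbit_dist x y <= orbit_dist y x.
  by apply: orbit_dist_le => z; rewrite distrC; exact: orbit_dist_ge.
split=> [x|x y|x y z].
- apply/eqP; rewrite eq_le; apply/andP; split.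
    by apply: orbit_dist_le => z; rewrite subrr normr0.
  by apply: le_trans (orbit_dist_ge x x x).
- by apply/eqP; rewrite eq_le !C.
- apply: orbit_dist_le => w; apply: le_trans (ler_distD (orbit_gap w y) _ _) _.
  by apply: lerD; exact: orbit_dist_ge.
Qed.

Lemma closed_period x : exists2 T : K, 0 < T & v T x = x.
Proof. by have [sx|//] := all_closed x; exists 1. Qed.

(** At distance 0, x has gap 0 to the orbit of y; as that orbit is closed, one period suffices to
    compute the gap and the minimum is attained. *)
Lemma orbit_dist_eq0 x y : orbit_dist x y = 0 <-> same_orbit x y.
Proof.
split=> [E|[t <-]]; last first.
  apply/eqP; rewrite eq_le; apply/andP; split; last exact: dist_ge0 orbit_dist_pseudo _ _.
  by apply: orbit_dist_le => z; rewrite orbit_gap_flow subrr normr0.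
have gx : orbit_gap x x = 0.
  have := orbit_gap_le x x 0; rewrite v0 dlxx; have := orbit_gap01 x x; flra.
have gy : orbit_gap x y = 0.
  have := orbit_dist_ge x x y; rewrite E gx sub0r normrN; have := orbit_gap01 x y.
  by move=> /andP[h _]; rewrite ger0_norm // => h'; apply/eqP; rewrite eq_le h h'.
have [T T0 vT] := closed_period y; apply: same_orbit_sym.
have [||t tT Ht] := @EVT_min _ (fun t => dl x (v t y)) 0 T; first exact: ltW.
  by apply: continuous_subspaceT => t; apply: cts_at_continuous; apply: cts_dl; ctsv.
exists t; apply/esym/dl_eq0/eqP; rewrite eq_le; apply/andP; split; last exact: dist_ge0.
rewrite -gy; apply: orbit_gap_ge => u; have [u' hu' ->] := period_reduce u T0 vT.
by apply: Ht; rewrite in_itv.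
Qed.

(** Two halves: the orbit of x stays near that of y by continuity over one period of x, and the
    orbit of y stays near that of x by stability. *)
Lemma orbit_dist_near x (e : K) : 0 < e -> \forall y \near x, orbit_dist x y < e.
Proof.
move=> e0; have e2 : 0 < e / 2 by flra.
have [T T0 vT] := closed_period x.
have HA : \forall y \near x, forall t, exists t', dl (v t x) (v t' y) < e / 2.
  have : \forall y \near x, forall t, 0 <= t <= T -> dl (v t x) (v t y) < e / 2.
    apply: (segment_near_forall (Q := fun t y => dl (v t x) (v t y) < e / 2)) => t _.
    apply: (cts_near_lt (f := fun p : K * S => dl (v p.1 x) (v p.1 p.2))).
      by apply: cts_dl; ctsv.
    by rewrite /= dlxx.
  apply: filterS => y H t; have [u hu ->] := period_reduce t T0 vT.
  by exists u; exact: H.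
have HB : \forall y \near x, forall t', exists t, dl (v t x) (v t' y) < e / 2.
  apply: (@stable x [set w | exists t, dl (v t x) w < e / 2]); last first.
    by move=> t; exists t; rewrite dlxx.
  rewrite openE => w [t h]; rewrite /interior.
  have : \forall w' \near w, dl (v t x) w' < e / 2.
    by apply: (cts_near_lt (f := fun w' => dl (v t x) w')); [apply: cts_dl; cts | exact: h].
  by apply: filterS => w' h'; exists t.
apply: filterS2 HA HB => y hA hB.
suff : orbit_dist x y <= e / 2 by flra.
apply: orbit_dist_le => z; rewrite ler_norml; apply/andP; split.
  suff : orbit_gap z y - e / 2 <= orbit_gap z x by flra.
  apply: orbit_gap_ge => t; have [t' h] := hA t.
  by have := orbit_gap_le z y t'; have := dl_tri z (v t x) (v t' y); flra.
suff : orbit_gap z x - e / 2 <= orbit_gap z y by flra.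
apply: orbit_gap_ge => t'; have [t h] := hB t'.
have := orbit_gap_le z x t; have := dl_tri z (v t' y) (v t x).
by rewrite (dlC (v t' y)); flra.
Qed.

Lemma dl_ball x (W : set S) : nbhs x W -> exists2 e : K, 0 < e & forall w, dl x w < e -> W w.
Proof.
move=> Wx.
have : \forall h \near (0 : K), forall w, [set: S] w -> dl x w < h -> W w.
  apply: (compact_near_forall (Q := fun w h => dl x w < h -> W w)) => // w _.
  have [->|xw] := pselect (w = x).
    have c : cts_at (fun p : S * K => p.1) (x, 0 : K) by cts.
    by have := cts_nbhs c Wx; apply: filterS => p.
  have d0 : 0 < dl x w.
    rewrite lt_neqAle dist_ge0 // andbT; apply/eqP => E; apply: xw; apply/esym; exact: dl_eq0.
  have : \forall p \near (w, 0 : K), p.2 - dl x p.1 < 0.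
    apply: (cts_near_lt (f := fun p : S * K => p.2 - dl x p.1)); last by rewrite /=; flra.
    have c : cts_at (fun p : S * K => dl x p.1) (w, 0) by apply: cts_dl; cts.
    by cts.
  by apply: filterS => p; rewrite subr_lt0 => h h'; have := lt_trans h h'; rewrite ltxx.
move=> /near_normP[e e0 H]; exists (e / 2); first by flra.
by move=> w; apply: H => //; rewrite subr0 gtr0_norm; flra.
Qed.

(** The gap from x to its own orbit is 0, so a small [orbit_dist x y] places some point of the orbit
    of y close to x. *)
Lemma orbit_dist_ball x (W : set S) : nbhs x W -> (forall t y, W y -> W (v t y)) ->
  exists2 e : K, 0 < e & forall y, orbit_dist x y < e -> W y.
Proof.
move=> /dl_ball[e e0 He] Wv; exists e => // y h.
have [t ht] : exists t, dl x (v t y) < e.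
  apply: contrapT => n.
  have : e <= orbit_gap x y.
    by apply: orbit_gap_ge => t; rewrite leNgt; apply/negP => h'; apply: n; exists t.
  have := orbit_gap_le x x 0; rewrite v0 dlxx; have := orbit_dist_ge x x y.
  by rewrite ler_norml; flra.
by rewrite -(vK t y); apply: Wv; exact: He.
Qed.

Lemma orbit_dist_stable x (W : set S) : open W -> (forall t, W (v t x)) ->
  exists2 e : K, 0 < e & forall y, orbit_dist x y < e -> forall t, W (v t y).
Proof.
move=> oW Wx; have [|e e0 H] := orbit_dist_ball (stable oW Wx).
  by move=> t y Wy t'; rewrite -vD.
by exists e.
Qed.

End OrbitDist.

(** The interface of D: from here on only these five properties are used, and the underlying metric
    is forgotten. *)
Lemma exists_orbit_dist : exists D : S -> S -> K,
  [/\ pseudo_dist D, forall x y, D x y = 0 <-> same_orbit x y,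
      forall x (e : K), 0 < e -> \forall y \near x, D x y < e,
      forall x (W : set S), nbhs x W -> (forall t y, W y -> W (v t y)) ->
        exists2 e : K, 0 < e & forall y, D x y < e -> W y &
      forall x (W : set S), open W -> (forall t, W (v t x)) ->
        exists2 e : K, 0 < e & forall y, D x y < e -> forall t, W (v t y)].
Proof.
have [dl [h1 h2 h3 h4]] := exists_metric; exists (orbit_dist dl); split.
- exact: orbit_dist_pseudo.
- exact: orbit_dist_eq0.
- exact: orbit_dist_near.
- exact: orbit_dist_ball.
- exact: orbit_dist_stable.
Qed.

(** * Arcs of orbits *)

Definition flow_invariant (W : set S) : Prop := forall t y, W y -> W (v t y).

Section Arc.
Variable D : S -> S -> K.
Hypothesis D_ball : forall x (W : set S), nbhs x W -> flow_invariant W ->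
  exists2 e : K, 0 < e & forall y, D x y < e -> W y.
Variable al : K -> S.
Hypothesis al_cts : dist_cts D al.

(** Since [al] is continuous only for D, it may jump along orbits, and neighbourhoods can be tested
    only if they are invariant. *)
Lemma arc_near (u : K) (W : set S) : nbhs (al u) W -> flow_invariant W -> \forall w \near u, W (al w).
Proof.
by move=> Wu Wv; have [e e0 H] := D_ball Wu Wv; apply: filterS (al_cts u e0) => w /H.
Qed.

Lemma arc_chart_cts (u : K) (W : set S) (k : S -> K) : open W -> flow_invariant W ->
  (forall x, W x -> cts_at k x) -> (forall t x, W x -> k (v t x) = k x) -> W (al u) ->
  cts_at (fun w => k (al w)) u.
Proof.
move=> oW Wv ck kv Wu; apply/cvgrPdist_lt => e e0.
have H : \forall w \near u, (W `&` [set x | `|k (al u) - k x| < e]) (al w).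
  apply: arc_near; last by move=> t x [Wx h]; split; [exact: Wv | rewrite /= kv].
  apply: filterI; first exact: open_nbhs_nbhs.
  by have /cvgrPdist_lt/(_ e e0) := ck _ Wu.
by apply: filterS H => w [].
Qed.

Lemma arc_coordinate_cts (u h : K) (W : set S) (k : S -> K) : open W -> flow_invariant W ->
  (forall x, W x -> cts_at k x) -> (forall t x, W x -> k (v t x) = k x) -> 0 <= h ->
  (forall w, `|w - u| <= h -> W (al w)) -> continuous (fun w => k (al (clamp (u - h) (u + h) w))).
Proof.
move=> oW Wv ck kv h0 HW w; apply: cts_at_continuous.
apply: (cts_comp (f := clamp (u - h) (u + h)) (g := fun w => k (al w))); first by cts.
apply: (arc_chart_cts oW Wv ck kv); apply: HW.
have : u - h <= clamp (u - h) (u + h) w <= u + h by apply: clamp_in; flra.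
by rewrite ler_norml; flra.
Qed.

Lemma arc_section_local (u : K) : ~ singular (al u) ->
  exists h (tau : K -> S), [/\ 0 < h, continuous tau & forall w, `|w - u| < h -> same_orbit (al w) (tau w)].
Proof.
move=> nu; have [W [k [sg [oW [Wu _] Wv [csg ck] [kv ks _]]]]] := orbit_chart nu.
have /near_normP[h h0 Hh] := arc_near (open_nbhs_nbhs (conj oW Wu)) Wv.
have h20 : 0 <= h / 2 by flra.
have ck' := @arc_coordinate_cts u (h / 2) W k oW Wv ck kv h20.
exists (h / 2), (fun w => sg (k (al (clamp (u - h / 2) (u + h / 2) w)))); split; first by flra.
  move=> w; apply: cts_at_continuous; apply: (cts_comp (g := sg)); last exact: csg.
  by apply: ck' => w' hw; apply: Hh; flra.
move=> w hw; rewrite clampE; first by apply: ks; apply: Hh; flra.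
by move: hw; rewrite ltr_norml; flra.
Qed.

Section Section01.
Hypothesis al_ns : forall u : K, 0 <= u < 1 -> ~ singular (al u).

(** A section known up to p and a local section around p pass through the same orbit at p; a
    constant shift c in time makes them agree there, and they are glued. The part before a is left
    untouched, so that extensions can be iterated. *)
Lemma arc_section_extend (a b : K) (tau : K -> S) : 0 <= a <= b -> b < 1 -> continuous tau ->
  (forall w, 0 <= w <= a -> same_orbit (al w) (tau w)) ->
  exists tau' : K -> S, [/\ continuous tau', forall w, w <= a -> tau' w = tau w &
    forall w, 0 <= w <= b -> same_orbit (al w) (tau' w)].
Proof.
move=> ab b1 ctau Htau.
pose P (c : K) := exists tau' : K -> S, [/\ continuous tau', forall w, w <= a -> tau' w = tau w &
    forall w, 0 <= w <= c -> same_orbit (al w) (tau' w)].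
apply: (@segment_locally_constant _ a b P _ a); [|flra|flra|by exists tau].
move=> x hx; have [|h [ta [h0 cta Hta]]] := @arc_section_local x; first by apply: al_ns; flra.
have key (p q : K) : `|p - x| < h -> `|q - x| < h -> a <= p -> P p -> P q.
  rewrite !ltr_norml => hp hq ap [t1 [ct1 t1a Ht1]].
  have [c Ec] : same_orbit (ta p) (t1 p).
    apply: (same_orbit_trans (same_orbit_sym (Hta p _)) (Ht1 p _)); first by rewrite ltr_norml.
    by flra.
  exists (fun w => if w <= p then t1 w else v c (ta w)); split.
  - by apply: cts_glue => //; move=> w; ctsv.
  - by move=> w wa; rewrite (le_trans wa ap); exact: t1a.
  - move=> w hw; case: leP => wp; first by apply: Ht1; flra.
    apply: (same_orbit_trans (Hta w _)); first by rewrite ltr_norml; flra.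
    by exists c.
apply/near_normP; exists h => // y hy aby.
by split; apply: key => //; rewrite ?subrr ?normr0 //; flra.
Qed.

(** Sections over [0, 1 - 1/(n + 1)] are extended one after the other; each extends the previous
    one, so on every smaller interval the sequence is eventually constant. *)
Lemma arc_section : exists tau : K -> S, forall u, 0 <= u < 1 -> cts_at tau u /\ same_orbit (al u) (tau u).
Proof.
pose b (n : nat) : K := 1 - n.+1%:R^-1.
have b01 n : 0 <= b n < 1.
  have h1 : 0 < n.+1%:R^-1 :> K by rewrite invr_gt0 ltr0n.
  have h2 : n.+1%:R^-1 <= 1 :> K by rewrite invf_le1 ?ltr0n // ler1n.
  by apply/andP; rewrite /b; split; [rewrite subr_ge0 | rewrite gtrBl].
have bS m n : (m <= n)%N -> b m <= b n.
  by move=> mn; rewrite /b lerD2l lerN2 lef_pV2 ?posrE ?ltr0n // ler_nat.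
have bw (w : K) : exists N : nat, w < 1 -> w < b N.
  have [w1|] := ltP w 1; last by exists 0%N; rewrite ltNge => /negP.
  have i0 : 0 <= (1 - w)^-1 by rewrite invr_ge0; flra.
  exists (Num.trunc (1 - w)^-1) => _; have /andP[_ h] := truncn_itv i0.
  suff : (Num.trunc (1 - w)^-1).+1%:R^-1 < 1 - w by rewrite /b ltrBrDr addrC -ltrBrDr.
  by rewrite -[X in _ < X]invrK ltf_pV2 ?posrE ?ltr0n // invr_gt0; flra.
pose R n (tau : K -> S) := continuous tau /\ forall w, 0 <= w <= b n -> same_orbit (al w) (tau w).
have /choice[st Hst] : forall p : nat * (K -> S), exists tau' : K -> S, R p.1 p.2 ->
    R p.1.+1 tau' /\ forall w, w <= b p.1 -> tau' w = p.2 w.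
  move=> [n tau] /=; have [[ct Ht]|nR] := pselect (R n tau); last by exists tau.
  have [||t' [h1 h2 h3]] := @arc_section_extend (b n) (b n.+1) tau _ _ ct Ht.
  - by have := b01 n; have := bS n n.+1 (leqnSn n); flra.
  - by have := b01 n.+1; flra.
  by exists t' => _.
pose f := fix f n := if n is m.+1 then st (m, f m) else (fun=> al 0).
have Rf n : R n (f n).
  elim: n => [|n IH]; last by have [] := Hst (n, f n) IH.
  split; first by move=> w; exact: cst_continuous.
  move=> w; rewrite /b invr1 subrr => hw; have -> : w = 0 by flra.
  exact: same_orbit_refl.
have fE m n (w : K) : (m <= n)%N -> w <= b m -> f n w = f m w.
  elim: n => [|n IH]; first by rewrite leqn0 => /eqP ->.
  rewrite leq_eqVlt => /predU1P[-> //|]; rewrite ltnS => mn wm.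
  have [_ H] := Hst (n, f n) (Rf n); rewrite -(IH mn wm); apply: H => /=.
  exact: le_trans wm (bS _ _ mn).
have /choice[N HN] := bw; exists (fun w => f (N w) w) => u u01.
have uN : u < b (N u) by apply: HN; flra.
split; last by have [_ H] := Rf (N u); apply: H; flra.
have bn : b (N u) < 1 by have := b01 (N u); flra.
have : \forall w \near u, w < b (N u) by apply: (cts_near_lt (f := id)) => //; cts.
move=> H; apply: (@cts_near_eq _ _ _ (f (N u))); last by have [h _] := Rf (N u); exact: h.
apply: filterS H => w wN; have wN' : w < b (N w) by apply: HN; flra.
by case: (leqP (N w) (N u)) => h; [rewrite (fE _ _ _ h) // ltW | rewrite (fE _ _ _ (ltnW h)) // ltW].
Qed.

End Section01.

Hypothesis al_inj : forall u w : K, 0 <= u <= 1 -> 0 <= w <= 1 -> same_orbit (al u) (al w) -> u = w.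

(** Along an arc of distinct orbits the coordinate k is injective, hence strictly monotone, and so
    takes both signs around an inner point where it vanishes. *)
Lemma arc_cross (u : K) (W : set S) (k : S -> K) (sg : K -> S) : 0 < u < 1 -> open W -> flow_invariant W ->
  (forall x, W x -> cts_at k x) -> (forall t x, W x -> k (v t x) = k x) ->
  (forall x, W x -> same_orbit x (sg (k x))) -> W (al u) -> k (al u) = 0 ->
  exists w1 w2 : K, [/\ W (al w1), k (al w1) < 0, 0 < k (al w2) &
    forall c, k (al w1) <= c <= k (al w2) -> exists w, [/\ 0 < w < 1, W (al w) & k (al w) = c]].
Proof.
move=> u01 oW Wv ck kv ks Wu ku.
have /near_normP[h0 h00 Hh0] := arc_near (open_nbhs_nbhs (conj oW Wu)) Wv.
have [|||h [h_gt0 hh hu h1]] := @exists_le3 _ (h0 / 2) (u / 2) ((1 - u) / 2); [flra|flra|flra|].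
have HW w : `|w - u| <= h -> W (al w) by move=> hw; apply: Hh0; flra.
have ckap := arc_coordinate_cts oW Wv ck kv (ltW h_gt0) HW.
set kap := (fun w => _) in ckap.
have kapE w : u - h <= w <= u + h -> kap w = k (al w) by move=> hw; rewrite /kap clampE.
have HW' w : u - h <= w <= u + h -> W (al w) by move=> hw; apply: HW; rewrite ler_norml; flra.
have inj : {in `[u - h, u + h] &, injective kap}.
  move=> w w'; rewrite !in_itv /= => hw hw'; rewrite !kapE // => E.
  apply: al_inj; [flra | flra |].
  by apply: (same_orbit_trans (ks _ (HW' _ hw))); rewrite E; apply: same_orbit_sym; exact: ks _ (HW' _ hw').
have iv c w w' : u - h <= w -> w <= w' -> w' <= u + h ->
    Num.min (kap w) (kap w') <= c <= Num.max (kap w) (kap w') ->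
    exists w, [/\ 0 < w < 1, W (al w) & k (al w) = c].
  move=> p1 p2 p3 hc; have [|x] := @IVT _ kap w w' c p2 _ hc.
    exact: continuous_subspaceT.
  rewrite in_itv /= => hx E; exists x; rewrite -kapE; last by flra.
  by split; [flra | apply: HW'; flra | exact: E].
have uu : u - h <= u <= u + h by flra.
have ul : u - h <= u - h <= u + h by flra.
have ur : u - h <= u + h <= u + h by flra.
have kapu : kap u = 0 by rewrite kapE.
have [mono|mono] := itv_continuous_inj_mono (continuous_subspaceT ckap) inj.
  have m1 : kap (u - h) < kap u by apply: mono; rewrite ?in_itv //; flra.
  have m2 : kap u < kap (u + h) by apply: mono; rewrite ?in_itv //; flra.
  rewrite kapu in m1 m2; exists (u - h), (u + h); rewrite -!kapE //; split => //; first exact: HW'.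
  move=> c hc; apply: (iv c (u - h) (u + h)); [flra | flra | flra |].
  by rewrite min_l ?max_r //; apply: ltW; apply: lt_trans m1 m2.
have m1 : kap u < kap (u - h) by apply: mono; rewrite ?in_itv //; flra.
have m2 : kap (u + h) < kap u by apply: mono; rewrite ?in_itv //; flra.
rewrite kapu in m1 m2; exists (u + h), (u - h); rewrite -!kapE //; split => //; first exact: HW'.
move=> c hc; apply: (iv c (u - h) (u + h)); [flra | flra | flra |].
by rewrite min_r ?max_l //; apply: ltW; apply: lt_trans m2 m1.
Qed.

(** The alternative k >= 0 of [orbit_chart] is incompatible with [arc_cross]; the other one gives
    continuity of the periods. *)
Lemma arc_annular (u e : K) : 0 < u < 1 -> ~ singular (al u) -> 0 < e ->
  \forall z \near al u, forall T T' : K, min_period (al u) T -> min_period z T' -> `|T' - T| < e.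
Proof.
move=> u01 nu; have [W [k [sg [oW [Wu ku] Wv [csg ck] [kv ks [k0|H]]]]]] := orbit_chart nu.
  have [w1 [w2 [Ww1 h _ _]]] := arc_cross u01 oW Wv ck kv ks Wu ku.
  by have := k0 _ Ww1; rewrite leNgt h.
exact: H.
Qed.

Lemma arc_open (u : K) : 0 < u < 1 -> ~ singular (al u) ->
  \forall z \near al u, exists2 w : K, 0 < w < 1 & same_orbit z (al w).
Proof.
move=> u01 nu; have [W [k [sg [oW [Wu ku] Wv [csg ck] [kv ks _]]]]] := orbit_chart nu.
have [w1 [w2 [Ww1 h1 h2 H]]] := arc_cross u01 oW Wv ck kv ks Wu ku.
have H1 : \forall z \near al u, k z < k (al w2).
  by apply: (cts_near_lt (f := k)); [exact: ck | rewrite ku].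
have H2 : \forall z \near al u, 0 < k z - k (al w1).
  apply: (cts_near_gt0 (f := fun z => k z - k (al w1))); last by rewrite ku; flra.
  by have := ck _ Wu => c; cts.
have H3 : \forall z \near al u, W z by exact: open_nbhs_nbhs.
apply: filterS3 H1 H2 H3 => z z1 z2 Wz; have [|w [w01 Ww wE]] := H (k z); first by flra.
exists w => //; apply: (same_orbit_trans (ks _ Wz)); rewrite -wE; apply: same_orbit_sym; exact: ks.
Qed.

End Arc.

Lemma min_period_ns z (T : K) : min_period z T -> ~ singular z.
Proof. by move=> [T0 vT H] sz; apply: (H (T / 2)); [flra | exact: sz]. Qed.

(** Along a section over the arc the minimal periods are continuous by [arc_annular], and near the
    end whole orbits shrink to the singular point by stability. *)
Lemma arc_end (D : S -> S -> K) (al : K -> S) :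
  (forall x (W : set S), nbhs x W -> flow_invariant W ->
     exists2 e : K, 0 < e & forall y, D x y < e -> W y) ->
  (forall x (W : set S), open W -> (forall t, W (v t x)) ->
     exists2 e : K, 0 < e & forall y, D x y < e -> forall t, W (v t y)) ->
  dist_cts D al ->
  (forall u w : K, 0 <= u <= 1 -> 0 <= w <= 1 -> same_orbit (al u) (al w) -> u = w) ->
  (forall u : K, 0 < u < 1 -> ~ singular (al u)) -> singular (al 1) ->
  exists (tau : K -> S) (Tm : K -> K),
  [/\ forall u, 0 < u < 1 -> [/\ cts_at tau u, cts_at Tm u & min_period (tau u) (Tm u)],
      forall u w, 0 < u < 1 -> 0 < w < 1 -> same_orbit (tau u) (tau w) -> u = w,
      forall W : set S, open W -> W (al 1) -> \forall u \near (1 : K), u < 1 -> forall t, W (v t (tau u)) &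
      forall u, 0 < u < 1 -> exists2 w : K, 0 < w < 1 & same_orbit (tau u) (al w)].
Proof.
move=> Dball Dst cal inj ns sx.
(* Only the second half of the arc is kept: its start is nonsingular, whereas al 0 may be
   singular. *)
pose h (u : K) : K := (1 + u) / 2.
have hin u : 0 <= u < 1 -> 0 < h u < 1 by rewrite /h => hu; apply/andP; split; flra.
have ch (u : K) : cts_at h u by rewrite /h; cts.
have cal' : dist_cts D (fun u => al (h u)).
  by move=> u e e0; have := cal (h u) e e0 => H; exact: (cts_nbhs (ch u) H).
have ns' u : 0 <= u < 1 -> ~ singular (al (h u)) by move=> /hin; exact: ns.
have [tau Htau] := arc_section Dball cal' ns'.
have /choice[Tm HTm] : forall u : K, exists T : K, 0 <= u < 1 -> min_period (tau u) T.
  move=> u; have [u01|n] := pselect (0 <= u < 1); last by exists 0.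
  have [_ [t Et]] := Htau u u01; have [T HT] := exists_min_period (ns' u u01).
  by exists T => _; rewrite -Et; apply: min_period_flow; case: HT.
have W01 (u : K) : 0 < u < 1 -> 0 <= u < 1 by flra.
exists tau, Tm; split.
- move=> u /[dup] u01' /W01 u01; have [ct [t Et]] := Htau u u01; split => //; last exact: HTm.
  apply/cvgrPdist_lt => e e0.
  have := arc_annular Dball cal inj (hin u u01) (ns' u u01) e0.
  rewrite -{1}(vK t (al (h u))) Et => /near_flow /(cts_nbhs ct) H.
  have u1 : \forall w \near u, w < 1 by apply: (cts_near_lt (f := id)); [cts | flra].
  have u0 : \forall w \near u, 0 < w by apply: (cts_near_gt0 (f := id)); [cts | flra].
  apply: filterS3 H u1 u0 => w H w1 w0; rewrite distrC; apply: H.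
    by rewrite -(vK t (al (h u))) Et; apply: min_period_flow; exact: HTm.
  by apply: min_period_flow; apply: HTm; apply: W01; rewrite w0.
- move=> u w /W01 u01 /W01 w01 E; have [_ E1] := Htau u u01; have [_ E2] := Htau w w01.
  have := inj (h u) (h w) _ _ (same_orbit_trans E1 (same_orbit_trans E (same_orbit_sym E2))).
  have := hin u u01; have := hin w w01 => h1 h2 H; suff : h u = h w by rewrite /h; flra.
  by apply: H; flra.
- move=> W oW Wx.
  have Wx' t : W (v t (al 1)) by rewrite sx.
  have [e e0 He] := Dst _ _ oW Wx'.
  have : \forall u \near (1 : K), D (al (h 1)) (al (h u)) < e by exact: cal'.
  have -> : h 1 = 1 by rewrite /h; flra.
  have u0 : \forall u \near (1 : K), 0 < u by apply: (cts_near_gt0 (f := id)) => //; cts.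
  apply: filterS2 u0 => u u0 H u1 t; have [|_ [t' <-]] := Htau u; first by rewrite (ltW u0).
  by rewrite -vD; exact: He.
- by move=> u /W01 u01; exists (h u); [exact: hin | have [_ /same_orbit_sym] := Htau u u01].
Qed.

(** * The disk swept by an arc ending at a singular point *)

Lemma circle_eq_turn (s s' : K) : circle s = circle s' -> s' <= s -> exists n : nat, s = s' + n%:R.
Proof.
move=> [c1 c2] ss; have f0 : 0 <= s - s' by flra.
have := truncn_itv f0; set n := Num.trunc _ => hn; exists n.
pose f := s - s' - n%:R; suff : f = 0 by rewrite /f; flra.
have f01 : 0 <= f < 1 by move: hn; rewrite /f -natr1 => hn; apply/andP; split; flra.
have pi0 := @pi_gt0 K.
have cf : cos (pi *+ 2 * f) = 1.
  have -> : pi *+ 2 * f = pi *+ 2 * (s - s') - (pi *+ 2) *+ n :> K.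
    by rewrite /f (mulrBr _ (s - s')) mulr_natr.
  rewrite -(periodicn (@cosD2pi K) n) subrK mulrBr cosB c1 c2.
  by rewrite -!expr2 cos2Dsin2.
have : sin (pi * f) = 0.
  have := cosD (pi * f) (pi * f); have -> : pi * f + pi * f = pi *+ 2 * f by rewrite -mulrDl -mulr2n.
  rewrite cf -!expr2; have := cos2Dsin2 (pi * f).
  by move=> h1 h2; apply/eqP; rewrite -sqrf_eq0; apply/eqP; flra.
move=> s0; apply/eqP; case: (ltrgtP f 0) => // h; first by flra.
have : 0 < sin (pi * f).
  apply: sin_gt0_pi; rewrite mulr_gt0 //= -[X in _ < X]mulr1 ltr_pM2l //; flra.
by rewrite s0 ltxx.
Qed.

Lemma circleD_nat (s : K) n : circle (s + n%:R) = circle s.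
Proof.
have E : pi *+ 2 * (s + n%:R) = pi *+ 2 * s + (pi *+ 2) *+ n :> K by rewrite mulrDr mulr_natr.
by rewrite /circle E (periodicn (@cosD2pi K)) (periodicn (@sinD2pi K)).
Qed.

Lemma min_period_multiple z (T t : K) : min_period z T -> v t z = z -> 0 <= t ->
  exists n : nat, t = T *+ n.
Proof.
move=> [T0 vT H] vt t0; have := truncn_itv (divr_ge0 t0 (ltW T0)); set n := Num.trunc _.
rewrite ler_pdivlMr // ltr_pdivrMr // -natr1 mulrDl mul1r => hn; exists n.
have [E|ne] := eqVneq t (T *+ n); first by [].
case: (H (t - T *+ n)).
  move: ne; rewrite -mulr_natl neq_lt => /orP ne.
  by apply/andP; split; [case: ne => ne; flra | flra].
by rewrite -[in LHS](period_nat n vT) -vD subrK.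
Qed.

(** The Euclidean radius; the norm of a pair is the maximum of the coordinates. *)
Definition eradius (q : K * K) : K := Num.sqrt (q.1 ^+ 2 + q.2 ^+ 2).

Lemma cts_eradius q : cts_at eradius q.
Proof.
have c : cts_at (fun q : K * K => q.1 * q.1 + q.2 * q.2) q by cts.
by apply: (cts_comp (g := Num.sqrt) c); exact: sqrt_continuous.
Qed.

Lemma eradius_circle (r s : K) : 0 <= r -> eradius (r *: circle s) = r.
Proof.
move=> r0; rewrite /eradius /circle /= !exprMn -mulrDr cos2Dsin2 mulr1 sqrtr_sqr.
exact: ger0_norm.
Qed.

Lemma polar_form q : q <> 0 -> 0 < eradius q /\ exists s, q = eradius q *: circle s.
Proof.
move=> /angle_of_exists[a [r r0 E]]; have pi0 := @pi_gt0 K.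
have Eq : q = r *: circle (a / (pi *+ 2)).
  rewrite E /circle; have -> : pi *+ 2 * (a / (pi *+ 2)) = a.
    by rewrite mulrC divfK // mulrn_eq0 /= gt_eqF.
  by [].
have rq : eradius q = r by rewrite Eq eradius_circle // ltW.
by split; rewrite rq //; exists (a / (pi *+ 2)).
Qed.

Lemma eradius0 : eradius 0 = 0.
Proof. by rewrite /eradius /= expr0n /= addr0 sqrtr0. Qed.

Lemma eradius_lt1 q : (eradius q < 1) = (q.1 ^+ 2 + q.2 ^+ 2 < 1).
Proof.
rewrite /eradius -{1}(sqrtr1 K) ltr_sqrt //.
Qed.

Definition plane_rot (t : K) (p : K * K) : K * K :=
  (p.1 * cos t - p.2 * sin t, p.1 * sin t + p.2 * cos t).

Lemma plane_rot_polar (r s t : K) :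
  plane_rot (pi *+ 2 * t) (r *: circle s) = r *: circle (t + s).
Proof.
rewrite /plane_rot /circle mulrDr [in RHS]cosD [in RHS]sinD /=.
by congr pair; rewrite /= /GRing.scale /=; ring.
Qed.

Definition plane_disk : set (K * K) := [set p | p.1 ^+ 2 + p.2 ^+ 2 < 1].

(** The notion [center_pt] over an arbitrary real field K, with [plane_rot] and [plane_disk] for
    [rot] and [unit_disk]; over [R] the two are convertible. *)
Definition rotation_center x : Prop :=
  singular x /\
  exists U : set S, [/\ open U, U x, (forall t y, U y -> U (v t y)) &
    exists h : S -> K * K, homeo_on U plane_disk h /\
      forall y, U y -> exists tau : K -> K,
        [/\ continuous tau, {homo tau : a b / a < b},
            (forall s, exists t, tau t = s) &
            (forall t, h (v t y) = plane_rot (tau t) (h y))]].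

(** Invariance of domain read in a chart. Since f is injective on U, covering a plane neighbourhood
    of f (F q) is enough even if U meets the boundary. *)
Lemma surface_open_map (F : K * K -> S) (q : K * K) (r : K) : 0 < r ->
  (forall p, `|p - q| < r -> cts_at F p) ->
  (forall p p', `|p - q| < r -> `|p' - q| < r -> F p = F p' -> p = p') ->
  nbhs (F q) (F @` [set p | `|p - q| < r]).
Proof.
move=> r0 cF injF; have [U [f [g [r1 [[oU cf Ug _ _] Uq]]]]] := has_chart (F q).
have qq : `|q - q| < r by rewrite subrr normr0.
have : \forall p \near q, U (F p) by apply: (cts_nbhs (cF q qq)); exact: open_nbhs_nbhs.
move=> /near_normP[r2 r20 H2].
have [||m [m0 m1 m2]] := @exists_le2 _ (r / 2) (r2 / 2); [flra | flra |].
pose c (p : K * K) : K * K := (clamp (q.1 - m) (q.1 + m) p.1, clamp (q.2 - m) (q.2 + m) p.2).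
have cE p : `|p.1 - q.1| <= m -> `|p.2 - q.2| <= m -> c p = p.
  by rewrite !ler_norml /c => h1 h2; rewrite !clampE -?surjective_pairing //; flra.
have cin p : `|c p - q| <= m.
  have h1 : q.1 - m <= clamp (q.1 - m) (q.1 + m) p.1 <= q.1 + m by apply: clamp_in; flra.
  have h2 : q.2 - m <= clamp (q.2 - m) (q.2 + m) p.2 <= q.2 + m by apply: clamp_in; flra.
  by rewrite pair_norm_le /= !ler_norml; apply/andP; split; flra.
have cinr p : `|c p - q| < r by have := cin p; flra.
have cinr2 p : `|c p - q| < r2 by have := cin p; flra.
have ccG : continuous (fun p => f (F (c p))).
  move=> p; apply: cts_at_continuous.
  have cc : cts_at c p by rewrite /c; cts.
  have cFc : cts_at (fun p => F (c p)) p by apply: (cts_comp cc); exact: cF.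
  by apply: (cts_comp (g := f) cFc); apply: cf; exact: H2.
have injG p p' : `|p.1 - q.1| <= m -> `|p.2 - q.2| <= m -> `|p'.1 - q.1| <= m ->
    `|p'.2 - q.2| <= m -> f (F (c p)) = f (F (c p')) -> p = p'.
  move=> h1 h2 h3 h4 E; have Ep := H2 _ (cinr2 p); have Ep' := H2 _ (cinr2 p').
  rewrite -(cE p) // -(cE p') //; apply: injF => //.
  by have [_ <-] := Ug _ Ep; have [_ <-] := Ug _ Ep'; rewrite E.
have near_f := @invariance_of_domain _ (fun p => f (F (c p))) q m m m0 m0 ccG injG.
have cq : c q = q by apply: cE; rewrite subrr normr0 ltW.
rewrite /= cq in near_f; have H3 := cts_nbhs (cf _ Uq) near_f.
have HU : \forall z \near F q, U z by exact: open_nbhs_nbhs.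
apply: filterS2 HU H3 => z Uz [p [h1 h2 E]]; exists (c p); first exact: cinr.
have [_ <-] := Ug z Uz; rewrite -E; have [_ ->] := Ug _ (H2 _ (cinr2 p)); by [].
Qed.

Section Disk.
Variables (x : S) (tau : K -> S) (Tm : K -> K).
Hypothesis sx : singular x.
Hypothesis tau_data : forall u, 0 < u < 1 ->
  [/\ cts_at tau u, cts_at Tm u & min_period (tau u) (Tm u)].
Hypothesis tau_inj : forall u w, 0 < u < 1 -> 0 < w < 1 -> same_orbit (tau u) (tau w) -> u = w.
Hypothesis tau_lim : forall W : set S, open W -> W x ->
  \forall u \near (1 : K), u < 1 -> forall t, W (v t (tau u)).

(** The angle s counts turns in units of the minimal period. The radius is 1 - u, so that the center
    of the disk corresponds to the end u = 1 of the arc. *)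
Definition polar_map (s r : K) : S := v (s * Tm (1 - r)) (tau (1 - r)).

Lemma polar_map_nat s (r : K) n : 0 < r < 1 -> polar_map (s + n%:R) r = polar_map s r.
Proof.
move=> r01; have [|_ _ [_ vT _]] := @tau_data (1 - r); first by lra.
by rewrite /polar_map mulrDl vD mulr_natl (period_nat n vT).
Qed.

Lemma polar_map_circle s s' (r : K) : 0 < r < 1 -> circle s = circle s' ->
  polar_map s r = polar_map s' r.
Proof.
move=> r01; wlog ss : s s' / s' <= s.
  by move=> W E; case: (leP s' s) => h; [exact: W | apply/esym/W => //; exact: ltW].
by move=> /circle_eq_turn /(_ ss)[n ->]; exact: polar_map_nat.
Qed.

Lemma polar_map_inj s s' (r r' : K) : 0 < r < 1 -> 0 < r' < 1 -> polar_map s r = polar_map s' r' ->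
  r = r' /\ circle s = circle s'.
Proof.
move=> r01 r01' E; have u01 : 0 < 1 - r < 1 by lra.
have u01' : 0 < 1 - r' < 1 by lra.
have rr : r = r'.
  suff : 1 - r = 1 - r' by lra.
  have h1 : same_orbit (tau (1 - r)) (polar_map s r) by exists (s * Tm (1 - r)).
  have h2 : same_orbit (tau (1 - r')) (polar_map s r) by rewrite E; exists (s' * Tm (1 - r')).
  exact: tau_inj u01 u01' (same_orbit_trans h1 (same_orbit_sym h2)).
split => //; subst r'; have [_ _ mp] := tau_data u01; have [T0 _ _] := mp.
wlog ss : s s' E / s' <= s.
  by move=> W; case: (leP s' s) => h; [exact: W | apply/esym; apply: W => //; exact: ltW].
have [||n En] := @min_period_multiple _ _ ((s - s') * Tm (1 - r)) mp.
- rewrite mulrBl -mulrN addrC vD; move: E; rewrite /polar_map => ->.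
  by rewrite mulrN vK.
- by apply: mulr_ge0; lra.
have -> : s = s' + n%:R; last exact: circleD_nat.
have : s - s' = n%:R by apply: (mulIf (lt0r_neq0 T0)); rewrite En mulr_natl.
by lra.
Qed.

(** An arbitrary choice of angle, possibly discontinuous: [polar_map] depends on the point of the
    circle only. *)
Lemma exists_phase : exists ph : K * K -> K, forall q, q <> 0 -> q = eradius q *: circle (ph q).
Proof.
have /choice[ph Hph] : forall q : K * K, exists s, q <> 0 -> q = eradius q *: circle s.
  move=> q; have [->|n] := pselect (q = 0); first by exists 0.
  by have [_ [s E]] := polar_form n; exists s.
by exists ph.
Qed.

Definition disk_map (ph : K * K -> K) (q : K * K) : S :=
  if q == 0 then x else polar_map (ph q) (eradius q).

Section DiskMap.
Variable ph : K * K -> K.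
Hypothesis hph : forall q, q <> 0 -> q = eradius q *: circle (ph q).

Lemma disk_map0 : disk_map ph 0 = x. Proof. by rewrite /disk_map eqxx. Qed.

Lemma disk_map_polar s (r : K) : 0 < r < 1 -> disk_map ph (r *: circle s) = polar_map s r.
Proof.
move=> r01; have r0 : 0 <= r by lra.
have q0 : r *: circle s <> 0.
  by move=> E; have := eradius_circle s r0; rewrite E eradius0; lra.
have /eqP/negPf qF := q0; rewrite /disk_map qF eradius_circle //.
apply: polar_map_circle => //; have := hph q0; rewrite eradius_circle // => /scalerI H.
by apply/esym/H; rewrite gt_eqF //; lra.
Qed.

Lemma disk_map_inj p q : eradius p < 1 -> eradius q < 1 -> disk_map ph p = disk_map ph q -> p = q.
Proof.
have ns s (r : K) : 0 < r < 1 -> polar_map s r <> x.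
  move=> r01 E; have [|_ _ mp] := @tau_data (1 - r); first by lra.
  apply: (min_period_ns mp) => t; have := sx t; rewrite -E /polar_map vC => /v_inj; exact.
have [->|p0] := pselect (p = 0); have [->//|q0] := pselect (q = 0).
- have [r0 [s ->]] := polar_form q0; rewrite disk_map0 eradius_circle ?ltW // => _ r1.
  by rewrite disk_map_polar ?r0 // => E; case: (@ns s (eradius q)); rewrite ?r0.
- have [r0 [s ->]] := polar_form p0; rewrite disk_map0 eradius_circle ?ltW // => r1 _.
  by rewrite disk_map_polar ?r0 // => E; case: (@ns s (eradius p)); rewrite ?r0.
have [r0 [s Ep]] := polar_form p0; have [r0' [s' Eq]] := polar_form q0 => r1 r1'.
rewrite Ep Eq !disk_map_polar ?r0 ?r0' // => /polar_map_inj[||-> ->] //.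
  by rewrite r0.
by rewrite r0'.
Qed.

(** At the origin this is the shrinking of the orbits; elsewhere the chosen phase is replaced by a
    local continuous one, which does not change the map. *)
Lemma disk_map_cts q : eradius q < 1 -> cts_at (disk_map ph) q.
Proof.
have cr : forall p, cts_at eradius p := cts_eradius.
have [->|q0] := pselect (q = 0) => r1.
  move=> A; rewrite disk_map0 => xA.
  have c : cts_at (fun p => 1 - eradius p) 0 by cts.
  have near0 : \forall p \near (0 : K * K), 1 - eradius p < 1 -> forall t, A° (v t (tau (1 - eradius p))).
    apply: (@cts_nbhs _ _ _ _ [set u | u < 1 -> forall t, A° (v t (tau u))] c).
    by rewrite eradius0 subr0; exact: (tau_lim (open_interior A) xA).
  have near1 : \forall p \near (0 : K * K), eradius p < 1.
    by apply: (cts_near_lt (f := eradius)); [exact: cr | rewrite eradius0].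
  have : \forall p \near (0 : K * K), A (disk_map ph p).
    apply: filterS2 near0 near1 => p Hp rp; have [->|p0] := pselect (p = 0).
      by rewrite disk_map0; exact: nbhs_singleton xA.
    have [r0 [s Ep]] := polar_form p0; rewrite {1}Ep disk_map_polar ?r0 //.
    by apply: interior_subset; apply: Hp; lra.
  by [].
have [r0 [s Eq]] := polar_form q0; have pi0 := @pi_gt0 K.
have aq : angle_of (pi *+ 2 * s) q by exists (eradius q) => //; rewrite {1}Eq.
(* The angle of p, in turns, obtained from that of q by [angle_of_turn]. *)
pose a p : K := (pi *+ 2 * s + atan (det2 q p / dot q p)) / (pi *+ 2).
have dq : 0 < dot q q by exact: dot_gt0.
have near1 : \forall p \near q, 0 < dot q p.
  by apply: (cts_near_gt0 (f := fun p => dot q p)) => //; rewrite /dot; cts.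
have near2 : \forall p \near q, eradius p < 1 by apply: (cts_near_lt (f := eradius)); [exact: cts_eradius | exact: r1].
have ca : cts_at a q.
  have cd : cts_at (fun p => (dot q p)^-1) q.
    by apply: cts_invr; [rewrite gt_eqF | rewrite /dot; cts].
  by rewrite /a /det2; cts.
apply: (@cts_near_eq _ _ _ (fun p => polar_map (a p) (eradius p))); last first.
  have [|ct cT _] := @tau_data (1 - eradius q); first by lra.
  have c1 : cts_at (fun p => 1 - eradius p) q by cts.
  have c2 := cts_comp c1 ct; have c3 := cts_comp c1 cT.
  by rewrite /polar_map; apply: cts_flow => //; apply: cts_mulr.
apply: filterS2 near1 near2 => p dp rp.
have ap : angle_of (pi *+ 2 * a p) p.
  have -> : pi *+ 2 * a p = pi *+ 2 * s + atan (det2 q p / dot q p).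
    by rewrite /a mulrC divfK // mulrn_eq0 /= gt_eqF.
  exact: angle_of_turn.
have [r' r'0 Ep] := ap; have Ep' : p = r' *: circle (a p) by rewrite {1}Ep.
have rr : eradius p = r' by rewrite {1}Ep' eradius_circle // ltW.
by rewrite {1}Ep' rr disk_map_polar // r'0 -rr.
Qed.

Lemma eradius_ball q : eradius q < 1 -> exists2 r : K, 0 < r & forall p, `|p - q| < r -> eradius p < 1.
Proof.
move=> rq; apply/near_normP; apply: (cts_near_lt (f := eradius)); [exact: cts_eradius | exact: rq].
Qed.

Lemma disk_map_nbhs q (r : K) : eradius q < 1 -> 0 < r ->
  nbhs (disk_map ph q) (disk_map ph @` [set p | `|p - q| < r /\ eradius p < 1]).
Proof.
move=> rq r0; have [r1 r10 H1] := eradius_ball rq.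
have [m [m0 m1 m2]] := exists_le2 r0 r10.
have inball p : `|p - q| < m -> eradius p < 1 by move=> h; apply: H1; exact: lt_le_trans h m2.
apply: filterS (surface_open_map m0 _ _) => [_ [p h <-]|p h|p p' h h' E].
- by exists p => //; split; [exact: lt_le_trans h m1 | exact: inball].
- by apply: disk_map_cts; exact: inball.
- by apply: disk_map_inj E; exact: inball.
Qed.

Lemma disk_map_flow q : eradius q < 1 -> exists tau' : K -> K,
  [/\ continuous tau', {homo tau' : a b / a < b}, (forall s, exists t, tau' t = s) &
    (forall t, v t (disk_map ph q) = disk_map ph (plane_rot (tau' t) q) /\
       eradius (plane_rot (tau' t) q) = eradius q)].
Proof.
move=> rq; have pi0 := @pi_gt0 K; have [->|q0] := pselect (q = 0).
  have r0 t' : plane_rot t' 0 = 0 by rewrite /plane_rot /= !mul0r subr0 addr0.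
  exists (fun t => t); split; [by move=> t'; cts | by [] | by move=> s; exists s |].
  by move=> t'; rewrite r0 disk_map0; split; [exact: sx | rewrite eradius0].
have [r0 [s Eq]] := polar_form q0; have r01 : 0 < eradius q < 1 by rewrite r0.
have [|_ _ [T0 _ _]] := @tau_data (1 - eradius q); first by lra.
set T := Tm (1 - eradius q) in T0; have p20 : 0 < pi *+ 2 :> K by rewrite pmulrn_lgt0.
exists (fun t => pi *+ 2 * (t / T)); split.
- by move=> t'; cts.
- by move=> a b ab; rewrite ltr_pM2l // ltr_pM2r // invr_gt0.
- move=> s'; exists (s' / (pi *+ 2) * T); rewrite mulfK ?gt_eqF //.
  by rewrite mulrC divfK // gt_eqF.
move=> t'; have -> : plane_rot (pi *+ 2 * (t' / T)) q = eradius q *: circle (t' / T + s).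
  by rewrite {1}Eq plane_rot_polar.
rewrite eradius_circle ?ltW //; split => //; rewrite {1}Eq !disk_map_polar //.
by rewrite /polar_map -/T -vD mulrDl divfK // gt_eqF.
Qed.

End DiskMap.

(** The swept disk map F is a continuous open injection that carries rotations to the flow, so its
    inverse h is the equivalence required of a center. *)
Lemma disk_center : rotation_center x.
Proof.
have [ph hph] := exists_phase; pose F := disk_map ph.
have /choice[h Hh] : forall z, exists q : K * K, forall p, eradius p < 1 -> F p = z -> q = p.
  move=> z; have [[p [rp E]]|n] := pselect (exists p, eradius p < 1 /\ F p = z).
    by exists p => p' rp' E'; apply: (disk_map_inj hph) => //; rewrite -/F E E'.
  by exists 0 => p rp E; case: n; exists p.
have hF p : eradius p < 1 -> h (F p) = p by move=> rp; exact: Hh.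
pose U : set S := F @` [set p | eradius p < 1].
have oU : open U.
  rewrite openE => _ [q rq <-]; rewrite /interior.
  by apply: filterS (disk_map_nbhs hph rq ltr01) => _ [p [_ rp] <-]; exists p.
split => //; exists U; split => //.
- by exists 0; [rewrite /= eradius0 | exact: disk_map0].
- move=> t _ [q rq <-]; have [tau' [_ _ _ H]] := disk_map_flow hph rq.
  by have [E rE] := H t; exists (plane_rot (tau' t) q); [rewrite /= rE | exact: esym].
exists h; split; last first.
  move=> _ [q rq <-]; have [tau' [h1 h2 h3 H]] := disk_map_flow hph rq.
  exists tau'; split => // t; have [E rE] := H t.
  by rewrite [v t _]E hF // hF // rE.
exists F; split.
- apply: continuous_in_subspaceT => z; rewrite inE => -[q rq <-].
  apply: cts_at_continuous => A; rewrite hF // => /near_normP[e e0 He].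
  have : \forall z \near F q, A (h z).
    apply: filterS (disk_map_nbhs hph rq e0) => _ [p [pe rp] <-].
    by rewrite [h _]hF //; exact: He.
  by [].
- apply: continuous_in_subspaceT => q; rewrite inE => rq.
  by apply: cts_at_continuous; apply: disk_map_cts => //; rewrite eradius_lt1.
- split=> [_ [q rq <-]|q rq]; first by rewrite hF // /plane_disk /= -eradius_lt1.
  by exists q => //; rewrite /= eradius_lt1.
- by move=> _ [q rq <-]; rewrite hF.
- by move=> q rq; rewrite hF // eradius_lt1.
Qed.

Lemma disk_near : \forall z \near x, z = x \/ exists2 u : K, 0 < u < 1 & same_orbit z (tau u).
Proof.
have [ph hph] := exists_phase; have r0 : eradius 0 < 1 by rewrite eradius0.
have := disk_map_nbhs hph r0 ltr01; rewrite disk_map0; apply: filterS => _ [q [_ rq] <-].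
have [->|q0] := pselect (q = 0); first by left; exact: disk_map0.
have [rq0 [s E]] := polar_form q0; right; exists (1 - eradius q); first by lra.
rewrite {1}E disk_map_polar ?rq0 //; apply: same_orbit_sym.
by exists (s * Tm (1 - eradius q)).
Qed.

End Disk.

Lemma same_orbit_singular x y : same_orbit x y -> singular x \/ singular y -> x = y.
Proof.
move=> [t <-] [sx|sx]; first by rewrite sx.
by have := sx (- t); rewrite vK.
Qed.

Lemma near_nonsingular x : ~ singular x -> \forall z \near x, ~ singular z.
Proof.
move=> /existsNP[t nt].
have : \forall z \near x, v t z <> z.
  by apply: (@cts_near_neq _ _ (fun z => v t z) id) => //; ctsv.
by apply: filterS => z h sz; exact: h.
Qed.

Lemma open_path_nonsingular (c : K -> S) : continuous c -> open [set t | ~ singular (c t)].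
Proof.
move=> cc; rewrite openE => t nt; rewrite /interior.
have c' : cts_at c t by exact: cc.
exact: (cts_nbhs c' (near_nonsingular nt)).
Qed.

Definition rev01 (u : K) : K := 1 - u.

Lemma cts_rev01 (u : K) : cts_at rev01 u.
Proof. by rewrite /rev01; apply: cts_addr; [cts | apply: (cts_oppr (f := id)); cts]. Qed.

(** * Arcs between singular points *)

Section GlobalArc.
Variable D : S -> S -> K.
Hypothesis D_pseudo : pseudo_dist D.
Hypothesis D_eq0 : forall x y, D x y = 0 <-> same_orbit x y.
Hypothesis D_near : forall x (e : K), 0 < e -> \forall y \near x, D x y < e.
Hypothesis D_ball : forall x (W : set S), nbhs x W -> flow_invariant W ->
  exists2 e : K, 0 < e & forall y, D x y < e -> W y.
Hypothesis D_stable : forall x (W : set S), open W -> (forall t, W (v t x)) ->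
  exists2 e : K, 0 < e & forall y, D x y < e -> forall t, W (v t y).

Definition orbit_arc (al : K -> S) : Prop :=
  [/\ dist_cts D al,
      forall u w : K, 0 <= u <= 1 -> 0 <= w <= 1 -> same_orbit (al u) (al w) -> u = w &
      forall u : K, 0 < u < 1 -> ~ singular (al u)].

Lemma orbit_arc_rev al : orbit_arc al -> orbit_arc (fun u => al (rev01 u)).
Proof.
move=> [h1 h2 h3]; split.
- move=> u e e0; have H := h1 (rev01 u) e e0.
  have c : cts_at rev01 u by exact: cts_rev01.
  exact: (cts_nbhs c H).
- by rewrite /rev01 => u w u01 w01 /h2 E; have : 1 - u = 1 - w by [apply: E; lra]; lra.
- by rewrite /rev01 => u u01; apply: h3; lra.
Qed.

(** The arc extracted from c takes its values among those of c; the end values of c can recur only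
    at the ends, by injectivity, so the inner orbits are nonsingular. *)
Lemma exists_orbit_arc (c : K -> S) : continuous c -> c 0 <> c 1 -> singular (c 1) ->
  (forall t : K, 0 < t < 1 -> ~ singular (c t)) ->
  exists2 al, orbit_arc al & same_orbit (al 0) (c 0) /\ al 1 = c 1.
Proof.
move=> cc c01 s1 ns.
have dc : dist_cts D c.
  move=> u e e0; have cu : cts_at c u by exact: cc.
  exact: (cts_nbhs cu (D_near (c u) e0)).
have [|al [h1 /D_eq0 h2 /D_eq0 h3 h4 h5]] := exists_arc D_pseudo dc.
  by move=> /D_eq0 /same_orbit_singular H; apply: c01; apply: H; right.
have inj (u w : K) : 0 <= u <= 1 -> 0 <= w <= 1 -> same_orbit (al u) (al w) -> u = w.
  by move=> u01 w01 /D_eq0; exact: h4.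
exists al; last by split => //; apply: (same_orbit_singular h3); right.
split => // u u01; have [t t01 E] := h5 u; rewrite E.
have [t0|t0] := eqVneq t 0.
  have : u = 0; last by lra.
  by apply: inj; [lra | lra | rewrite E t0; exact: same_orbit_sym].
have [t1|t1] := eqVneq t 1.
  have : u = 1; last by lra.
  by apply: inj; [lra | lra | rewrite E t1; exact: same_orbit_sym].
by apply: ns; rewrite !lt_neqAle eq_sym t0 t1; lra.
Qed.

Lemma orbit_arc_end al : orbit_arc al -> singular (al 1) -> rotation_center (al 1) /\
  \forall z \near al 1, z = al 1 \/ exists2 w : K, 0 < w < 1 & same_orbit z (al w).
Proof.
move=> [h1 h2 h3] s1; have [tau [Tm [k1 k2 k3 k4]]] := arc_end D_ball D_stable h1 h2 h3 s1.
split; first exact: disk_center s1 k1 k2 k3.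
apply: filterS (disk_near s1 k1 k2 k3) => z [->|[u u01 E]]; first by left.
by right; have [w w01 E'] := k4 u u01; exists w => //; exact: same_orbit_trans E E'.
Qed.

Hypothesis conS : connected [set: S].

(** The union of the orbits is open at inner points by [arc_open] and at the two ends by the disks
    swept there; it is closed by compactness of [0, 1]. *)
Lemma orbit_arc_whole al : orbit_arc al -> singular (al 0) -> singular (al 1) ->
  forall z, exists2 u : K, 0 <= u <= 1 & same_orbit z (al u).
Proof.
move=> ha s0 s1; have [cal inj ns] := ha.
pose P z := exists2 u : K, 0 <= u <= 1 & same_orbit z (al u).
have Pv t z : P (v t z) -> P z.
  by move=> [u u01 E]; exists u => //; apply: same_orbit_trans E; exists t.
have P1 : P (al 1) by exists 1; [rewrite ler01 lexx | exact: same_orbit_refl].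
have P0 : P (al 0) by exists 0; [rewrite ler01 lexx | exact: same_orbit_refl].
have oP z : P z -> \forall z' \near z, P z'.
  move=> [u u01 [t E]].
  suff H : \forall w \near al u, P w.
    by rewrite -E in H; apply: filterS (near_flow H) => w; exact: Pv.
  have [u0|u0] := eqVneq u 0.
    have s0' : singular (al (rev01 1)) by rewrite /rev01 subrr.
    have [_] := orbit_arc_end (orbit_arc_rev ha) s0'; rewrite /= /rev01 subrr u0.
    apply: filterS => w [->|[w' w01 Ew]]; first exact: P0.
    by exists (1 - w') => //; lra.
  have [u1|u1] := eqVneq u 1.
    have [_] := orbit_arc_end ha s1; rewrite u1.
    apply: filterS => w [->|[w' w01 Ew]]; first exact: P1.
    by exists w' => //; lra.
  have u01' : 0 < u < 1 by rewrite !lt_neqAle eq_sym u0 u1; lra.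
  apply: filterS (arc_open D_ball cal inj u01' (ns u u01')) => w [w' w01 Ew].
  by exists w' => //; lra.
have cP z : ~ P z -> \forall z' \near z, ~ P z'.
  move=> nP; have : \forall z' \near z, forall u, 0 <= u <= 1 -> ~ same_orbit z' (al u).
    apply: (segment_near_forall (Q := fun u z' => ~ same_orbit z' (al u))) => u u01.
    have n : ~ same_orbit z (al u) by move=> E; apply: nP; exists u.
    pose W := [set w | ~ same_orbit z w].
    have [_ DC Dtri] := D_pseudo.
    have d0 : 0 < D z (al u).
      by rewrite lt_neqAle dist_ge0 // andbT eq_sym; apply/eqP => /D_eq0.
    have d2 : 0 < D z (al u) / 2 by lra.
    have c1 : cts_at (fun p : K * S => p.1) (u, z) by cts.
    have c2 : cts_at (fun p : K * S => p.2) (u, z) by cts.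
    apply: filterS2 (cts_nbhs c1 (cal u _ d2)) (cts_nbhs c2 (D_near z d2)) => p e1 e2 /D_eq0 E.
    by have := Dtri z p.2 (al u); have := Dtri p.2 (al p.1) (al u); rewrite (DC (al p.1)) E; lra.
  by apply: filterS => z' H [u u01 E]; exact: H E.
have H z : \forall z' \near z, [set: S] z' -> (P z' <-> P z).
  have [Pz|nPz] := pselect (P z).
    by apply: filterS (oP z Pz) => z' Pz' _.
  by apply: filterS (cP z nPz) => z' Pz' _.
by move=> z; apply: (connected_locally_constant conS (fun z _ => H z) (x := al 0)).
Qed.

Definition joined x y : Prop := exists c : K -> S, [/\ continuous c, c 0 = x & c 1 = y].

Lemma joined_sym x y : joined x y -> joined y x.
Proof.
move=> [c [cc c0 c1]]; exists (fun t => c (rev01 t)); split; last by rewrite /rev01 subrr.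
  by move=> t; have c' : cts_at rev01 t by [exact: cts_rev01]; cts.
by rewrite /rev01 subr0.
Qed.

Lemma joined_trans x y z : joined x y -> joined y z -> joined x z.
Proof.
move=> [c [cc c0 c1]] [d [cd d0 d1]].
exists (fun t => if t <= 2^-1 then c (2 * t) else d (2 * t - 1)); split.
- apply: (cts_glue (f := fun t => c (2 * t)) (g := fun t => d (2 * t - 1))); [by move=> t; cts | by move=> t; cts |].
  by rewrite divff // subrr c1 d0.
- by rewrite ifT ?mulr0 //; lra.
- rewrite ifF; last by apply/negbTE; rewrite -ltNge invf_lt1 // ltr1n.
  by have -> : 2 * 1 - 1 = 1 :> K by lra.
Qed.

Lemma joined_near x : \forall y \near x, joined y x.
Proof.
have [U [f [g [r [[oU cf Ug r0 gr] Ux]]]]] := has_chart x.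
have H1 : \forall y \near x, U y by exact: open_nbhs_nbhs.
have H2 : \forall y \near x, `|f y - f x| < r.
  have c := cf x Ux; apply: (cts_near_lt (f := fun y => `|f y - f x|)); first by cts.
  by rewrite subrr normr0.
apply: filterS2 H1 H2 => y Uy hy.
exists (fun t => g (f y + clamp 0 1 t *: (f x - f y))); split.
- move=> t; apply: cts_at_continuous.
  have c : cts_at (fun t => f y + clamp 0 1 t *: (f x - f y)) t by cts.
  apply: (cts_comp (g := g) c).
  have t01 : 0 <= clamp 0 1 t <= 1 by apply: clamp_in; exact: ler01.
  have [] // := gr (f y + clamp 0 1 t *: (f x - f y)).
  have -> : f y + clamp 0 1 t *: (f x - f y) - f x = (1 - clamp 0 1 t) *: (f y - f x).
    by rewrite scalerBl scale1r -(opprB (f y)) scalerN addrAC.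
  rewrite normrZ ger0_norm; last by lra.
  by apply: le_lt_trans hy; rewrite -[X in _ <= X]mul1r ler_wpM2r //; lra.
- by rewrite clampE ?lexx ?ler01 // scale0r addr0; have [_ ->] := Ug y Uy.
- by rewrite clampE ?lexx ?ler01 // scale1r addrC subrK; have [_ ->] := Ug x Ux.
Qed.

Lemma all_joined x y : joined x y.
Proof.
apply: (connected_locally_constant conS (P := joined x) _ (x := x)) => //; last first.
  by exists (fun=> x); split => //; exact: cst_continuous.
move=> z _; apply: filterS (joined_near z) => w jw _.
by split=> h; apply: joined_trans h _; [exact: jw | exact: joined_sym].
Qed.

(** A path from y is cut at its first singular time. *)
Lemma exists_accessible y x : ~ singular y -> singular x ->
  exists al, orbit_arc al /\ singular (al 1).
Proof.
move=> ny sx; have [c [cc c0 c1]] := all_joined y x.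
have [||b [b01 nb Hb]] := first_outside (open_path_nonsingular cc) (a := 0) (t := 1); first exact: ler01.
  by rewrite /= c1; apply.
have {nb}sb : singular (c b) by apply: contrapT.
have b0 : 0 < b.
  rewrite lt_neqAle; case/andP: b01 => -> _; rewrite andbT; apply/eqP => E.
  by apply: ny; rewrite -c0 E.
have [||||al ha [_ E]] := @exists_orbit_arc (fun t => c (b * t)).
- by move=> t; cts.
- by rewrite mulr0 mulr1 c0 => E; apply: ny; rewrite E.
- by rewrite mulr1.
- move=> t t01; apply: Hb; first by apply: mulr_ge0; lra.
  by rewrite -[X in _ < X]mulr1 ltr_pM2l //; lra.
by exists al; rewrite E mulr1.
Qed.

(** A path from al 1 to x is cut at its last visit b to al 1 and at the first singular time b' after
    it. That b' exists as a next time, and does not accumulate at b, is because the center al 1 is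
    isolated among the singular points. *)
Lemma exists_second al x : orbit_arc al -> singular (al 1) -> singular x -> x <> al 1 ->
  exists be, [/\ orbit_arc be, singular (be 0) & singular (be 1)].
Proof.
move=> ha s1 sx xn; have [_ near1] := orbit_arc_end ha s1; have [_ _ ns] := ha.
have near2 : \forall z \near al 1, z = al 1 \/ ~ singular z.
  apply: filterS near1 => z [->|[w w01 [t E]]]; first by left.
  by right => sz; apply: (ns w w01); rewrite -E sz.
have [c [cc c0 c1]] := all_joined (al 1) x.
have oX : open [set t | c t <> al 1].
  rewrite openE => t nt; rewrite /interior.
  by apply: (@cts_near_neq _ _ c (fun=> al 1)) => //; cts.
have [||b [b01 nb Hb]] := last_outside oX (s := 0) (a := 1); first exact: ler01.
  by rewrite /= c0; apply.
have {nb}cb : c b = al 1 by apply: contrapT.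
have b1 : b < 1.
  by rewrite lt_neqAle; case/andP: b01 => _ ->; rewrite andbT; apply/eqP => E; apply: xn; rewrite -c1 -cb E.
have cb' : cts_at c b by exact: cc.
rewrite -cb in near2; have /near_normP[h h0 Hh] := cts_nbhs cb' near2.
(* Up to b + m the path is near al 1 without meeting it again, hence nonsingular; the search for a
   singular time can start there. *)
have [||m [m0 m1 m2]] := @exists_le2 _ (h / 2) ((1 - b) / 2); [lra | lra |].
have [||b' [b01' nb' Hb']] := first_outside (open_path_nonsingular cc) (a := b + m) (t := 1).
- by lra.
- by rewrite /= c1; apply.
have {nb'}sb' : singular (c b') by apply: contrapT.
have nsc t : b < t < b' -> ~ singular (c t).
  move=> ht; case: (leP (b + m) t) => tm; first by apply: Hb'; lra.
  have [|E|//] := Hh t; first by rewrite ltr_norml; lra.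
  by have /= H := Hb t; exfalso; apply: H; [lra | lra | rewrite E cb].
have [||||be hbe [E0 E1]] := @exists_orbit_arc (fun t => c (b + t * (b' - b))).
- by move=> t; cts.
- rewrite mul0r addr0 mul1r addrC subrK cb => E.
  by have /= H := Hb b'; apply: H; [lra | lra | rewrite -E].
- by rewrite mul1r addrC subrK.
- move=> t t01; apply: nsc; have d0 : 0 < b' - b by lra.
  have : 0 < t * (b' - b) by apply: mulr_gt0; lra.
  have : t * (b' - b) < b' - b by rewrite -[X in _ < X]mul1r ltr_pM2r //; lra.
  by lra.
exists be; split => //; last by rewrite E1 mul1r addrC subrK.
have : be 0 = c b.
  move: E0; rewrite mul0r addr0 => /same_orbit_singular; apply; right; rewrite cb; exact: s1.
by move=> ->; rewrite cb.
Qed.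

Lemma singular_centers y : ~ singular y ->
  (forall x, singular x -> rotation_center x) /\
  exists a b : S, forall x, singular x -> x = a \/ x = b.
Proof.
move=> ny; have [[x sx]|nS] := pselect (exists x, singular x); last first.
  by split=> [x sx|]; [case: nS; exists x | exists y, y => x sx; case: nS; exists x].
have [al [ha s1]] := exists_accessible ny sx; have [c1 _] := orbit_arc_end ha s1.
have [[x' [sx' nx']]|n2] := pselect (exists x', singular x' /\ x' <> al 1); last first.
  have H z : singular z -> z = al 1 by move=> sz; apply: contrapT => n; apply: n2; exists z.
  by split=> [z /H ->//|]; exists (al 1), (al 1) => z /H ->; left.
have [be [hb t0 t1]] := exists_second ha s1 sx' nx'.
have [c1' _] := orbit_arc_end hb t1.
have t0' : singular (be (rev01 1)) by rewrite /rev01 subrr.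
have [c0' _] := orbit_arc_end (orbit_arc_rev hb) t0'; rewrite /= /rev01 subrr in c0'.
have [_ _ ns] := hb.
have H z : singular z -> z = be 0 \/ z = be 1.
  move=> sz; have [u u01 E] := orbit_arc_whole hb t0 t1 z.
  have {}E := same_orbit_singular E (or_introl sz).
  have [u0|u0] := eqVneq u 0; first by left; rewrite E u0.
  have [u1|u1] := eqVneq u 1; first by right; rewrite E u1.
  by case: (ns u); [rewrite !lt_neqAle eq_sym u0 u1; lra | rewrite -E].
by split=> [z /H[->|->] //|]; exists (be 0), (be 1).
Qed.

Lemma orbit_dist_separated x y : ~ same_orbit x y -> exists A B : set S,
  [/\ open A /\ open B, (forall t z, A z -> A (v t z)), (forall t z, B z -> B (v t z)),
      A x /\ B y & A `&` B = set0].
Proof.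
move=> n; have [Dxx DC Dtri] := D_pseudo.
have d0 : 0 < D x y.
  by rewrite lt_neqAle dist_ge0 // andbT eq_sym; apply/eqP => /D_eq0.
have Dv w z t : D w (v t z) = D w z.
  have h : D z (v t z) = 0 by apply/D_eq0; exists t.
  by have := Dtri w z (v t z); have := Dtri w (v t z) z; rewrite (DC (v t z)) h; lra.
have oD w (e : K) : open [set z | D w z < e].
  rewrite openE => z /= hz; rewrite /interior.
  have e0 : 0 < e - D w z by lra.
  by apply: filterS (D_near z e0) => z' h /=; have := Dtri w z z'; lra.
exists [set z | D x z < D x y / 2], [set z | D y z < D x y / 2]; split => //.
- by move=> t z /=; rewrite Dv.
- by move=> t z /=; rewrite Dv.
- by rewrite /= !Dxx; split; lra.
- rewrite predeqE => z; split => // -[/= h1 h2].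
  by have := Dtri x z y; rewrite (DC z y); lra.
Qed.

End GlobalArc.

End Flow.

(** * Separated orbit spaces *)

Section Separated.
Variables (K : realType) (S : topologicalType) (v : K -> S -> S).
Hypothesis hS : hausdorff_space S.
Hypothesis cS : compact [set: S].
Hypothesis has_chart : forall x : S, exists (U : set S) (f : S -> K * K)
  (g : K * K -> S) (r : K), chart U f g (f x) r /\ U x.
Hypothesis v_cont : continuous (fun p : K * S => v p.1 p.2).
Hypothesis v0 : forall x, v 0 x = x.
Hypothesis vD : forall s t x, v (s + t) x = v s (v t x).
Implicit Types (x y z : S).
Local Notation singular := (singular v).
Local Notation same_orbit := (same_orbit v).
Ltac ctsv := cts; repeat (first [apply: (cts_flow v_cont) | cts1]).

(** The Hausdorff property of the orbit space pulled back to S: distinct orbits have disjoint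
    invariant open neighbourhoods. *)
Definition orbits_separated : Prop := forall x y, ~ same_orbit x y -> exists A B : set S,
  [/\ open A /\ open B, (forall t z, A z -> A (v t z)), (forall t z, B z -> B (v t z)),
      A x /\ B y & A `&` B = set0].

Lemma separated_closed_orbit x z : orbits_separated -> ~ same_orbit x z ->
  \forall w \near z, ~ same_orbit x w.
Proof.
move=> sep /sep[A [B [[oA oB] Av Bv [Ax Bz] AB]]].
have : \forall w \near z, B w by exact: open_nbhs_nbhs.
apply: filterS => w Bw [t E]; suff : (A `&` B) w by rewrite AB.
by split => //; rewrite -E; exact: Av.
Qed.

(** Every w outside U is separated from the orbit of x; by compactness, orbits starting near x avoid
    all such w at once. *)
Lemma separated_stable : orbits_separated -> forall x (U : set S), open U ->
  (forall t, U (v t x)) -> \forall z \near x, forall t, U (v t z).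
Proof.
move=> sep x U oU xU.
have : \forall z \near x, forall w, [set: S] w -> ~ U w -> ~ same_orbit z w.
  apply: (compact_near_forall (Q := fun w z => ~ U w -> ~ same_orbit z w)) => // w _.
  have [Uw|nU] := pselect (U w).
    have c : cts_at (fun p : S * S => p.1) (w, x) by cts.
    have := cts_nbhs c (open_nbhs_nbhs (conj oU Uw)).
    by apply: filterS => p Up nUp.
  have nxw : ~ same_orbit x w by move=> [t E]; apply: nU; rewrite -E.
  have [A [B [[oA oB] Av Bv [Ax Bw] AB]]] := sep _ _ nxw.
  have c1 : cts_at (fun p : S * S => p.1) (w, x) by cts.
  have c2 : cts_at (fun p : S * S => p.2) (w, x) by cts.
  have H1 := cts_nbhs c1 (open_nbhs_nbhs (conj oB Bw)).
  have H2 := cts_nbhs c2 (open_nbhs_nbhs (conj oA Ax)).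
  apply: filterS2 H1 H2 => p Bp Ap _ [t E]; suff : (A `&` B) p.1 by rewrite AB.
  by split => //; rewrite -E; exact: Av.
apply: filterS => z Hz t; apply: contrapT => nU; apply: (Hz _ I nU).
by exists t.
Qed.

(** The sequence v k x accumulates at some p by compactness, and p is on the orbit of x because that
    orbit is closed; so the orbit comes back near each of its points at arbitrarily large times. *)
Lemma recurrence x (t0 : K) (W : set S) (n : nat) : orbits_separated -> nbhs (v t0 x) W ->
  exists2 t : K, n%:R < `|t| & W (v t x).
Proof.
move=> sep Wx.
pose u (k : nat) := v (k%:R : K) x.
have [p [_ clp]] : [set: S] `&` cluster (u @ \oo) !=set0 by apply: cS; exact: filterT.
have clu (A : set S) (m : nat) : nbhs p A -> exists2 k : nat, (m <= k)%N & A (u k).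
  move=> Ap; have [|q [[k /= km <-] Aq]] := clp (u @` [set k | (m <= k)%N]) A _ Ap.
    by exists m => // k /= km; exists k.
  by exists k.
have [c Ec] : same_orbit x p.
  apply: contrapT => n0; have [k _ H] := clu _ 0%N (separated_closed_orbit sep n0).
  by apply: H; exists k%:R.
have Wp : \forall z \near p, W (v (t0 - c) z).
  by apply: (near_flow v_cont); rewrite -Ec -vD subrK.
have [m0 Hm0] : exists m : nat, n%:R + `|t0 - c| < m%:R :> K.
  have h : 0 <= n%:R + `|t0 - c| :> K by rewrite addr_ge0.
  by exists (Num.trunc (n%:R + `|t0 - c|)).+1; have /andP[] := truncn_itv h.
have [k km Wk] := clu _ m0 Wp; exists (t0 - c + k%:R); last by rewrite vD.
have : m0%:R <= k%:R :> K by rewrite ler_nat.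
have := ler_norm (t0 - c + k%:R); have := ler_norm (- (t0 - c)); rewrite normrN; lra.
Qed.

(** If x is not closed, t |-> v t x is injective. By recurrence there are nested closed balls
    centered on the orbit, the step from n to n + 1 avoiding all v s x with |s| <= n. A point common
    to all of them lies on the closed orbit, at a finite time, which is absurd. *)
Lemma separated_all_closed : orbits_separated ->
  forall x, singular x \/ exists2 T : K, 0 < T & v T x = x.
Proof.
move=> sep x; apply: contrapT => nx.
have inj (t t' : K) : v t x = v t' x -> t = t'.
  wlog tt : t t' / t' <= t.
    by move=> W E; case: (leP t' t) => h; [exact: W | apply/esym/W => //; exact: ltW].
  move=> E; apply/eqP; case: (ltrgtP t t') => // h; first by lra.
  exfalso; apply: nx; right; exists (t - t'); first by lra.
  by rewrite addrC vD E (vK v0 vD).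
have [dl [hdl dl0 dl1 dlc]] := exists_metric hS cS has_chart.
have [dlxx dlC dltri] := hdl.
have /choice[st Hst] : forall p : nat * (K * K), exists p' : K * K, 0 < p.2.2 ->
    [/\ 0 < p'.2, forall w, dl (v p'.1 x) w <= p'.2 -> dl (v p.2.1 x) w <= p.2.2 &
      forall w, dl (v p'.1 x) w <= p'.2 -> forall s, - p.1%:R <= s <= p.1%:R -> v s x <> w].
  move=> [n [t r]] /=; have [r0|nr] := pselect (0 < r); last by exists 0.
  have Bt : nbhs (v t x) [set w | dl (v t x) w < r].
    apply: (cts_near_lt (f := fun w => dl (v t x) w)); last by rewrite dlxx.
    by apply: (cts_dl dlc); cts.
  have [t' nt' Ht'] := recurrence n sep Bt.
  have : \forall w \near v t' x, forall s, - n%:R <= s <= n%:R -> v s x <> w.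
    apply: (segment_near_forall (Q := fun s w => v s x <> w)) => s hs.
    apply: (@cts_near_neq _ _ (fun p : K * S => v p.1 x) (fun p : K * S => p.2)) => //=.
    - by apply: (@cts_flow K S v v_cont _ (fun p : K * S => p.1) (fun=> x)); cts.
    - by cts.
    - by move=> /inj E; move: nt'; rewrite -E ltNge ler_norml hs.
  move=> /(dl_ball cS hdl dl0 dlc)[e e0 He].
  have [||m [m0 m1 m2]] := @exists_le2 _ (e / 2) (r - dl (v t x) (v t' x)); [lra | |].
    by move: Ht'; rewrite /= => h; lra.
  exists (t', m) => _ /=; split => // w hw.
    by have := dltri (v t x) (v t' x) w; lra.
  by apply: He; lra.
(* [f n] is the pair of the time of the n-th center and the radius of the n-th ball. *)
pose f := fix f n := if n is m.+1 then st (m, f m) else (0, 1).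
have f0 n : 0 < (f n).2 by elim: n => [|n IH] //=; have [] := Hst (n, f n) IH.
have fmono m n w : (m <= n)%N -> dl (v (f n).1 x) w <= (f n).2 -> dl (v (f m).1 x) w <= (f m).2.
  elim: n => [|n IH]; first by rewrite leqn0 => /eqP ->.
  rewrite leq_eqVlt => /predU1P[-> //|]; rewrite ltnS => mn h; apply: IH => //.
  by have [_ H _] := Hst (n, f n) (f0 n); exact: H.
pose u n := v (f n).1 x.
have [p [_ clp]] : [set: S] `&` cluster (u @ \oo) !=set0 by apply: cS; exact: filterT.
have clu (A : set S) (m : nat) : nbhs p A -> exists2 k : nat, (m <= k)%N & A (u k).
  move=> Ap; have [|q [[k /= km <-] Aq]] := clp (u @` [set k | (m <= k)%N]) A _ Ap.
    by exists m => // k /= km; exists k.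
  by exists k.
have [c Ec] : same_orbit x p.
  apply: contrapT => n0; have [k _ H] := clu _ 0%N (separated_closed_orbit sep n0).
  by apply: H; exists (f k).1.
have pin m : dl (v (f m).1 x) p <= (f m).2.
  rewrite leNgt; apply/negP => h.
  have : \forall w \near p, 0 < dl (v (f m).1 x) w - (f m).2.
    apply: (cts_near_gt0 (f := fun w => dl (v (f m).1 x) w - (f m).2)); last by lra.
    have cd : cts_at (fun w => dl (v (f m).1 x) w) p by apply: (cts_dl dlc); cts.
    by cts.
  move=> /(clu _ m)[k mk]; have := @fmono m k (u k) mk; rewrite /u dlxx => /(_ (ltW (f0 k))).
  by lra.
(* Ball N + 1 avoids the times up to N, among them c. *)
pose N := (Num.trunc `|c|).+1.
have cN : `|c| <= N%:R by apply: ltW; have /andP[] := truncn_itv (normr_ge0 c).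
have [_ _ H] := Hst (N, f N) (f0 N).
by apply: (H p (pin N.+1) c) => //=; rewrite -ler_norml.
Qed.

End Separated.

(** * Charts from the definition of a surface, and stability of centers *)

Lemma within_open_cts (X Y : topologicalType) (A : set X) (f : X -> Y) (x : X) :
  open A -> {within A, continuous f} -> A x -> cts_at f x.
Proof.
by move=> oA; rewrite continuous_open_subspace // => H Ax; apply: H; rewrite inE.
Qed.

(** Folding before applying the inverse homeomorphism makes it continuous on a full square, even
    around a boundary point. *)
Lemma chart_of_homeo (K : realType) (S : topologicalType) (U : set S) (W : set (K * K))
    (f : S -> K * K) (x : S) : open U -> U x -> open W ->
  homeo_on U (W `&` [set p | 0 <= p.2]) f -> exists g r, chart U f g (f x) r.
Proof.
move=> oU Ux oW [g [cf cg [fU gW] gf fg]].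
have [Wx fx0] := fU x Ux.
have /near_normP[r r0 Hr] : \forall q \near f x, W q by exact: open_nbhs_nbhs.
have foldW q : `|q - f x| < r -> (W `&` [set p | 0 <= p.2]) (fold_plane q).
  move=> h; split; first by apply: Hr; exact: fold_plane_dist.
  by rewrite /fold_plane /= le_max lexx.
have fold_id (z : K * K) : 0 <= z.2 -> fold_plane z = z.
  by case: z => a b /= b0; rewrite /fold_plane /= max_r.
exists (fun q => g (fold_plane q)), r; split => //.
- by move=> z Uz; exact: within_open_cts oU cf Uz.
- by move=> z Uz; have [_ h] := fU z Uz; rewrite fold_id // gf.
move=> q hq; have Bq := foldW q hq; split; [|exact: gW|exact: fg].
have /subspace_continuousP/(_ _ Bq) H := cg.
move=> A /H nA.
have : \forall q' \near q, (W `&` [set p | 0 <= p.2]) (fold_plane q') -> A (g (fold_plane q')).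
  exact: (cts_nbhs (@cts_fold_plane K q) nA).
have near_r : \forall q' \near q, `|q' - f x| < r.
  by apply: (cts_near_lt (f := fun q' : K * K => `|q' - f x|)); [cts | exact: hq].
move=> nA'; have : \forall q' \near q, A (g (fold_plane q')).
  by apply: filterS2 near_r nA' => q' /foldW h1; exact.
by [].
Qed.

Section CenterStable.
Variables (K : realType) (S : topologicalType) (v : K -> S -> S).

Lemma eradius_rot (t : K) (p : K * K) : eradius (plane_rot t p) = eradius p.
Proof.
rewrite /eradius /plane_rot /=; congr Num.sqrt.
have h := cos2Dsin2 t; rewrite -[RHS]mulr1 -h; ring.
Qed.

Lemma norm_le_eradius (q : K * K) : `|q| <= eradius q.
Proof.
rewrite pair_norm_le /eradius -!sqrtr_sqr.
by apply/andP; split; apply: ler_wsqrtr; rewrite ?lerDl ?lerDr sqr_ge0.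
Qed.

Lemma open_plane_disk : open (@plane_disk K).
Proof.
rewrite openE => q; rewrite /plane_disk /= -eradius_lt1 => rq; rewrite /interior.
have : \forall p \near q, eradius p < 1.
  by apply: (cts_near_lt (f := @eradius K)); [exact: cts_eradius | exact: rq].
by apply: filterS => p; rewrite /= eradius_lt1.
Qed.

(** Concentric disks are invariant under rotations, so their preimages are invariant neighbourhoods
    of x. *)
Lemma center_stable x (U : set S) : rotation_center v x -> open U -> U x ->
  \forall z \near x, forall t, U (v t z).
Proof.
move=> [sx [V [oV Vx Vv [h [[g [ch cg [hV gV] gh hg]] rot]]]]] oU Ux.
(* The time change reaches the angle pi, so h x is fixed by a half-turn. *)
have hx0 : h x = 0.
  have [tau [_ _ onto E]] := rot x Vx; have [t tE] := onto pi.
  have := E t; rewrite tE sx /plane_rot cospi sinpi !mulr0 !mulrN1 subr0 add0r.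
  case: (h x) => a b [E1 E2]; congr pair; lra.
have D0 : plane_disk (0 : K * K) by rewrite -hx0; exact: hV.
have cg0 : cts_at g 0 by apply: within_open_cts cg D0; exact: open_plane_disk.
have g0 : g 0 = x by rewrite -hx0 gh.
have /near_normP[e e0 He] : \forall q \near (0 : K * K), U (g q).
  by apply: (cts_nbhs cg0); rewrite g0; exact: open_nbhs_nbhs.
have chx : cts_at h x by exact: within_open_cts oV ch Vx.
have H1 : \forall z \near x, V z by exact: open_nbhs_nbhs.
have H2 : \forall z \near x, eradius (h z) < e.
  have c := cts_comp chx (@cts_eradius K (h x)).
  by apply: (cts_near_lt (f := fun z => eradius (h z))); [exact: c | rewrite hx0 eradius0].
apply: filterS2 H1 H2 => z Vz hz t; have [tau [_ _ _ E]] := rot z Vz.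
rewrite -(gh _ (Vv t z Vz)) E; apply: He; rewrite subr0.
by apply: le_lt_trans (norm_le_eradius _) _; rewrite eradius_rot.
Qed.

End CenterStable.

(** * The equivalence, and its transfer to the orbit space *)

(** Each direction supplies closedness of the points and stability of the orbits, and then uses D:
    forwards to find the centers, backwards to separate orbits by balls of half their distance. *)
Lemma separated_iff_centers (K : realType) (S : topologicalType) (v : K -> S -> S) :
  hausdorff_space S -> compact [set: S] -> connected [set: S] ->
  (forall x : S, exists (U : set S) (f : S -> K * K) (g : K * K -> S) (r : K),
     chart U f g (f x) r /\ U x) ->
  continuous (fun p : K * S => v p.1 p.2) -> (forall x, v 0 x = x) ->
  (forall s t x, v (s + t) x = v s (v t x)) ->
  orbits_separated v <->
  (forall x, singular v x \/ exists2 T : K, 0 < T & v T x = x) /\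
  ((forall x, singular v x) \/
   ((forall x, singular v x -> rotation_center v x) /\
    exists a b : S, forall x, singular v x -> x = a \/ x = b)).
Proof.
move=> hS cS conS has_chart v_cont v0 vD; split=> [sep|[ac H]].
  have ac := separated_all_closed hS cS has_chart v_cont v0 vD sep.
  have st := separated_stable cS sep; split => //.
  have [all_s|/existsNP[y ny]] := pselect (forall x, singular v x); [by left | right].
  have [D [h1 h2 h3 h4 h5]] := exists_orbit_dist hS cS has_chart v_cont v0 vD ac st.
  exact: singular_centers hS cS has_chart v_cont v0 vD ac _ h1 h2 h3 h4 h5 conS _ ny.
have st x (U : set S) : open U -> (forall t, U (v t x)) -> \forall z \near x, forall t, U (v t z).
  move=> oU xU; have Ux : U x by rewrite -(v0 x).
  have [sx|nx] := pselect (singular v x); last exact: periodic_stable nx oU xU.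
  case: H => [all_s|[cen _]]; last by apply: center_stable => //; exact: cen.
  have : \forall z \near x, U z by exact: open_nbhs_nbhs.
  by apply: filterS => z Uz t; rewrite all_s.
have [D [h1 h2 h3 h4 h5]] := exists_orbit_dist hS cS has_chart v_cont v0 vD ac st.
by move=> x y; exact: orbit_dist_separated h1 h2 h3 _ _.
Qed.

(** Open sets of the orbit space correspond to invariant open sets of S, by preimage in one
    direction and by taking the orbits contained in the set in the other. *)
Lemma orbit_space_T2E (S : topologicalType) (v : R -> S -> S) : is_flow v ->
  orbit_space_T2 v <-> orbits_separated v.
Proof.
move=> [_ v0 vD].
have orbE x y : same_orbit v x y -> Defs.orbit v x = Defs.orbit v y.
  move=> [t <-]; rewrite predeqE => z; split=> -[u <-].
    by exists (u - t); rewrite -vD subrK.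
  by exists (u + t); rewrite vD.
have Eorb x y : Defs.orbit v x = Defs.orbit v y -> same_orbit v x y.
  move=> E; suff : Defs.orbit v x y by [].
  by rewrite E; exists 0.
split=> [T2 x y nxy|sep p q [x _ <-] [y _ <-] n].
  have [||n|A [B [oA oB Ax By AB]]] := T2 (Defs.orbit v x) (Defs.orbit v y).
  - by exists x.
  - by exists y.
  - by apply: nxy; exact: Eorb.
  have inv (C : set (set S)) t z : (Defs.orbit v @^-1` C) z -> (Defs.orbit v @^-1` C) (v t z).
    by rewrite /= -(orbE z (v t z)) //; exists t.
  exists (Defs.orbit v @^-1` A), (Defs.orbit v @^-1` B); split => //; try exact: inv.
  rewrite predeqE => z; split => // -[/= Az Bz].
  by suff : (A `&` B) (Defs.orbit v z) by rewrite AB.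
have [|A [B [[oA oB] Av Bv [Ax By] AB]]] := sep x y; first by move=> /orbE.
have pre (C : set S) : (forall t z, C z -> C (v t z)) ->
    Defs.orbit v @^-1` [set o | exists2 z, C z & o = Defs.orbit v z] = C.
  move=> Cv; rewrite predeqE => w; split=> [[z Cz /Eorb [t E]]|Cw]; last by exists w.
  have -> : w = v (- t) z by rewrite -E -vD addNr v0.
  exact: Cv.
exists [set o | exists2 z, A z & o = Defs.orbit v z], [set o | exists2 z, B z & o = Defs.orbit v z].
split; rewrite /orbit_space_open ?pre //; [by exists x | by exists y |].
rewrite predeqE => o; split => // -[[z Az ->] [w Bw /Eorb [t E]]].
suff : (A `&` B) w by rewrite AB.
by split => //; rewrite -E; exact: Av.
Qed.

Theorem theoremD (S : topologicalType) (v : R -> S -> S) :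
  is_surface S -> compact [set: S] -> connected [set: S] -> is_flow v ->
  (orbit_space_T2 v <->
   (forall x : S, closed_point v x) /\
   ((forall x : S, singular_pt v x) \/
    ((forall x : S, singular_pt v x -> center_pt v x) /\
     exists a b : S, forall x : S, singular_pt v x -> x = a \/ x = b))).
Proof.
move=> [hS _ charts] cS conS fl; have [v_cont v0 vD] := fl.
have has_chart x : exists (U : set S) (f : S -> R * R) (g : R * R -> S) (r : R),
    chart U f g (f x) r /\ U x.
  have [U [oU Ux [f [W [oW hom]]]]] := charts x.
  have [g [r ch]] := chart_of_homeo oU Ux oW hom.
  by exists U, f, g, r.
have H := separated_iff_centers hS cS conS has_chart v_cont v0 vD.
have cl : (forall x : S, closed_point v x) <->
    (forall x, singular v x \/ exists2 T : R, 0 < T & v T x = x).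
  split=> h x.
    by have [sx|[_ [T [T0 E]]]] := h x; [left | right; exists T].
  have [sx|nx] := pselect (singular_pt v x); first by left.
  by have [sx|[T T0 E]] := h x; [left | right; split => //; exists T].
rewrite orbit_space_T2E // H.
by split=> -[/cl h1 h2]; split => //; exact/cl.
Qed.
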